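(* Let $P\in\mathbb{R}[x_1,y_1,x_2,y_2]$ be an irreducible polynomial of degree at most $D$. Then there exists a variety $Y\subset\mathbb{C}^4$ of dimension at most two and degree bounded by a constant depending only on $D$, such that for every point $p\in \mathbf{Z}_{\mathbb{R}}(P)\setminus Y(\mathbb{R})$ there is at most one irreducible complex algebraic curve $\gamma\subset\mathbb{C}^2$ with $p\in\iota(\gamma)_{\mathrm{reg}}$ and $\iota(\gamma)\subset \mathbf{Z}_{\mathbb{R}}(P)$.
   Context: $\iota:\mathbb{C}^2\to\mathbb{R}^4$ is the identification $\iota(x_1+iy_1,x_2+iy_2)=(x_1,y_1,x_2,y_2)$ with $x_1,y_1,x_2,y_2\in\mathbb{R}$. $\mathbf{Z}_{\mathbb{R}}(P)\subset\mathbb{R}^4$ is the real zero set of $P$. For a complex variety $Y\subset\mathbb{C}^4$, $Y(\mathbb{R})=Y\cap\mathbb{R}^4$ is its set of real points. Varieties are (possibly reducible) Zariski closed sets; the degree of a reducible variety is the sum of the degrees of its irreducible components. For a complex curve $\gamma$, $\iota(\gamma)_{\mathrm{reg}}$ denotes the set of regular (nonsingular) points of the real variety $\iota(\gamma)$, which equals $\iota(\gamma_{\mathrm{reg}})$, the image of the nonsingular points of $\gamma$. *)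

(* Defs.v *)
From mathcomp Require Import all_boot all_algebra.
From mathcomp Require Import reals.
From mathcomp Require Import complex.
From mathcomp Require Import mpoly.

Set Implicit Arguments.
Unset Strict Implicit.
Unset Printing Implicit Defensive.

Import GRing.Theory.
Local Open Scope ring_scope.

Section AffineGeometry.
Variable K : fieldType.

Definition pt (n : nat) := 'I_n -> K.
Definition subset_of (n : nat) := pt n -> Prop.

Definition sub_set n (A B : subset_of n) := forall x, A x -> B x.
Definition strict_sub_set n (A B : subset_of n) :=
  sub_set A B /\ exists x, B x /\ ~ A x.

Definition zariski_closed n (S : subset_of n) :=
  exists F : seq {mpoly K[n]}, forall x, S x <-> (forall f, f \in F -> f.@[x] = 0).

Definition irreducible_variety n (S : subset_of n) :=
  [/\ zariski_closed S, exists x, S x &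
      forall A B : subset_of n, zariski_closed A -> zariski_closed B ->
        sub_set S (fun x => A x \/ B x) -> sub_set S A \/ sub_set S B].

Definition has_chain n (S : subset_of n) (k : nat) :=
  exists V : nat -> subset_of n,
    [/\ forall i, (i <= k)%N -> irreducible_variety (V i),
        forall i, (i < k)%N -> strict_sub_set (V i) (V i.+1) &
        sub_set (V k) S].

Definition dim_le n (S : subset_of n) (k : nat) := ~ has_chain S k.+1.
Definition dim_eq n (S : subset_of n) (k : nat) := has_chain S k /\ ~ has_chain S k.+1.

Definition card_eq n (S : subset_of n) (d : nat) :=
  exists f : 'I_d -> pt n, injective f /\ forall x, S x <-> exists i, f i = x.

Definition affine_subspace n k (A : 'M[K]_(k, n)) (b : 'cV[K]_k) : subset_of n :=
  fun x => A *m (\col_i x i) = b.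

(* Degree of an irreducible variety V of dimension k: the maximal number of
   points in a finite intersection of V with an affine subspace of dimension
   n - k (this maximum is attained by generic such subspaces). *)
Definition irr_degree n (V : subset_of n) (d : nat) :=
  exists k, [/\ dim_eq V k,
    (exists (A : 'M[K]_(k, n)) (b : 'cV[K]_k), row_free A /\
        card_eq (fun x => V x /\ affine_subspace A b x) d) &
    (forall (A : 'M[K]_(k, n)) (b : 'cV[K]_k) (e : nat), row_free A ->
        card_eq (fun x => V x /\ affine_subspace A b x) e -> (e <= d)%N)].

Definition component_decomposition n (Y : subset_of n) m (C : 'I_m -> subset_of n) :=
  [/\ forall i, irreducible_variety (C i),
      forall i j, i != j -> ~ sub_set (C i) (C j) &
      forall x, Y x <-> exists i, C i x].

Definition variety_degree n (Y : subset_of n) (d : nat) :=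
  exists m (C : 'I_m -> subset_of n) (ds : 'I_m -> nat),
    [/\ component_decomposition Y C, forall i, irr_degree (C i) (ds i) &
        d = (\sum_(i < m) ds i)%N].

Definition mpoly_const n (q : {mpoly K[n]}) := exists c : K, q = c%:MP.
Definition irreducible_mpoly n (p : {mpoly K[n]}) :=
  ~ mpoly_const p /\
  forall q r : {mpoly K[n]}, p = q * r -> mpoly_const q \/ mpoly_const r.

Definition irreducible_plane_curve (g : subset_of 2) :=
  irreducible_variety g /\ dim_eq g 1.

(* Regular (nonsingular) point of a plane curve g: g = Z(f) with f an
   irreducible polynomial (so f generates the ideal of g) and grad f (q) <> 0. *)
Definition regular_point (g : subset_of 2) (q : pt 2) :=
  g q /\ exists f : {mpoly K[2]}, [/\ irreducible_mpoly f,
     (forall z, g z <-> f.@[z] = 0) & exists i : 'I_2, (f^`M(i)).@[q] != 0].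

End AffineGeometry.

Section RealComplex.
Variable R : realType.
Local Open Scope complex_scope.

(* iota : C^2 -> R^4, (x1 + i y1, x2 + i y2) |-> (x1, y1, x2, y2) *)
Definition iotaC (z : pt R[i] 2) : 'I_4 -> R :=
  fun j => let k : 'I_2 := inord (j %/ 2) in
           if odd j then Im (z k) else Re (z k).

Definition complexify (p : 'I_4 -> R) : pt R[i] 4 := fun j => Complex (p j) 0.

Definition real_zero_set (P : {mpoly R[4]}) (p : 'I_4 -> R) := P.@[p] = 0.

End RealComplex.

(* Main.v *)
(* A real polynomial [P] on C^2 = R^4 becomes, in the coordinates z and its
   conjugate, a polynomial G (z, w) on C^2 x C^2 with P (iota z) = G (z, conj z).
   If P vanishes on an irreducible curve g, then G vanishes on the pairs
   (z, conj w) with z and w in g: the product of g and its conjugate is irreducible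
   and finite over a plane in which the points (conj t, t) are Zariski dense, so the
   norm of G vanishes identically. Hence g is a component of the Segre variety
   G (., conj q) = 0 for every q in g. Two distinct curves through q give two factors
   of G (., conj q) vanishing at q, so all the partial derivatives of P vanish at
   iota q.

   It remains to enclose the singular points of P = 0 in a surface. After linear
   changes of coordinates, P is monic in one variable and its discriminant, which is
   nonzero since P is irreducible, is monic in the next one; their common zero set Y
   is finite over C^2. The components of Y have dimension two and their number is
   at most the degree of the cover. Each of them is cut out by polynomials of bounded
   degree, factors of characteristic polynomials of linear forms, and Bezout's theorem
   in a plane section bounds its degree. *)
From HB Require Import structures.
Require Import Defs.
From mathcomp Require Import all_boot all_order all_algebra.
From mathcomp Require Import perm ring mpoly boolp reals complex.
Set Implicit Arguments.
Unset Strict Implicit.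
Unset Printing Implicit Defensive.
Import Order.TTheory GRing.Theory Num.Theory.
Local Open Scope ring_scope.

(** * Norms and unique factorization *)

(** One tool carries the algebra: the norm of [w] modulo a monic polynomial, defined as a
    determinant. It commutes with base change, over a closed field it is the product of the values
    of [w] at the roots, its vanishing over a domain yields a divisibility, and its degree is
    explicitly bounded. The discriminant, characteristic polynomials, Bezout's bound and the
    Nullstellensatz for a hypersurface are all read off from it. The obstacle is the degree. It is a
    maximum over all finite plane sections, so counting a generic fibre says nothing about special
    planes: each component needs its own equations of bounded degree, although noetherianity
    produces the components only abstractly. Keeping multiplicities in the fibres makes
    characteristic polynomials exist over the whole base and excludes components of smaller
    dimension. [P] is irreducible over the reals and may split over the complex numbers; the
    discriminant is therefore formed over the reals and extended afterwards. *)

Section Norm.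
Variable A : comNzRingType.

(** The size is a separate argument because [horner_mx] asks for the form [n.+1], which the size
    [(size p).-1] of [companionmx] does not have syntactically. *)
Definition companion n (p : {poly A}) : 'M[A]_n.+1 :=
  \matrix_(i, j) if i == n :> nat then - p`_j else (i.+1 == j :> nat)%:R.

(* The norm of [w] from [A[X]/(p)] to [A], for [p] monic: up to sign, the resultant
   of [p] and [w]. *)
Definition normp (p w : {poly A}) : A :=
  \det (horner_mx (companion (size p).-2 p) w).

Lemma char_poly_companion n (p : {poly A}) :
  p \is monic -> size p = n.+2 -> char_poly (companion n p) = p.
Proof.
move=> pm sp; have := companionmxK pm; rewrite /companionmx /companion.
by rewrite sp.
Qed.

Lemma delta_companion_exp n (p : {poly A}) (i : nat) (lt_i : (i < n.+1)%N) :
  delta_mx 0 ord0 *m companion n p ^+ i = delta_mx 0 (Ordinal lt_i) :> 'rV_n.+1.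
Proof.
elim: i lt_i => [|i IH] lt_i.
  by rewrite expr0 mulmx1; congr delta_mx; apply: val_inj.
rewrite exprSr mulmxA (IH (ltnW lt_i)) -rowE; apply/rowP => j.
by rewrite !mxE ltn_eqF //= eq_sym.
Qed.

(** The companion matrix shifts the basis, so the first basis row is a cyclic vector, and its image
    recovers the coefficients of a polynomial of small degree. *)
Lemma delta_horner_companion n (p : {poly A}) (v : 'rV_n.+1) :
  delta_mx 0 ord0 *m horner_mx (companion n p) (rVpoly v) = v.
Proof.
rewrite [rVpoly v]poly_def linear_sum /= mulmx_sumr.
rewrite [RHS]row_sum_delta; apply: eq_bigr => i _.
rewrite linearZ /= rmorphXn /= horner_mx_X -scalemxAr.
by rewrite delta_companion_exp; case: i => i li; rewrite insubT.
Qed.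

End Norm.

Lemma normp_map (A B : comNzRingType) (f : {rmorphism A -> B}) (p w : {poly A}) :
  p \is monic -> normp (map_poly f p) (map_poly f w) = f (normp p w).
Proof.
move=> pm; rewrite /normp -det_map_mx map_horner_mx.
rewrite size_map_poly_id0 ?(monicP pm) ?rmorph1 ?oner_eq0 //.
congr (\det (horner_mx _ _)); apply/matrixP => i j; rewrite !mxE /=.
by rewrite (fun_if f) rmorphN coef_map rmorph_nat.
Qed.

(** Both sides are multiplicative in [w], which splits into linear factors; for [X - t] the
    determinant is, up to sign, the characteristic polynomial at [t]. The list is nonempty because
    the companion matrix has at least one row, so the norm modulo 1 is not the empty product. *)
Lemma normp_prod (F : closedFieldType) (rs : seq F) (w : {poly F}) :
  rs != [::] -> normp (\prod_(r <- rs) ('X - r%:P)) w = \prod_(r <- rs) w.[r].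
Proof.
move=> rs0; set p := \prod_(r <- rs) _.
have pm : p \is monic by apply: monic_prod => i _; exact: monicXsubC.
have sp : size p = (size rs).-1.+2.
  by rewrite size_prod_XsubC; case: (rs) rs0.
rewrite /normp sp /=; set n := (size rs).-1; set C := companion n p.
have detC t : \det (C - t%:M) = \prod_(r <- rs) (r - t).
  have := char_poly_companion pm sp; rewrite -/n -/C => cC.
  have -> : C - t%:M = - (t%:M - C) by rewrite opprB.
  rewrite -scaleN1r detZ.
  have <- : (char_poly C).[t] = \det (t%:M - C).
    rewrite /char_poly -horner_evalE -det_map_mx; congr (\det _).
    by apply/matrixP => i j; rewrite !mxE /= horner_evalE !hornerE hornerMn hornerX.
  rewrite cC /p horner_prod.
  have -> : n.+1 = size rs by move: rs0; rewrite /n; case: (rs).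
  elim: (rs) => [|r s IH]; first by rewrite !big_nil mulr1.
  rewrite !big_cons -IH !hornerE /= exprS.
  by rewrite mulN1r mulNr [_ * (t - r)]mulrC -mulNr opprB.
have [us ->] : exists us, w = lead_coef w *: \prod_(u <- us) ('X - u%:P).
  by have [us] := closed_field_poly_normal w; exists us.
set c := lead_coef w; rewrite linearZ /= -mul_scalar_mx det_mulmx det_scalar.
under [RHS]eq_bigr do rewrite hornerZ.
rewrite big_split /= big_const_seq count_predT iter_mulr_1.
have <- : n.+1 = size rs by move: rs0; rewrite /n; case: (rs).
congr (_ * _); rewrite rmorph_prod /=.
have -> : \det (\prod_(u <- us) horner_mx C ('X - u%:P)) =
          \prod_(u <- us) \prod_(r <- rs) (r - u).
  elim: us => [|u us IH]; first by rewrite !big_nil det1.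
  rewrite !big_cons det_mulmx IH; congr (_ * _).
  by rewrite rmorphB /= horner_mx_X horner_mx_C detC.
rewrite exchange_big /=; apply: eq_bigr => r _.
by rewrite horner_prod; apply: eq_bigr => u _; rewrite !hornerE.
Qed.

(** A vanishing determinant gives a row [v] killed by [w] at the companion matrix. Read as a
    polynomial, [v] times [w] kills the cyclic vector, hence is zero at the matrix. So is its
    remainder modulo [p], which is too short for that unless it is zero. *)
Lemma normp_eq0_dvd (A : idomainType) (p w : {poly A}) :
  p \is monic -> (1 < size p)%N -> normp p w = 0 ->
  exists v q : {poly A}, [/\ v != 0, (size v < size p)%N & v * w = q * p].
Proof.
move=> pm sp /eqP; rewrite /normp; case sE: (size p) sp => [|[|n]] //= _.
case/det0P => v v0 vw; set C := companion n p.
have comC a b : horner_mx C a *m horner_mx C b = horner_mx C (a * b).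
  by rewrite rmorphM.
have e0v : delta_mx 0 ord0 *m horner_mx C (rVpoly v * w) = 0 :> 'rV_n.+1.
  by rewrite -comC mulmxA delta_horner_companion.
have vw0 : horner_mx C (rVpoly v * w) = 0.
  apply/row_matrixP => i; rewrite row0 rowE.
  have <- := delta_horner_companion p (delta_mx 0 i).
  by rewrite -mulmxA comC mulrC -comC mulmxA e0v mul0mx.
have [q [r [ewv sr]]] : exists q r, rVpoly v * w = q * p + r /\ (size r <= n.+1)%N.
  exists (Pdiv.Ring.rdivp (rVpoly v * w) p), (Pdiv.Ring.rmodp (rVpoly v * w) p).
  rewrite -Pdiv.RingMonic.rdivp_eq // -ltnS -sE.
  by rewrite Pdiv.Ring.ltn_rmodpN0 ?monic_neq0.
exists (rVpoly v), q; split.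
- by apply: contra_neq v0 => h; rewrite -[v]rVpolyK h linear0.
- by rewrite ltnS size_poly.
have C0 : horner_mx C p = 0.
  by rewrite -[in X in horner_mx _ X](char_poly_companion pm sE) Cayley_Hamilton.
rewrite ewv; suff -> : r = 0 by rewrite addr0.
move: vw0; rewrite ewv rmorphD rmorphM /= C0 mulr0 add0r => r0.
have := delta_horner_companion p (poly_rV r : 'rV_n.+1).
by rewrite poly_rV_K // r0 mulmx0 => /(congr1 rVpoly); rewrite poly_rV_K // linear0.
Qed.

Section Factorial.
Variable A : idomainType.
Implicit Types a b c p : A.

Definition divides a b := exists c, b = c * a.

Definition prime_elt p :=
  [/\ p != 0, p \isn't a GRing.unit &
      forall a b, divides p (a * b) -> divides p a \/ divides p b].

Definition prime_product a :=
  exists u s, [/\ u \is a GRing.unit, forall p, p \in s -> prime_elt p &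
                  a = u * \prod_(p <- s) p].

(** The factors are prime, not merely irreducible, so a factorization is unique as soon as it
    exists. *)
Definition factorial_domain := forall a, a != 0 -> prime_product a.

Lemma divides_mull a b c : divides a b -> divides a (c * b).
Proof. by case=> d ->; exists (c * d); rewrite mulrA. Qed.

Lemma divides_mulr a b c : divides a b -> divides a (b * c).
Proof. by rewrite mulrC; apply: divides_mull. Qed.

Lemma dividesD a b c : divides a b -> divides a c -> divides a (b + c).
Proof. by case=> d -> [e ->]; exists (d + e); rewrite mulrDl. Qed.

Lemma dividesN a b : divides a b -> divides a (- b).
Proof. by case=> d ->; exists (- d); rewrite mulNr. Qed.

Lemma divides_unit a u : divides a u -> u \is a GRing.unit -> a \is a GRing.unit.
Proof. by case=> d ->; rewrite unitrM => /andP[]. Qed.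

Lemma prime_divides_prod p (s : seq A) : prime_elt p ->
  divides p (\prod_(q <- s) q) -> exists2 q, q \in s & divides p q.
Proof.
case=> _ pu pp; elim: s => [|q s IH].
  by rewrite big_nil => h; case/negP: pu; apply: divides_unit h _; rewrite unitr1.
rewrite big_cons => /pp[h|/IH[r rs h]].
  by exists q; rewrite ?mem_head.
by exists r; rewrite ?inE ?rs ?orbT.
Qed.

Lemma prime_productM a b :
  prime_product a -> prime_product b -> prime_product (a * b).
Proof.
move=> [u [s [uu ps ->]]] [v [t [vu pt ->]]].
exists (u * v), (s ++ t); split.
- by rewrite unitrM uu.
- by move=> p; rewrite mem_cat => /orP[/ps|/pt].
- by rewrite big_cat mulrACA.
Qed.

Lemma prime_product1 p : prime_elt p -> prime_product p.
Proof.
move=> pp; exists 1, [:: p]; split; first exact: unitr1.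
- by move=> q; rewrite inE => /eqP ->.
- by rewrite big_seq1 mul1r.
Qed.

Lemma prime_product_unit u : u \is a GRing.unit -> prime_product u.
Proof. by move=> uu; exists u, [::]; split=> //; rewrite big_nil mulr1. Qed.

End Factorial.

(** * Gauss's lemma: unique factorization passes to polynomials *)

Section Gauss.
Variable A : idomainType.
Implicit Types (p c : A) (f g h k : {poly A}).

Lemma divides_coef p f i : divides p%:P f -> divides p f`_i.
Proof. by case=> g ->; rewrite coefMC; exists g`_i. Qed.

Lemma polyC_unitE p : (p%:P \is a GRing.unit) = (p \is a GRing.unit).
Proof.
rewrite poly_unitE size_polyC coefC eqxx.
by have [->|] := eqVneq p 0; rewrite ?unitr0.
Qed.

Lemma prime_polyC p : prime_elt p -> prime_elt p%:P.
Proof.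
case=> p0 pu pp; split; rewrite ?polyC_eq0 ?polyC_unitE //.
suff H n f g : (size f + size g <= n)%N -> divides p%:P (f * g) ->
    divides p%:P f \/ divides p%:P g by move=> f g; apply: (H _ _ _ (leqnn _)).
elim: n f g => [|n IH] f g.
  rewrite leqn0 addn_eq0 size_poly_eq0 => /andP[/eqP-> _] _; left.
  by exists 0; rewrite mul0r.
move=> hn hfg; have [->|f0] := eqVneq f 0; first by left; exists 0; rewrite mul0r.
have [->|g0] := eqVneq g 0; first by right; exists 0; rewrite mul0r.
have rd (k : {poly A}) : k != 0 -> divides p (lead_coef k) ->
  exists k', (size k' < size k)%N /\ divides p%:P (k - k').
  move=> k0 hk; exists (k - (lead_coef k)%:P * 'X^((size k).-1)); split.
  - rewrite (polySpred k0) ltnS; apply/leq_sizeP => j.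
    rewrite leq_eqVlt coefB coefCM coefXn => /predU1P[<-|hj].
      by rewrite eqxx mulr1 subrr.
    by rewrite gtn_eqF // mulr0 subr0 nth_default // (polySpred k0).
  - rewrite opprB addrC subrK; apply: divides_mulr.
    by case: hk => c ->; exists c%:P; rewrite polyCM.
have /pp : divides p (lead_coef f * lead_coef g).
  by rewrite -lead_coefM; apply: divides_coef.
case=> [/(rd _ f0)|/(rd _ g0)] [k [sk dk]].
  have /IH : divides p%:P (k * g).
    have -> : k * g = f * g - (f - k) * g by rewrite mulrBl opprB addrC subrK.
    by apply: dividesD => //; apply/dividesN/divides_mulr.
  case=> [|h|]; last by right.
    by rewrite -ltnS (leq_trans _ hn) // ltn_add2r.
  by left; rewrite -(subrK k f); apply: dividesD.
have /IH : divides p%:P (f * k).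
  have -> : f * k = f * g - f * (g - k) by rewrite mulrBr opprB addrC subrK.
  by apply: dividesD => //; apply/dividesN/divides_mull.
case=> [||h]; last 1 first.
- by right; rewrite -(subrK k g); apply: dividesD.
- by rewrite -ltnS (leq_trans _ hn) // ltn_add2l.
- by left.
Qed.

Hypothesis factA : factorial_domain A.

Definition primitive f := forall p, prime_elt p -> ~ divides p%:P f.

(** The prime factors of [c] stay prime as constant polynomials, so each one divides [f] or [g] and
    is moved out of it; the unit part goes to [f]. *)
Lemma gauss_split c k f g : c != 0 -> c *: k = f * g ->
  exists a b f' g', [/\ a != 0, b != 0, f = a *: f', g = b *: g' & k = f' * g'].
Proof.
move=> c0; have [u [s [uu ps ce]]] := factA c0.
have s0 : \prod_(p <- s) p != 0.
  by apply: contra_neq c0; rewrite ce => ->; rewrite mulr0.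
rewrite ce -scalerA => e.
have e0 : (\prod_(p <- s) p) *: k = (u^-1 *: f) * g.
  by rewrite -scalerAl -e (scalerA u^-1 u) mulVr // scale1r.
have : exists a b f' g', [/\ a != 0, b != 0, u^-1 *: f = a *: f', g = b *: g' & k = f' * g'].
  move: (u^-1 *: f) e0 => {ce e c0 u uu}f.
  elim: s f g ps s0 => [|p s IH] f g ps.
    rewrite big_nil scale1r => _ ->; exists 1, 1, f, g.
    by rewrite oner_neq0 !scale1r.
  rewrite big_cons mulf_eq0 negb_or => /andP[p0 s0] e.
  have pp : prime_elt p by apply: ps; rewrite mem_head.
  have ps' q : q \in s -> prime_elt q by move=> qs; apply: ps; rewrite inE qs orbT.
  have [_ _ /(_ f g)] := prime_polyC pp.
  case=> [|[h hf]|[h hg]].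
  - by rewrite -e -scalerA -mul_polyC mulrC; eexists.
  - have eh : (\prod_(q <- s) q) *: k = h * g.
      apply: (mulfI (x := p%:P)); first by rewrite polyC_eq0.
      by rewrite mul_polyC scalerA e hf mulrA [h * _]mulrC.
    have [a [b [f' [g' [a0 b0 eh1 -> ->]]]]] := IH _ _ ps' s0 eh.
    exists (p * a), b, f', g'; split=> //; first by rewrite mulf_neq0.
    by rewrite hf eh1 mulrC mul_polyC scalerA.
  - have eh : (\prod_(q <- s) q) *: k = f * h.
      apply: (mulfI (x := p%:P)); first by rewrite polyC_eq0.
      by rewrite mul_polyC scalerA e hg mulrA mulrC.
    have [a [b [f' [g' [a0 b0 -> eh1 ->]]]]] := IH _ _ ps' s0 eh.
    exists a, (p * b), f', g'; split=> //; first by rewrite mulf_neq0.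
    by rewrite hg eh1 mulrC mul_polyC scalerA.
case=> a [b [f' [g' [a0 b0 ef -> ->]]]]; exists (u * a), b, f', g'; split=> //.
  by rewrite mulf_neq0 // (contraTneq _ uu) // => ->; rewrite unitr0.
by rewrite -scalerA -ef scalerA mulrV // scale1r.
Qed.

(** [gauss_split] distributes [c] over the two factors; the share of [f] has no prime factor by
    primitivity, so it is a unit. *)
Lemma primitive_divides c k f : primitive f -> c != 0 -> divides f (c *: k) ->
  divides f k.
Proof.
move=> pf c0 [g] /(gauss_split c0)[a [b [g' [f' [a0 b0 _ ef ->]]]]].
have [u [s [uu ps be]]] := factA b0.
case: s ps be => [|p s] ps be; last first.
  case: (pf p); first by apply: ps; rewrite mem_head.
  rewrite ef be big_cons; exists ((u * \prod_(q <- s) q) *: f').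
  by rewrite [RHS]mulrC mul_polyC scalerA mulrCA.
rewrite big_nil mulr1 in be; exists (u^-1 *: g').
by rewrite ef be -scalerAr scalerAl scalerA mulrV // scale1r.
Qed.

(** Over the fraction field [f] is irreducible, so its gcd with [g] is constant or [f] itself.
    Pseudo-division expresses both cases up to a constant factor, which [primitive_divides]
    removes. *)
Lemma primitive_prime f : primitive f -> (1 < size f)%N ->
  (forall g h, f = g * h -> (size g <= 1)%N \/ (size h <= 1)%N) -> prime_elt f.
Proof.
move=> pf sf irrf; have f0 : f != 0 by rewrite -size_poly_gt0 (ltn_trans _ sf).
split=> //.
  by rewrite poly_unitE negb_and neq_ltn sf orbT.
move=> g h fgh; set d := gcdp f g.
have [[c e] /= c0 cf] := Pdiv.Idomain.dvdpP _ _ (dvdp_gcdl f g).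
have [a [b [e' [d' [a0 b0 ee ed ef]]]]] := gauss_split c0 cf.
have [se|sd] := irrf _ _ ef; last first.
  have : coprimep f g.
    rewrite /coprimep; move: sd; rewrite -(size_scale d' b0) -ed.
    by rewrite leq_eqVlt ltnS leqn0 size_poly_eq0 gcdp_eq0 (negPf f0) orbF.
  case/Bezout_coprimepP => -[u v] /=; rewrite -size_poly_eq1 => /size_poly1P[k k0 ek].
  right; apply: (primitive_divides pf k0).
  rewrite -mul_polyC -ek mulrDl; apply: dividesD.
    by exists (u * h); rewrite mulrAC.
  by rewrite -mulrA; apply: divides_mull.
left; have [[c' e2] /= c'0 cg] := Pdiv.Idomain.dvdpP _ _ (dvdp_gcdr f g).
have /size_poly1P[k k0 ek] : size e' == 1%N.
  rewrite eqn_leq se size_poly_gt0; apply: contra_neq f0.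
  by rewrite ef => ->; rewrite mul0r.
apply: (primitive_divides (c := c' * k)) => //; first by rewrite mulf_neq0.
rewrite mulrC -scalerA cg; exists (b *: e2).
by rewrite ed ef ek -!scalerAl -!scalerAr mulrCA mul_polyC scalerA mulrC -scalerA.
Qed.

(** Primes of the leading coefficient that divide [f] are split off one at a time. When none is left
    [f] is primitive, hence a unit, a prime, or a product of two factors of smaller degree. *)
Lemma factorial_poly : factorial_domain {poly A}.
Proof.
move=> f; move: {2}(size f) (leqnn (size f)) => n; elim: n f => [|n IH] f.
  by rewrite leqn0 size_poly_eq0 => /eqP->; rewrite eqxx.
have base (u : A) (s : seq A) (g : {poly A}) : u \is a GRing.unit ->
    (forall p, p \in s -> prime_elt p) -> lead_coef g = u * \prod_(p <- s) p ->
    (size g <= n.+1)%N -> g != 0 ->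
    ~ (exists2 p, p \in s & divides p%:P g) -> prime_product g.
  move: g => {}f uu ps ce sf f0 nps; have pf : primitive f.
    (* A prime constant dividing [f] divides the leading coefficient, so it is associated to a
       member of [s]. *)
    move=> p pp hpf; have [p0 pu _] := pp.
    have := divides_coef (size f).-1 hpf; rewrite -lead_coefE ce => -[v hv].
    have /(prime_divides_prod pp)[q qs [w hw]] : divides p (\prod_(q <- s) q).
      exists (u^-1 * v); apply: (mulrI uu).
      by rewrite hv !mulrA mulrV // mul1r.
    apply: nps; exists q => //.
    have [q0 qu qq] := ps _ qs.
    case: (qq w p); first by exists 1; rewrite mul1r hw.
      case=> t ht; case/negP: pu.
      have /(mulIf q0) e1 : t * p * q = 1 * q by rewrite mul1r {2}hw ht mulrAC.
      by apply/unitrPr; exists t; rewrite mulrC.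
    case=> t ht; case: hpf => g ->; exists (g * t%:P).
    by rewrite ht polyCM mulrA.
  have [sf1|sf1] := leqP (size f) 1.
    have /size_poly1P[c c0 ef] : size f == 1%N by rewrite eqn_leq sf1 size_poly_gt0.
    case: s ps ce {nps} => [|p s] ps ce; last first.
      case: (pf p); first by apply: ps; rewrite mem_head.
      rewrite ef; move: ce; rewrite ef lead_coefC big_cons => ->.
      by exists (u * \prod_(q <- s) q)%:P; rewrite -polyCM mulrCA mulrC.
    apply: prime_product_unit; rewrite ef polyC_unitE; move: ce.
    by rewrite ef lead_coefC big_nil mulr1 => ->.
  have [[g [h [e /negP sg /negP sh]]]|irr] :=
      pselect (exists g h, [/\ f = g * h, ~ (size g <= 1)%N & ~ (size h <= 1)%N]).
    rewrite -!ltnNge in sg sh.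
    have g0 : g != 0 by rewrite -size_poly_gt0 (ltn_trans _ sg).
    have h0 : h != 0 by rewrite -size_poly_gt0 (ltn_trans _ sh).
    move: sf; rewrite e size_mul // => sgh.
    apply: prime_productM; apply: IH => //; move: sg sh sgh;
      case: (size g) => [|[|a]] //; case: (size h) => [|[|b]] // _ _ /=.
    - by rewrite !addnS ltnS => /(leq_trans _); apply; rewrite ltnS leq_addr.
    - by rewrite !addnS ltnS => /(leq_trans _); apply; rewrite !addSn !ltnS leq_addl.
  apply/prime_product1/primitive_prime => // g h e.
  apply: contrapT => ngh; apply: irr; exists g, h; split=> //.
    by move=> sg; apply: ngh; left.
  by move=> sh; apply: ngh; right.
move=> sf f0; have [u [s [uu ps ce]]] : prime_product (lead_coef f).
  by apply: factA; rewrite lead_coef_eq0.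
move: {2}(size s) (erefl (size s)) => m es.
elim: m s es u uu ps f f0 sf ce => [|m IHm] s es u uu ps f f0 sf ce.
  by apply: (base u s) => // -[p]; case: (s) es.
have [[p psi [f' ef]]|] := pselect (exists2 p, p \in s & divides p%:P f); last by apply: (base u s).
have pp := ps _ psi; have p0 : p != 0 by have [] := pp.
have f'0 : f' != 0 by apply: contra_neq f0; rewrite ef => ->; rewrite mul0r.
rewrite ef; apply: prime_productM; last exact/prime_product1/prime_polyC.
apply: (IHm (rem p s) _ u) => //.
- by rewrite size_rem // es.
- by move=> q /mem_rem; apply: ps.
- by move: sf; rewrite ef mulrC mul_polyC size_scale.
apply: (mulIf p0); move: ce.
rewrite ef lead_coefM lead_coefC => ->.
by rewrite (perm_big _ (perm_to_rem psi)) big_cons /= mulrCA mulrC.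
Qed.
End Gauss.

Section Transfer.
Variables (A B : idomainType) (f : {rmorphism A -> B}) (g : {rmorphism B -> A}).
Hypotheses (fK : cancel f g) (gK : cancel g f).

Lemma prime_transfer p : prime_elt p -> prime_elt (f p).
Proof.
case=> p0 pu pp; split.
- by apply: contra_neq p0 => e; rewrite -(fK p) e rmorph0.
- by apply: contra pu => u; rewrite -(fK p) rmorph_unit.
- move=> a b [c e]; have : divides p (g a * g b).
    by exists (g c); rewrite -rmorphM e rmorphM fK.
  by case/pp => -[d h]; [left|right]; exists (f d); rewrite -rmorphM -h gK.
Qed.

Lemma factorial_transfer : factorial_domain A -> factorial_domain B.
Proof.
move=> fA b b0; have [|u [s [uu ps e]]] := fA (g b).
  by apply: contra_neq b0 => e; rewrite -(gK b) e rmorph0.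
exists (f u), (map f s); split.
- exact: rmorph_unit.
- by move=> p /mapP[q qs ->]; apply/prime_transfer/ps.
- by rewrite big_map -rmorph_prod -rmorphM -e gK.
Qed.
End Transfer.

(** * Multivariate polynomials *)

Section Snoc.
Variables (T : Type) (n : nat).

Definition widen1 : 'I_n -> 'I_n.+1 := widen_ord (leqnSn n).
Definition init (x : 'I_n.+1 -> T) : 'I_n -> T := fun i => x (widen1 i).
Definition snoc (a : 'I_n -> T) (t : T) : 'I_n.+1 -> T :=
  fun i => if unlift ord_max i is Some j then a j else t.

Lemma widen1E (i : 'I_n) : widen1 i = lift ord_max i.
Proof. by apply: val_inj; rewrite /= /bump leqNgt ltn_ord. Qed.

Lemma snoc_widen a t i : snoc a t (widen1 i) = a i.
Proof. by rewrite /snoc widen1E liftK. Qed.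

Lemma snoc_max a t : snoc a t ord_max = t.
Proof. by rewrite /snoc unlift_none. Qed.

Lemma snocK a t : init (snoc a t) = a.
Proof. by apply/funext => i; rewrite /init snoc_widen. Qed.

Lemma snoc_init x : snoc (init x) (x ord_max) = x.
Proof.
apply/funext => i; rewrite /snoc; case: unliftP => [j ->|->] //.
by rewrite /init widen1E.
Qed.

Lemma ord_maxVwiden (i : 'I_n.+1) : i = ord_max \/ exists j, i = widen1 j.
Proof.
case: (unliftP ord_max i) => [j ->|->]; last by left.
by right; exists j; rewrite widen1E.
Qed.

End Snoc.

Section MpolyRing.
Variable R : comNzRingType.

Lemma mpoly_rmorph_ext n (S : nzRingType) (f g : {rmorphism {mpoly R[n]} -> S}) :
  (forall c, f c%:MP = g c%:MP) -> (forall i, f 'X_i = g 'X_i) -> f =1 g.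
Proof.
move=> hC hX p; rewrite [p]mpolyE !rmorph_sum /=; apply: eq_bigr => m _.
rewrite -mul_mpolyC !rmorphM /= hC; congr (_ * _).
rewrite mpolyXE_id !rmorph_prod /=; apply: eq_bigr => i _.
by rewrite !rmorphXn /= hX.
Qed.

Lemma muni_widen n (i : 'I_n) : muni ('X_(widen1 i) : {mpoly R[n.+1]}) = ('X_i)%:P.
Proof.
rewrite muniE msuppX big_seq1 mcoeffX eqxx scale1r mnm1E.
rewrite -val_eqE /= ltn_eqF // expr0 -alg_polyC; congr (_%:A).
congr 'X_[_]; apply/mnmP => j; rewrite mnmE !mnm1E.
by rewrite -!val_eqE.
Qed.

Lemma muni_max n : muni ('X_ord_max : {mpoly R[n.+1]}) = 'X.
Proof.
rewrite muniE msuppX big_seq1 mcoeffX eqxx scale1r mnm1E eqxx expr1.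
rewrite (_ : [multinom _ | _ < _] = 0%MM) ?mpolyX0 ?scale1r //.
apply/mnmP => j; rewrite mnmE mnm1E mnm0E -val_eqE /=.
by rewrite gtn_eqF.
Qed.

Definition munV n : {poly {mpoly R[n]}} -> {mpoly R[n.+1]} :=
  horner_eval 'X_ord_max \o map_poly (@mwiden n R).
HB.instance Definition _ n := GRing.RMorphism.on (@munV n).

Lemma muniK n : cancel (@muni n R) (@munV n).
Proof.
apply: (mpoly_rmorph_ext (f := @munV n \o @muni n R) (g := idfun)) => [c|i] /=.
  by rewrite muniC /munV /= map_polyC /horner_eval hornerC /= mwidenC.
have [->|[j ->]] := ord_maxVwiden i.
  by rewrite muni_max /munV /= map_polyX /horner_eval hornerX.
rewrite muni_widen /munV /= map_polyC /horner_eval hornerC /=.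
by rewrite /mwiden mmapX mmap1U.
Qed.

Lemma muni_mwiden n (p : {mpoly R[n]}) : muni (mwiden p) = p%:P.
Proof.
apply: (mpoly_rmorph_ext (f := @muni n R \o @mwiden n R) (g := @polyC _)) => [c|i] /=.
  by rewrite mwidenC muniC.
by rewrite /mwiden mmapX mmap1U muni_widen.
Qed.

Lemma munVK n : cancel (@munV n) (@muni n R).
Proof.
move=> q; elim/poly_ind: q => [|q c IH]; first by rewrite !rmorph0.
rewrite !rmorphD !rmorphM /= IH; congr (_ * _ + _).
  by rewrite /munV /= map_polyX /horner_eval hornerX muni_max.
by rewrite /munV /= map_polyC /horner_eval hornerC muni_mwiden.
Qed.

Lemma muni_eval n (w : {mpoly R[n.+1]}) x :
  w.@[x] = (map_poly (meval (init x)) (muni w)).[x ord_max].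
Proof.
pose g := horner_eval (x ord_max) \o map_poly (meval (init x)) \o @muni n R.
apply: (mpoly_rmorph_ext (f := meval x) (g := g)) => [c|i] /=.
  by rewrite mevalC /g /= muniC map_polyC /horner_eval hornerC /= mevalC.
rewrite mevalXU /g /=; have [->|[j ->]] := ord_maxVwiden i.
  by rewrite muni_max map_polyX /horner_eval hornerX.
by rewrite muni_widen map_polyC /horner_eval hornerC /= mevalXU.
Qed.

Lemma munV_eval n (q : {poly {mpoly R[n]}}) x :
  (munV q).@[x] = (map_poly (meval (init x)) q).[x ord_max].
Proof. by rewrite muni_eval munVK. Qed.

End MpolyRing.

Lemma mpoly0_const (R : nzRingType) (p : {mpoly R[0]}) : p = (p@_0)%:MP.
Proof.
apply/mpolyP => m; have -> : m = 0%MM by apply/mnmP => -[].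
by rewrite mcoeffC eqxx mulr1.
Qed.

Section FieldMpoly.
Variable F : fieldType.

Lemma factorial_mpoly n : factorial_domain {mpoly F[n]}.
Proof.
elim: n => [|n IH].
  move=> p p0; apply: prime_product_unit; rewrite (mpoly0_const p) rmorph_unit //.
  by rewrite unitfE; apply: contra_neq p0 => e; rewrite (mpoly0_const p) e.
exact: (factorial_transfer (@munVK F n) (@muniK F n) (factorial_poly IH)).
Qed.

(** [msize] is the degree plus one, and 0 for the zero polynomial, so zero satisfies every bound. *)
Definition degle n d (p : {mpoly F[n]}) := (msize p <= d.+1)%N.

Lemma degleW n d e (p : {mpoly F[n]}) : (d <= e)%N -> degle d p -> degle e p.
Proof. by move=> de h; apply: leq_trans h _. Qed.

Lemma degleD n d (p q : {mpoly F[n]}) : degle d p -> degle d q -> degle d (p + q).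
Proof.
by rewrite /degle => hp hq; apply: leq_trans (mmeasureD_le _ _ _) _; rewrite geq_max hp.
Qed.

Lemma degleN n d (p : {mpoly F[n]}) : degle d p -> degle d (- p).
Proof. by rewrite /degle msizeN. Qed.

Lemma degle0 n d : degle d (0 : {mpoly F[n]}).
Proof. by rewrite /degle msize0. Qed.

Lemma degleC n d c : degle d (c%:MP : {mpoly F[n]}).
Proof. by rewrite /degle msizeC; case: (c == 0). Qed.

Lemma degleX n (i : 'I_n) : degle 1 ('X_i : {mpoly F[n]}).
Proof. by rewrite /degle msizeX mdeg1. Qed.

Lemma degleM n d e (p q : {mpoly F[n]}) :
  degle d p -> degle e q -> degle (d + e) (p * q).
Proof.
rewrite /degle; have [->|p0] := eqVneq p 0; first by rewrite mul0r msize0.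
have [->|q0] := eqVneq q 0; first by rewrite mulr0 msize0.
rewrite msizeM // => hp hq; rewrite -subn1 leq_subLR add1n.
by apply: leq_trans (leq_add hp hq) _; rewrite addSn addnS.
Qed.

Lemma degleZ n d c (p : {mpoly F[n]}) : degle d p -> degle d (c *: p).
Proof. by rewrite -mul_mpolyC => h; apply: (degleM (d := 0)) h; apply: degleC. Qed.

Lemma degle_sum n d I (r : seq I) (P : pred I) (p : I -> {mpoly F[n]}) :
  (forall i, P i -> degle d (p i)) -> degle d (\sum_(i <- r | P i) p i).
Proof.
by move=> h; elim/big_ind: _ => //; [exact: degle0|move=> ? ?; exact: degleD].
Qed.

Lemma degle_exp n d (p : {mpoly F[n]}) k : degle d p -> degle (d * k) (p ^+ k).
Proof.
move=> h; elim: k => [|k IH]; first by rewrite expr0 muln0; exact: (degleC _ _ 1).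
by rewrite exprS mulnS; apply: degleM.
Qed.

Lemma degle_mdeg n d (p : {mpoly F[n]}) m : degle d p -> m \in msupp p -> (mdeg m <= d)%N.
Proof. by move=> h hm; rewrite -ltnS; apply: leq_trans h; apply: msize_mdeg_lt. Qed.

Lemma degleXm n d (m : 'X_{1..n}) : (mdeg m <= d)%N -> degle d ('X_[m] : {mpoly F[n]}).
Proof. by rewrite /degle msizeX ltnS. Qed.

Lemma degle_comp n k d (p : {mpoly F[n]}) (T : n.-tuple {mpoly F[k]}) :
  (forall i, degle 1 (tnth T i)) -> degle d p -> degle d (p \mPo T).
Proof.
move=> hT hp; rewrite comp_mpolyEX big_seq; apply: degle_sum => m hm.
apply: degleZ; rewrite comp_mpolyX.
apply: (degleW (d := \sum_i m i)); first by rewrite -mdegE; apply: degle_mdeg hp hm.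
elim/big_rec2: _ => [|i s q _ h]; first exact: (degleC _ _ 1).
by apply: degleM => //; have := degle_exp (m i) (hT i); rewrite mul1n.
Qed.

Lemma degle_const n (p : {mpoly F[n]}) : degle 0 p -> p = (p@_0)%:MP.
Proof. exact: msize1_polyC. Qed.

Lemma degle_dvd n d (p q : {mpoly F[n]}) : q != 0 -> divides p q -> degle d q -> degle d p.
Proof.
move=> q0 [c e]; rewrite /degle; have c0 : c != 0.
  by apply: contra_neq q0 => h; rewrite e h mul0r.
have p0 : p != 0 by apply: contra_neq q0 => h; rewrite e h mulr0.
rewrite e msizeM // => /(leq_trans _); apply.
by rewrite [msize c]mpolySpred //= leq_addl.
Qed.

Lemma mdeg_widen n (m : 'X_{1..n.+1}) :
  mdeg m = (mdeg [multinom m (widen1 i) | i < n] + m ord_max)%N.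
Proof.
rewrite !mdegE big_ord_recr /=; congr (_ + _)%N.
by apply: eq_bigr => i _; rewrite mnmE.
Qed.

Lemma muni_degle n d (w : {mpoly F[n.+1]}) k :
  degle d w -> (k <= d)%N -> degle (d - k) (muni w)`_k.
Proof.
move=> hw kd; rewrite muniE coef_sum big_seq; apply: degle_sum => m hm.
rewrite coefZ coefXn; have [e|_] := eqVneq; last by rewrite mulr0; apply: degle0.
rewrite mulr1; apply/degleZ/degleXm; rewrite leq_subRL // e addnC -mdeg_widen.
exact: degle_mdeg hw hm.
Qed.

Lemma size_muni n d (w : {mpoly F[n.+1]}) : degle d w -> (size (muni w) <= d.+1)%N.
Proof.
move=> hw; rewrite muniE; apply: (leq_trans (size_sum _ _ _)).
apply/bigmax_leqP_seq => m hm _.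
apply: leq_trans (size_scale_leq _ _) _.
rewrite size_polyXn ltnS; apply: leq_trans (degle_mdeg hw hm).
by rewrite mdeg_widen leq_addl.
Qed.

Lemma munV_degle n d e (q : {poly {mpoly F[n]}}) :
  (forall i, degle d q`_i) -> (size q <= e.+1)%N -> degle (d + e) (munV q).
Proof.
move=> hq sq; have -> : munV q = \sum_(i < size q) mwiden q`_i * 'X_ord_max ^+ i.
  rewrite /munV /= /horner_eval horner_coef size_map_inj_poly ?rmorph0 //.
    by apply: eq_bigr => i _; rewrite coef_map.
  exact: inj_mwiden.
apply: degle_sum => i _; apply: degleM; last first.
  apply: (degleW (d := 1 * i)); last by apply/degle_exp/degleX.
  by rewrite mul1n -ltnS; apply: leq_trans sq.
move: (q`_i) (hq i) => p hp; rewrite [p]mpolyE raddf_sum /= big_seq.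
apply: degle_sum => m hm; rewrite mwidenZ mwidenX; apply/degleZ/degleXm.
suff -> : mdeg (mnmwiden m) = mdeg m by apply: degle_mdeg hp hm.
rewrite mdeg_widen mnmwiden_ordmax addn0; congr mdeg.
by apply/mnmP => j; rewrite mnmE mnmwiden_widen.
Qed.

End FieldMpoly.

(** * Points off a hypersurface, and shears *)

Section NumMpoly.
Variable F : numFieldType.

Lemma poly_nat_nonroot (p : {poly F}) : p != 0 -> exists t : nat, p.[t%:R] != 0.
Proof.
move=> p0; apply: contrapT => h.
set rs : seq F := [seq i%:R | i <- iota 0 (size p)].
suff : (size rs < size p)%N by rewrite size_map size_iota ltnn.
apply: max_poly_roots => //.
  apply/allP => x /mapP[i _ ->]; apply/rootP; apply: contrapT => /eqP hx.
  by apply: h; exists i.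
by rewrite map_inj_uniq ?iota_uniq // => i j /eqP; rewrite eqr_nat => /eqP.
Qed.

Lemma poly_nonroot (p : {poly F}) : p != 0 -> exists t, p.[t] != 0.
Proof. by case/poly_nat_nonroot => t; exists t%:R. Qed.

(** The coordinates are natural numbers because these are fixed by complex conjugation, on which
    [conj_diagonal_dense] relies. *)
Lemma mpoly_nat_nonroot n (p : {mpoly F[n]}) : p != 0 ->
  exists x : 'I_n -> nat, p.@[fun i => (x i)%:R] != 0.
Proof.
elim: n p => [|n IH] p p0.
  exists (fun=> 0%N); move: p0; rewrite (mpoly0_const p) mevalC.
  by apply: contra_neq => ->.
have q0 : muni p != 0 by apply: contra_neq p0 => e; rewrite -(muniK p) e rmorph0.
have [a ha] : exists a : 'I_n -> nat, (lead_coef (muni p)).@[fun i => (a i)%:R] != 0.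
  by apply: IH; rewrite lead_coef_eq0.
have [|t ht] := @poly_nat_nonroot (map_poly (meval (fun i => (a i)%:R)) (muni p)).
  apply: contra_neq ha => /(congr1 (fun r : {poly F} => r`_(size (muni p)).-1)).
  by rewrite coef_map coef0.
exists (snoc a t); rewrite muni_eval.
have -> : init (fun i => (snoc a t i)%:R) = fun i => (a i)%:R :> F.
  by apply/funext => i; rewrite /init snoc_widen.
by rewrite snoc_max.
Qed.

Lemma mpoly_nonroot n (p : {mpoly F[n]}) : p != 0 -> exists x, p.@[x] != 0.
Proof. by case/mpoly_nat_nonroot => x; exists (fun i => (x i)%:R). Qed.

Lemma mpoly_eval_eq n (p q : {mpoly F[n]}) : (forall x, p.@[x] = q.@[x]) -> p = q.
Proof.
move=> h; apply/eqP; rewrite -subr_eq0; apply: contrapT => /negP/mpoly_nonroot[x].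
by rewrite mevalB h subrr eqxx.
Qed.

Lemma poly_eval_eq (p q : {poly F}) : (forall x, p.[x] = q.[x]) -> p = q.
Proof.
move=> h; apply/eqP; rewrite -subr_eq0; apply: contrapT => /negP/poly_nonroot[x].
by rewrite !hornerE h subrr eqxx.
Qed.

(** The linear map that fixes the first [n] basis vectors and sends the last one to [v]. *)
Definition shear n (v x : 'I_n.+1 -> F) : 'I_n.+1 -> F :=
  fun i => (if i == ord_max then 0 else x i) + v i * x ord_max.

Definition unshear n (v x : 'I_n.+1 -> F) : 'I_n.+1 -> F :=
  fun i => (if i == ord_max then 0 else x i - v i * (x ord_max / v ord_max))
    + (if i == ord_max then x ord_max / v ord_max else 0).

Lemma shearK n (v x : 'I_n.+1 -> F) : v ord_max != 0 -> unshear v (shear v x) = x.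
Proof.
move=> v0; apply/funext => i; rewrite /unshear /shear eqxx !add0r.
have -> : v ord_max * x ord_max / v ord_max = x ord_max by rewrite mulrC mulKf.
case: eqP => [->|_]; first by rewrite add0r.
by rewrite addrK addr0.
Qed.

Lemma unshearK n (v x : 'I_n.+1 -> F) : v ord_max != 0 -> shear v (unshear v x) = x.
Proof.
move=> v0; apply/funext => i; rewrite /unshear /shear eqxx !add0r.
case: eqP => [->|_]; first by rewrite add0r mulrC divfK.
by rewrite addr0 subrK.
Qed.

Definition shear_tuple n (v : 'I_n.+1 -> F) : n.+1.-tuple {mpoly F[n.+1]} :=
  [tuple (if i == ord_max then 0 else 'X_i) + v i *: 'X_ord_max | i < n.+1].

Definition unshear_tuple n (v : 'I_n.+1 -> F) : n.+1.-tuple {mpoly F[n.+1]} :=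
  [tuple (if i == ord_max then 0 else 'X_i - (v i / v ord_max) *: 'X_ord_max)
    + (if i == ord_max then (v ord_max)^-1 *: 'X_ord_max else 0) | i < n.+1].

Lemma shear_eval n (v x : 'I_n.+1 -> F) (p : {mpoly F[n.+1]}) :
  (p \mPo shear_tuple v).@[x] = p.@[shear v x].
Proof.
rewrite comp_mpoly_meval; apply: meval_eq => i.
rewrite tnth_mktuple mevalD mevalZ mevalXU /shear (fun_if (meval x)).
by rewrite meval0 mevalXU.
Qed.

Lemma unshear_eval n (v x : 'I_n.+1 -> F) (p : {mpoly F[n.+1]}) :
  (p \mPo unshear_tuple v).@[x] = p.@[unshear v x].
Proof.
rewrite comp_mpoly_meval; apply: meval_eq => i.
rewrite tnth_mktuple mevalD /unshear; case: eqP => _.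
  by rewrite !meval0 mevalZ mevalXU mulrC.
by rewrite meval0 mevalB mevalZ !mevalXU mulrAC mulrA.
Qed.

Lemma shear_tuple_degle n (v : 'I_n.+1 -> F) i : degle 1 (tnth (shear_tuple v) i).
Proof.
rewrite tnth_mktuple; apply: degleD; last exact/degleZ/degleX.
by case: ifP => _; [apply: degle0|apply: degleX].
Qed.

Lemma unshear_tuple_degle n (v : 'I_n.+1 -> F) i : degle 1 (tnth (unshear_tuple v) i).
Proof.
rewrite tnth_mktuple; apply: degleD; case: ifP => _; try exact: degle0.
  by apply: degleD; [apply: degleX|apply/degleN/degleZ/degleX].
exact/degleZ/degleX.
Qed.

Lemma tnth_shear_eval n (v x : 'I_n.+1 -> F) k : (tnth (shear_tuple v) k).@[x] = shear v x k.
Proof. by have := shear_eval v x 'X_k; rewrite comp_mpolyXU mevalXU -tnth_nth. Qed.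

Lemma tnth_unshear_eval n (v x : 'I_n.+1 -> F) k :
  (tnth (unshear_tuple v) k).@[x] = unshear v x k.
Proof. by have := unshear_eval v x 'X_k; rewrite comp_mpolyXU mevalXU -tnth_nth. Qed.

Definition topform n d (f : {mpoly F[n]}) : {mpoly F[n]} :=
  \sum_(m <- msupp f | mdeg m == d) f@_m *: 'X_[m].

Lemma topform_neq0 n (f : {mpoly F[n]}) : f != 0 -> topform (msize f).-1 f != 0.
Proof.
move=> f0; apply/eqP => /(congr1 (mcoeff (mlead f))).
rewrite mcoeff0 raddf_sum /= big_mkcond (bigD1_seq (mlead f)) ?mlead_supp ?msupp_uniq //=.
rewrite -(mlead_deg f0) eqxx mcoeffZ mcoeffX eqxx mulr1 big1 ?addr0 => [/eqP|m hm].
  by rewrite mleadc_eq0 (negPf f0).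
by case: ifP => // _; rewrite mcoeffZ mcoeffX (negPf hm) mulr0.
Qed.

Lemma topform_eval n d (f : {mpoly F[n]}) v :
  (topform d f).@[v] =
  (\sum_(m <- msupp f) (f@_m * \prod_i v i ^+ m i) *: 'X^(mdeg m))`_d.
Proof.
rewrite /topform raddf_sum coef_sum big_mkcond /=; apply: eq_bigr => m _.
rewrite coefZ coefXn eq_sym; case: eqP => _; last by rewrite mulr0.
by rewrite mulr1 mevalZ mevalX.
Qed.

(** On the line over the origin of the base the sheared polynomial is [f] along the direction [v],
    whose coefficient of degree [d] is the top form at [v]. For degree reasons this coefficient
    involves no other variable. *)
Lemma shear_lead n d (f : {mpoly F[n.+1]}) v :
  degle d f -> (topform d f).@[v] != 0 ->
  size (muni (f \mPo shear_tuple v)) = d.+1 /\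
  exists2 c, c != 0 & lead_coef (muni (f \mPo shear_tuple v)) = c%:MP.
Proof.
move=> df fv; set g := f \mPo _.
have dg : degle d g by apply: degle_comp => // i; apply: shear_tuple_degle.
have sg := size_muni dg.
have gd : (muni g)`_d = ((topform d f).@[v])%:MP.
  have := muni_degle dg (leqnn d); rewrite subnn => /degle_const ->.
  congr (_%:MP); rewrite topform_eval; set H := \sum_(m <- _) _.
  have GH : map_poly (meval (fun=> 0)) (muni g) = H.
    apply: poly_eval_eq => s; transitivity (g.@[snoc (fun=> 0) s]).
      by rewrite muni_eval snocK snoc_max.
    rewrite shear_eval mevalE /H horner_sum; apply: eq_bigr => m _.
    rewrite !hornerE -mulrA; congr (_ * _).
    rewrite mdegE -prodrXr -big_split /=; apply: eq_bigr => i _.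
    rewrite /shear snoc_max -exprMn; congr (_ ^+ _).
    have [->|[j ->]] := ord_maxVwiden i; first by rewrite eqxx add0r.
    by rewrite snoc_widen if_same add0r.
  rewrite -GH coef_map /=.
  have := muni_degle dg (leqnn d); rewrite subnn => /degle_const e.
  by rewrite [in RHS]e mevalC.
have sE : size (muni g) = d.+1.
  apply/eqP; rewrite eqn_leq sg ltnNge; apply/negP => h.
  by move: fv; rewrite -(mpolyC_eq0 n) -gd nth_default // eqxx.
split=> //; exists ((topform d f).@[v]) => //.
by rewrite lead_coefE sE.
Qed.

End NumMpoly.

(** * Finite covers of affine space *)

Section Filtration.
Variables (A : comNzRingType) (D : nat -> A -> Prop).

(** Abstract degree bounds, so that the estimate for norms is proved once and serves multivariate
    polynomials as well as polynomials over them. *)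
Record filtration := Filtration {
  filtW : forall d e x, (d <= e)%N -> D d x -> D e x;
  filt0 : D 0 0;
  filt1 : D 0 1;
  filtD : forall d x y, D d x -> D d y -> D d (x + y);
  filtN : forall d x, D d x -> D d (- x);
  filtM : forall d e x y, D d x -> D e y -> D (d + e)%N (x * y) }.

(** The degree in the variable and the degrees of the coefficients are bounded separately; returning
    to a total degree therefore doubles the bound. *)
Definition poly_filt d (q : {poly A}) := (size q <= d.+1)%N /\ forall i, D d q`_i.

Hypothesis hD : filtration.

Lemma filt0d d : D d 0.
Proof. exact: filtW (filt0 hD). Qed.

Lemma filt_sum d I (r : seq I) (P : pred I) (F : I -> A) :
  (forall i, P i -> D d (F i)) -> D d (\sum_(i <- r | P i) F i).
Proof.
by move=> h; elim/big_ind: _ => //; [exact: filt0d|move=> ? ?; exact: filtD].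
Qed.

Lemma filt_prod d n (F : 'I_n -> A) :
  (forall i, D d (F i)) -> D (n * d)%N (\prod_i F i).
Proof.
elim: n F => [|n IH] F h; first by rewrite big_ord0; exact: filtW (filt1 hD).
by rewrite big_ord_recl mulSn; apply: filtM => //; apply: IH.
Qed.

Lemma filt_mx_exp n d (M : 'M[A]_n.+1) k :
  (forall i j, D d (M i j)) -> forall i j, D (d * k)%N ((M ^+ k) i j).
Proof.
move=> h; elim: k => [|k IH] i j.
  rewrite expr0 !mxE; apply: filtW (leq0n _) _ => //.
  by case: (i == j); [exact: filt1|exact: filt0].
rewrite exprS mxE mulnS; apply: filt_sum => l _; exact: filtM.
Qed.

(** The companion matrix has at most [d] rows and entries of degree [d]. Substituted into [w] it has
    entries of degree [e + d * e], and each term of the determinant multiplies at most [d] of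
    them. *)
Lemma normp_filt d e (p w : {poly A}) : (1 < size p)%N ->
  poly_filt d p -> poly_filt e w -> D (d * (e + d * e))%N (normp p w).
Proof.
move=> sp [sd hp] [se hw]; rewrite /normp; case: (size p) sp sd => [|[|n]] //= _ sd.
set C := companion n p.
have hC i j : D d (C i j).
  rewrite mxE; case: ifP => _; first exact/filtN.
  case: (_ == _); last exact: filt0d.
  exact: filtW (filt1 hD).
have hwC i j : D (e + d * e)%N (horner_mx C w i j).
  rewrite -[w]coefK poly_def linear_sum summxE; apply: filt_sum => l _.
  rewrite linearZ /= rmorphXn /= horner_mx_X mxE; apply: filtM => //.
  apply: filtW (filt_mx_exp _ hC i j) => //.
  by rewrite leq_mul2l -ltnS (leq_trans (ltn_ord l)) // orbT.
apply: filt_sum => s _; rewrite -[(d * _)%N]add0n; apply: filtM => //.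
  by case: (odd_perm s); rewrite ?expr1 ?expr0; [apply/filtN/filt1|apply: filt1].
apply: filtW (filt_prod _) => //.
by rewrite leq_mul2r -ltnS sd orbT.
Qed.

Lemma poly_filtM d e (p q : {poly A}) :
  poly_filt d p -> poly_filt e q -> poly_filt (d + e) (p * q).
Proof.
move=> [sp hp] [sq hq]; split.
  apply: leq_trans (size_polyMleq _ _) _; rewrite -subn1 leq_subLR add1n.
  by apply: leq_trans (leq_add sp sq) _; rewrite addSn addnS.
by move=> i; rewrite coefM; apply: filt_sum => j _; apply: filtM.
Qed.

End Filtration.

Lemma poly_filtration (A : comNzRingType) (D : nat -> A -> Prop) :
  filtration D -> filtration (poly_filt D).
Proof.
move=> hD; split.
- move=> d e x de [sx hx]; split; first exact: leq_trans sx _.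
  by move=> i; apply: filtW de _.
- by split=> [|i]; rewrite ?size_poly0 // coef0; apply: filt0.
- split=> [|i]; rewrite ?size_poly1 // coef1.
  by case: (i == 0)%N; [exact: filt1|exact: filt0].
- move=> d x y [sx hx] [sy hy]; split; last by move=> i; rewrite coefD; apply: filtD.
  by apply: leq_trans (size_polyD _ _) _; rewrite geq_max sx.
- by move=> d x [sx hx]; split=> [|i]; rewrite ?size_polyN // coefN; apply: filtN.
- by move=> d e x y; apply: poly_filtM.
Qed.

Lemma poly_filtC (A : comNzRingType) (D : nat -> A -> Prop) d x :
  filtration D -> D d x -> poly_filt D d x%:P.
Proof.
move=> hD hx; split.
  by apply: leq_trans (size_polyC_leq1 _) _.
by move=> i; rewrite coefC; case: ifP => // _; apply: filt0d.
Qed.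

Lemma poly_filtX (A : comNzRingType) (D : nat -> A -> Prop) :
  filtration D -> poly_filt D 1 'X.
Proof.
move=> hD; split; first by rewrite size_polyX.
move=> i; rewrite coefX; case: (_ == _); last exact: filt0d.
exact: filtW (filt1 hD).
Qed.

Lemma poly_filt_map (A B : comNzRingType) (D : nat -> A -> Prop) (E : nat -> B -> Prop)
    (f : {rmorphism A -> B}) d q :
  (forall x, D d x -> E d (f x)) -> poly_filt D d q -> poly_filt E d (map_poly f q).
Proof.
move=> h [sq hq]; split; first exact: leq_trans (size_poly _ _) sq.
by move=> i; rewrite coef_map; apply: h.
Qed.

Lemma degle_filtration (F : fieldType) n : filtration (@degle F n).
Proof.
split.
- exact: degleW.
- exact: degle0.
- exact: (degleC _ _ 1).
- exact: degleD.
- exact: degleN.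
- exact: degleM.
Qed.

Lemma muni_filt (F : fieldType) n d (w : {mpoly F[n.+1]}) :
  degle d w -> poly_filt (@degle F n) d (muni w).
Proof.
move=> hw; split; first exact: size_muni.
move=> i; have [id|di] := leqP i d.
  by apply: degleW (muni_degle hw id); rewrite leq_subr.
by rewrite nth_default ?(leq_trans (size_muni hw)) //; apply: degle0.
Qed.

Section RootSeq.
Variable K : closedFieldType.

Definition rootseq (q : {poly K}) : seq K := sval (closed_field_poly_normal q).

Lemma rootseqE q : q \is monic -> q = \prod_(z <- rootseq q) ('X - z%:P).
Proof.
rewrite /rootseq; case: closed_field_poly_normal => rs /= e /monicP lc.
by rewrite {1}e lc scale1r.
Qed.

Lemma mem_rootseq q z : q \is monic -> (z \in rootseq q) = root q z.
Proof. by move=> qm; rewrite {2}(rootseqE qm) root_prod_XsubC. Qed.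

Lemma size_rootseq q : q \is monic -> size (rootseq q) = (size q).-1.
Proof. by move=> qm; rewrite {2}(rootseqE qm) size_prod_XsubC. Qed.

Lemma normp_rootseq (q w : {poly K}) : q \is monic -> (1 < size q)%N ->
  normp q w = \prod_(z <- rootseq q) w.[z].
Proof.
move=> qm sq; rewrite {1}(rootseqE qm) normp_prod //.
by rewrite -size_eq0 size_rootseq // -subn1 subn_eq0 -ltnNge.
Qed.

Definition eval2 (A : comNzRingType) (f : {rmorphism A -> K}) (b : K) : {poly A} -> K :=
  horner_eval b \o map_poly f.
HB.instance Definition _ A f b := GRing.RMorphism.on (@eval2 A f b).

Lemma size_map_monic (B : comNzRingType) (C : nzRingType) (f : {rmorphism B -> C})
  (q : {poly B}) : q \is monic -> size (map_poly f q) = size q.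
Proof. by move=> qm; rewrite size_map_poly_id0 // (monicP qm) rmorph1 oner_eq0. Qed.

Section TowerChi.
Variables (A : comNzRingType) (r : {poly A}) (p : {poly {poly A}}).
Hypotheses (rm : r \is monic) (pm : p \is monic).
Hypotheses (sr : (1 < size r)%N) (sp : (1 < size p)%N).

(** The characteristic polynomial of [w] on the free [A]-module defined by [r] and then [p]: the
    iterated norm of [T - w], where [T] is the variable of the result. The base is first enlarged
    from [A] to [A[T]], whence the nested [polyC]. *)
Definition tower_chi (w : {poly {poly A}}) : {poly A} :=
  normp (map_poly polyC r)
    (normp (map_poly (map_poly polyC) p) ('X%:P%:P - map_poly (map_poly polyC) w)).

Lemma tower_chi_eval (f : {rmorphism A -> K}) w t :
  (map_poly f (tower_chi w)).[t] =
  \prod_(b <- rootseq (map_poly f r))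
    \prod_(c <- rootseq (map_poly (eval2 f b) p)) (t - (map_poly (eval2 f b) w).[c]).
Proof.
have e1 (q : {poly A}) : map_poly (eval2 f t) (map_poly polyC q) = map_poly f q.
  rewrite -map_poly_comp; apply: eq_map_poly => x /=.
  by rewrite /eval2 /= map_polyC /horner_eval hornerC.
rewrite -[LHS]/(eval2 f t (tower_chi w)) /tower_chi -normp_map ?monic_map //.
rewrite [map_poly _ (map_poly polyC r)]e1 normp_rootseq ?monic_map ?size_map_monic //.
apply: eq_bigr => b _.
set g := eval2 (eval2 f t) b.
have e2 (q : {poly {poly A}}) :
    map_poly g (map_poly (map_poly polyC) q) = map_poly (eval2 f b) q.
  rewrite -map_poly_comp; apply: eq_map_poly => x /=.
  by rewrite /g /eval2 /= e1.
rewrite -[LHS]/(g _) /g -normp_map ?monic_map //.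
rewrite [map_poly _ (map_poly _ p)]e2 normp_rootseq ?monic_map ?size_map_monic //.
apply: eq_bigr => c _.
rewrite rmorphB /= [map_poly _ (map_poly _ w)]e2 map_polyC /= !hornerE.
congr (_ - _).
rewrite /eval2 /= map_polyC /horner_eval hornerC /=.
by rewrite -[LHS]/((map_poly f 'X).[t]) map_polyX hornerX.
Qed.

End TowerChi.
End RootSeq.

Section Cover.
Variable K : numClosedFieldType.

Definition mpoly_map n k (T : k.-tuple {mpoly K[n]}) (x : pt K n) : pt K k :=
  fun i => (tnth T i).@[x].

(* [fib a] lists the fibre of [pi] over [a] with multiplicities, and [chi] is the
   characteristic polynomial of [w] over the base. *)
Definition finite_cover n k (Y : subset_of K n) (pi : k.-tuple {mpoly K[n]})
    N (fib : pt K k -> 'I_N -> pt K n) d :=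
  [/\ forall y, Y y -> exists i, fib (mpoly_map pi y) i = y,
      forall a i, Y (fib a i) /\ mpoly_map pi (fib a i) = a &
      forall w : {mpoly K[n]}, exists chi : {poly {mpoly K[k]}},
        [/\ chi \is monic,
            forall a, map_poly (meval a) chi = \prod_i ('X - (w.@[fib a i])%:P) &
            degle 1 w -> poly_filt (@degle K k) d chi]].

Section Tower.
Variables (k : nat) (T T' : k.+2.-tuple {mpoly K[k.+2]}).
Hypotheses (TK : forall x, mpoly_map T (mpoly_map T' x) = x).
Hypotheses (T'K : forall x, mpoly_map T' (mpoly_map T x) = x).
Hypotheses (degT : forall i, degle 1 (tnth T i)).
Variables (P : {mpoly K[k.+2]}) (Q : {mpoly K[k.+1]}) (dP dQ : nat).
Hypotheses (Pm : muni P \is monic) (Qm : muni Q \is monic).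
Hypotheses (sP : (1 < size (muni P))%N) (sQ : (1 < size (muni Q))%N).
Hypotheses (hdP : degle dP P) (hdQ : degle dQ Q).

Definition tower_set : subset_of K k.+2 :=
  fun x => P.@[mpoly_map T' x] = 0 /\ Q.@[init (mpoly_map T' x)] = 0.

Definition tower_proj : k.-tuple {mpoly K[k.+2]} :=
  [tuple tnth T' (widen1 (widen1 i)) | i < k].

Let r := muni Q.
Let p := map_poly (@muni k K) (muni P).

Definition tower_roots (a : pt K k) : seq (K * K) :=
  [seq (b, c) | b <- rootseq (map_poly (meval a) r),
                c <- rootseq (map_poly (eval2 (meval a) b) p)].

Definition tower_size := ((size r).-1 * (size p).-1)%N.

Definition tower_fib (a : pt K k) (i : 'I_tower_size) : pt K k.+2 :=
  let bc := nth (0, 0) (tower_roots a) i in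
  mpoly_map T (snoc (snoc a bc.1) bc.2).

(** [normp_filt] applied twice: to a linear form modulo the equation of degree [dP], then to the
    result modulo that of degree [dQ]. *)
Definition tower_deg :=
  let e := (dP * (1 + dP * 1))%N in (dQ * (e + dQ * e))%N.

Let pm : p \is monic. Proof. exact: monic_map. Qed.
Let sp : (1 < size p)%N. Proof. by rewrite size_map_monic. Qed.

Lemma size_tower_roots a : size (tower_roots a) = tower_size.
Proof.
rewrite size_allpairs_dep /tower_size -(size_map_monic (meval a) Qm).
rewrite -size_rootseq ?monic_map //.
elim: (rootseq _) => //= b s ->; rewrite mulSn; congr (_ + _)%N.
by rewrite size_rootseq ?monic_map // size_map_monic.
Qed.

Lemma eval2_muni (w : {mpoly K[k.+1]}) a b : eval2 (meval a) b (muni w) = w.@[snoc a b].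
Proof. by rewrite muni_eval snocK snoc_max. Qed.

Lemma eval3_muni (w : {mpoly K[k.+2]}) a b c :
  (map_poly (eval2 (meval a) b) (map_poly (@muni k K) (muni w))).[c] =
  w.@[snoc (snoc a b) c].
Proof.
rewrite muni_eval snocK snoc_max -map_poly_comp; congr (_.[_]).
by apply: eq_map_poly => q /=; rewrite eval2_muni.
Qed.

Lemma mem_tower_roots a b c : ((b, c) \in tower_roots a) =
  (Q.@[snoc a b] == 0) && (P.@[snoc (snoc a b) c] == 0).
Proof.
apply/allpairsPdep/andP => [[b' [c' [hb hc [-> ->]]]]|[hb hc]].
  move: hb hc; rewrite !mem_rootseq ?monic_map // /root eval3_muni.
  by rewrite -[_.[b']]/(eval2 (meval a) b' _) eval2_muni.
exists b, c; split=> //; rewrite mem_rootseq ?monic_map // /root ?eval3_muni //.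
by rewrite -[_.[b]]/(eval2 (meval a) b _) eval2_muni.
Qed.

Lemma tower_cover : finite_cover tower_set tower_proj tower_fib tower_deg.
Proof.
have projE x : mpoly_map tower_proj x = init (init (mpoly_map T' x)).
  by apply/funext => i; rewrite /mpoly_map tnth_mktuple.
split.
- move=> y [hP hQ]; set x := mpoly_map T' y in hP hQ.
  rewrite projE -/x; set a := init (init x).
  have hbc : (init x ord_max, x ord_max) \in tower_roots a.
    by rewrite mem_tower_roots !snoc_init hP hQ eqxx.
  have hi : (index (init x ord_max, x ord_max) (tower_roots a) < tower_size)%N.
    by rewrite -(size_tower_roots a) index_mem.
  exists (Ordinal hi); rewrite /tower_fib nth_index //= !snoc_init.
  exact: TK.
- move=> a i; rewrite /tower_fib; set bc := nth _ _ _.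
  have : bc \in tower_roots a by rewrite mem_nth // size_tower_roots.
  rewrite (surjective_pairing bc) mem_tower_roots => /andP[/eqP hQ /eqP hP].
  by split; rewrite ?projE /tower_set ?T'K !snocK.
move=> w; pose w' := w \mPo T.
have w'E x : w'.@[x] = w.@[mpoly_map T x] by rewrite comp_mpoly_meval.
pose chi := tower_chi r p (map_poly (@muni k K) (muni w')).
have chiE a : map_poly (meval a) chi = \prod_(i < tower_size) ('X - (w.@[tower_fib a i])%:P).
  apply: poly_eval_eq => t; rewrite tower_chi_eval // horner_prod.
  transitivity (\prod_(bc <- tower_roots a) (t - w'.@[snoc (snoc a bc.1) bc.2])).
    rewrite big_allpairs_dep; apply: eq_bigr => b _; apply: eq_bigr => c _.
    by rewrite eval3_muni.
  rewrite (big_nth (0, 0)) size_tower_roots big_mkord; apply: eq_bigr => i _.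
  by rewrite !hornerE w'E.
exists chi; split; [|exact: chiE|].
  have cf i a : (chi`_i).@[a] = (\prod_(i < tower_size) ('X - (w.@[tower_fib a i])%:P))`_i.
    by rewrite -chiE coef_map.
  have pm' a : \prod_(i < tower_size) ('X - (w.@[tower_fib a i])%:P) \is monic.
    by apply: monic_prod => i _; apply: monicXsubC.
  have ps' a : size (\prod_(i < tower_size) ('X - (w.@[tower_fib a i])%:P)) = tower_size.+1.
    by rewrite size_prod_XsubC /index_enum -enumT size_enum_ord.
  (* The coefficients of [chi] are identified by their values at all points of the base: every fibre
     list has the same length, so the top one is constantly 1. *)
  have c1 : chi`_tower_size = 1.
    apply: mpoly_eval_eq => a; rewrite cf meval1.
    by move/monicP: (pm' a); rewrite lead_coefE ps'.
  have sc : size chi = tower_size.+1.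
    apply/eqP; rewrite eqn_leq; apply/andP; split; last first.
      by rewrite ltnNge; apply/negP => h; move/eqP: c1; rewrite nth_default // eq_sym oner_eq0.
    apply/leq_sizeP => j hj; apply: mpoly_eval_eq => a; rewrite cf meval0.
    by rewrite nth_default // ps'.
  by rewrite monicE lead_coefE sc c1.
move=> hw; have D0 := degle_filtration K k.
have D1 := poly_filtration D0; have D2 := poly_filtration D1.
have lift1 d q : poly_filt (@degle K k) d q ->
    poly_filt (poly_filt (@degle K k)) d (map_poly polyC q).
  by apply: poly_filt_map => x; apply: poly_filtC.
have lift2 d q : poly_filt (poly_filt (@degle K k)) d q ->
    poly_filt (poly_filt (poly_filt (@degle K k))) d (map_poly (map_poly polyC) q).
  by apply: poly_filt_map => x; apply: lift1.
have muni2 d (q : {mpoly K[k.+2]}) : degle d q ->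
    poly_filt (poly_filt (@degle K k)) d (map_poly (@muni k K) (muni q)).
  by move=> hq; apply: (poly_filt_map _ (muni_filt hq)) => x; apply: muni_filt.
apply: normp_filt => //.
- by rewrite size_map_monic.
- exact/lift1/muni_filt.
apply: normp_filt => //.
- by rewrite size_map_monic.
- exact/lift2/muni2.
apply: filtD (poly_filtration D2) _ _ _ _ _.
  by apply: poly_filtC => //; apply: poly_filtC => //; apply: poly_filtX.
apply: filtN (poly_filtration D2) _ _ _.
by apply/lift2/muni2/degle_comp.
Qed.

End Tower.
End Cover.

(** * The Zariski topology *)

Section Noetherian.
Variable A : comNzRingType.

Record ideal (I : A -> Prop) := Ideal {
  ideal0 : I 0;
  idealD : forall x y, I x -> I y -> I (x + y);
  idealM : forall c x, I x -> I (c * x) }.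

Definition ideal_gen (S : seq A) (x : A) :=
  forall I, ideal I -> (forall y, y \in S -> I y) -> I x.

Definition noetherian := forall I : A -> Prop, ideal I ->
  exists S : seq A, (forall y, y \in S -> I y) /\ forall x, I x -> ideal_gen S x.

Lemma ideal_gen_ideal S : ideal (ideal_gen S).
Proof.
split=> [I hI _|x y hx hy I hI hS|c x hx I hI hS]; first exact: ideal0.
  by apply: idealD => //; [apply: hx|apply: hy].
by apply: idealM => //; apply: hx.
Qed.

Lemma ideal_gen_mem S x : x \in S -> ideal_gen S x.
Proof. by move=> xS I _; apply. Qed.

Lemma ideal_gen_sub S S' x : {subset S <= S'} -> ideal_gen S x -> ideal_gen S' x.
Proof. by move=> h hx I hI hS; apply: hx => // y /h /hS. Qed.

Lemma idealB I x y : ideal I -> I x -> I y -> I (x - y).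
Proof. by move=> hI hx hy; apply: idealD => //; rewrite -mulN1r; apply: idealM. Qed.

End Noetherian.

Lemma noetherian_field (F : fieldType) : noetherian F.
Proof.
move=> I hI; have [[x [x0 hx]]|h] := pselect (exists x, x != 0 /\ I x).
  exists [:: x]; split=> [y|y _]; first by rewrite inE => /eqP ->.
  rewrite -(divfK x0 y); apply: idealM (ideal_gen_ideal _) _ _ _.
  by apply: ideal_gen_mem; rewrite inE.
exists [::]; split=> // x hx; suff -> : x = 0 by apply: ideal0 (ideal_gen_ideal _).
by apply: contrapT => /eqP x0; apply: h; exists x.
Qed.

Lemma noetherian_transfer (A B : comNzRingType) (f : {rmorphism A -> B})
  (g : {rmorphism B -> A}) : cancel g f -> noetherian A -> noetherian B.
Proof.
move=> gK nA I hI; have [] := nA (fun x => I (f x)).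
  split=> [|x y|c x]; rewrite ?rmorph0 ?rmorphD ?rmorphM //; first exact: ideal0.
    exact: idealD.
  exact: idealM.
move=> S [hS hg]; exists (map f S); split=> [y /mapP[x xS ->]|x]; first exact: hS.
rewrite -(gK x) => /hg hx J hJ hSJ; apply: (hx (fun x => J (f x))) => [|y yS].
  split=> [|y z|c y]; rewrite ?rmorph0 ?rmorphD ?rmorphM //; first exact: ideal0.
    exact: idealD.
  exact: idealM.
exact/hSJ/map_f.
Qed.

Section HilbertBasis.
Variables (A : comNzRingType) (nA : noetherian A).

(** The leading coefficients in degree [k], with 0 added to make an ideal. *)
Let lead (I : {poly A} -> Prop) k a := exists f, [/\ I f, (size f <= k.+1)%N & f`_k = a].

Let lead_ideal I k : ideal I -> ideal (lead I k).
Proof.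
move=> hI; split.
- by exists 0; rewrite size_poly0 coef0; split=> //; apply: ideal0.
- move=> x y [f [hf sf <-]] [g [hg sg <-]]; exists (f + g); rewrite coefD; split=> //.
    exact: idealD.
  by apply: leq_trans (size_polyD _ _) _; rewrite geq_max sf.
- move=> c x [f [hf sf <-]]; exists (c%:P * f); rewrite coefCM; split=> //.
    exact: idealM.
  by rewrite mul_polyC; apply: leq_trans (size_scale_leq _ _) _.
Qed.

Let lead_shift (I : {poly A} -> Prop) k l a : ideal I -> (k <= l)%N -> lead I k a -> lead I l a.
Proof.
move=> hI kl [f [hf sf <-]]; exists ('X^(l - k) * f); split; first exact: idealM.
  apply: leq_trans (size_polyMleq _ _) _; rewrite size_polyXn /=.
  by apply: leq_trans (leq_add (leqnn _) sf) _; rewrite addnS subnK.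
by rewrite coefXnM ltnNge leq_subr /= subKn.
Qed.

Let lead_gen (I : {poly A} -> Prop) k (S : seq A) : (forall y, y \in S -> lead I k y) ->
  exists T : seq {poly A}, (forall f, f \in T -> I f) /\
    forall y, y \in S -> lead (ideal_gen T) k y.
Proof.
elim: S => [|y S IH] h; first by exists [::].
have [|T [hT hS]] := IH; first by move=> z zS; apply: h; rewrite inE zS orbT.
have [|f [hf sf fy]] := h y; first by rewrite mem_head.
exists (f :: T); split=> [g|z].
  by rewrite inE => /predU1P[->|/hT].
rewrite inE => /predU1P[->|/hS [g [hg sg gz]]].
  by exists f; split=> //; apply: ideal_gen_mem; rewrite mem_head.
exists g; split=> //; apply: ideal_gen_sub hg => ?.
by rewrite inE orbC => ->.
Qed.

Let lead_fg I k : ideal I -> exists T : seq {poly A}, (forall f, f \in T -> I f) /\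
  forall y, lead I k y -> lead (ideal_gen T) k y.
Proof.
move=> hI; have [S [hS gS]] := nA (lead_ideal k hI).
have [T [hT hST]] := lead_gen hS; exists T; split=> // y /gS; apply => //.
exact/lead_ideal/ideal_gen_ideal.
Qed.

Let lead_fg_below I d : ideal I -> exists T : seq {poly A}, (forall f, f \in T -> I f) /\
  forall k y, (k < d)%N -> lead I k y -> lead (ideal_gen T) k y.
Proof.
move=> hI; elim: d => [|d [T [hT gT]]]; first by exists [::].
have [T' [hT' gT']] := lead_fg d hI; exists (T' ++ T); split=> [f|k y].
  by rewrite mem_cat => /orP[/hT'|/hT].
rewrite ltnS leq_eqVlt => /predU1P[->|kd] h.
  have [g [hg sg gy]] := gT' _ h; exists g; split=> //.
  by apply: ideal_gen_sub hg => ?; rewrite mem_cat => ->.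
have [g [hg sg gy]] := gT _ _ kd h; exists g; split=> //.
by apply: ideal_gen_sub hg => ?; rewrite mem_cat orbC => ->.
Qed.

(** Generators of the ideal of all leading coefficients are realized in one common degree [d] and
    reduce every element of degree at least [d]; each of the finitely many lower degrees gets
    generators of its own. *)
Lemma noetherian_poly : noetherian {poly A}.
Proof.
move=> I hI; have [] := nA (I := fun a => exists k, lead I k a).
  split=> [|x y [k hx] [l hy]|c x [k hx]].
  - by exists 0%N; apply: ideal0 (lead_ideal _ _).
  - exists (maxn k l); apply: idealD; first exact: lead_ideal.
      by apply: lead_shift hx => //; apply: leq_maxl.
    by apply: lead_shift hy => //; apply: leq_maxr.
  - by exists k; apply: idealM => //; apply: lead_ideal.
move=> S [hS gS]; have [d hd] : exists d, forall y, y \in S -> lead I d y.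
  elim: S hS {gS} => [|y S IH] hS; first by exists 0%N.
  have [|d hd] := IH; first by move=> z zS; apply: hS; rewrite inE zS orbT.
  have [|k hk] := hS y; first by rewrite mem_head.
  exists (maxn k d) => z; rewrite inE => /predU1P[->|/hd hz].
    by apply: lead_shift hk => //; apply: leq_maxl.
  by apply: lead_shift hz => //; apply: leq_maxr.
have [T [hT gT]] := lead_gen hd.
have [T' [hT' gT']] := lead_fg_below d hI.
have subl x : ideal_gen T x -> ideal_gen (T ++ T') x.
  by apply: ideal_gen_sub => y; rewrite mem_cat => ->.
have subr x : ideal_gen T' x -> ideal_gen (T ++ T') x.
  by apply: ideal_gen_sub => y; rewrite mem_cat orbC => ->.
exists (T ++ T'); split=> [f|f]; first by rewrite mem_cat => /orP[/hT|/hT'].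
move: {2}(size f) (leqnn (size f)) => k; elim: k f => [|k IH] f sf hf.
  move: sf; rewrite leqn0 size_poly_eq0 => /eqP ->.
  exact: ideal0 (ideal_gen_ideal _).
have [g [hg sg gf]] : lead (ideal_gen (T ++ T')) k f`_k.
  have fk : lead I k f`_k by exists f.
  have [kd|dk] := ltnP k d.
    by have [g [hg sg gy]] := gT' _ _ kd fk; exists g; split=> //; apply: subr.
  apply: (lead_shift (k := d)) => //; first exact: ideal_gen_ideal.
  have : ideal_gen S f`_k by apply: gS; exists k.
  move/(_ (lead (ideal_gen (T ++ T')) d)); apply; first exact/lead_ideal/ideal_gen_ideal.
  by move=> y /gT [h [hh sh hy]]; exists h; split=> //; apply: subl.
rewrite -(subrK g f); apply: (idealD (ideal_gen_ideal _)) => //.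
apply: IH.
  apply/leq_sizeP => j; rewrite leq_eqVlt coefB => /predU1P[<-|hj].
    by rewrite gf subrr.
  by rewrite !nth_default ?subrr //; [apply: leq_trans sg _|apply: leq_trans sf _].
apply: idealB => //; apply: hg => // y; rewrite mem_cat => /orP[/hT|/hT'] //.
Qed.

End HilbertBasis.

Lemma noetherian_mpoly (F : fieldType) n : noetherian {mpoly F[n]}.
Proof.
elim: n => [|n IH].
  apply: (noetherian_transfer (f := @mpolyC 0 F) (g := mcoeff 0%MM)).
    by move=> p; rewrite [RHS]mpoly0_const.
  exact: noetherian_field.
apply: (@noetherian_transfer {poly {mpoly F[n]}} {mpoly F[n.+1]} (@munV F n) (@muni n F)).
  exact: muniK.
exact: noetherian_poly.
Qed.

(** * Closed sets and their irreducible components *)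

Section Zariski.
Variables (K : fieldType) (n : nat).
Implicit Types (S V W : subset_of K n) (f g : {mpoly K[n]}).

Definition vanish S f := forall x, S x -> f.@[x] = 0.

Lemma vanish_ideal S : ideal (vanish S).
Proof.
split=> [x _|f g hf hg x hx|f g hg x hx]; first by rewrite meval0.
  by rewrite mevalD hf ?hg ?addr0.
by rewrite mevalM hg ?mulr0.
Qed.

(** Noetherianity extracts finitely many equations from any family, even an infinite one. *)
Lemma closed_zeros (Phi : {mpoly K[n]} -> Prop) :
  zariski_closed (fun x => forall f, Phi f -> f.@[x] = 0).
Proof.
pose Z x := forall f, Phi f -> f.@[x] = 0.
have [S [hS gS]] := noetherian_mpoly (vanish_ideal Z).
exists S => x; split=> [hx f /hS|h f hf]; first exact.
apply: (gS f _ (vanish (fun y => y = x))) => //.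
- by move=> y; apply.
- exact: vanish_ideal.
- by move=> g gS' y ->; apply: h.
Qed.

Lemma closed_ext S V : (forall x, S x <-> V x) -> zariski_closed S -> zariski_closed V.
Proof. by move=> h [F hF]; exists F => x; rewrite -h. Qed.

Lemma closed_vanish S x : zariski_closed S -> ~ S x -> exists2 f, vanish S f & f.@[x] != 0.
Proof.
move=> [F hF] nSx; apply: contrapT => h; apply: nSx; apply/hF => f fF.
apply: contrapT => /eqP hx; apply: h; exists f => // y /hF; exact.
Qed.

Lemma closed_sub S V : zariski_closed V -> (forall f, vanish V f -> vanish S f) ->
  sub_set S V.
Proof.
move=> cV h x Sx; apply: contrapT => /(closed_vanish cV)[f /h hf].
by rewrite hf ?eqxx.
Qed.

Lemma closed_zero f : zariski_closed (fun x => f.@[x] = 0).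
Proof.
by exists [:: f] => x; split=> [h g|]; [rewrite inE => /eqP ->|apply; rewrite inE].
Qed.

Lemma closedI S V : zariski_closed S -> zariski_closed V -> zariski_closed (fun x => S x /\ V x).
Proof.
move=> [F hF] [G hG]; exists (F ++ G) => x; split.
  by move=> [/hF hf /hG hg] f; rewrite mem_cat => /orP[/hf|/hg].
by move=> h; split; [apply/hF|apply/hG] => f fF; apply: h; rewrite mem_cat fF ?orbT.
Qed.

Lemma closed_pt (a : pt K n) : zariski_closed (fun x => x = a).
Proof.
apply: (@closed_ext (fun x => forall f, (exists i, f = 'X_i - (a i)%:MP) -> f.@[x] = 0));
  last exact: closed_zeros.
move=> x; split=> [h|-> f [i ->]]; last by rewrite mevalB mevalXU mevalC subrr.
apply/funext => i; apply/eqP; rewrite -subr_eq0.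
have : ('X_i - (a i)%:MP).@[x] = 0 by apply: h; exists i.
by rewrite mevalB mevalXU mevalC => ->.
Qed.

Lemma irreducible_pt (a : pt K n) : irreducible_variety (fun x => x = a).
Proof.
split; [exact: closed_pt|by exists a|move=> A B _ _ h].
by case: (h a (erefl _)) => ha; [left|right] => x ->.
Qed.

Lemma irreducible_mul S f g : irreducible_variety S -> vanish S (f * g) ->
  vanish S f \/ vanish S g.
Proof.
move=> [_ _ irr] h; apply: irr (closed_zero f) (closed_zero g) _ => x /h.
by rewrite mevalM => /eqP; rewrite mulf_eq0 => /orP[]/eqP; [left|right].
Qed.

Lemma irreducible_exp S f k : irreducible_variety S -> vanish S (f ^+ k) -> vanish S f.
Proof.
move=> irr; elim: k => [|k IH].
  have [_ [x Sx] _] := irr => /(_ x Sx)/eqP.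
  by rewrite expr0 meval1 oner_eq0.
by rewrite exprS => /(irreducible_mul irr)[].
Qed.

Lemma irreducible_prod S (s : seq {mpoly K[n]}) : irreducible_variety S ->
  vanish S (\prod_(f <- s) f) -> exists2 f, f \in s & vanish S f.
Proof.
move=> irr; elim: s => [|f s IH].
  have [_ [x Sx] _] := irr; rewrite big_nil => /(_ x Sx)/eqP.
  by rewrite meval1 oner_eq0.
rewrite big_cons => /(irreducible_mul irr)[hf|/IH[g gs hg]].
  by exists f; rewrite ?mem_head.
by exists g; rewrite ?inE ?gs ?orbT.
Qed.

Definition irreducible_union S := exists m (C : 'I_m -> subset_of K n),
  (forall i, irreducible_variety (C i)) /\ forall x, S x <-> exists i, C i x.

Lemma irreducible_unionU S V : irreducible_union S -> irreducible_union V ->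
  irreducible_union (fun x => S x \/ V x).
Proof.
move=> [m [C [iC hC]]] [l [D [iD hD]]].
exists (m + l)%N, (fun i => match split i with inl j => C j | inr j => D j end).
split=> [i|x]; first by case: split.
split=> [[/hC[i hi]|/hD[i hi]]|[i ]].
- by exists (unsplit (inl i)); rewrite unsplitK.
- by exists (unsplit (inr i)); rewrite unsplitK.
- by case: split => j hj; [left; apply/hC; exists j|right; apply/hD; exists j].
Qed.

Lemma closed_descending (V : nat -> subset_of K n) : (forall i, zariski_closed (V i)) ->
  (forall i, sub_set (V i.+1) (V i)) -> exists i, sub_set (V i) (V i.+1).
Proof.
move=> cV dV.
have dV' i j : (i <= j)%N -> sub_set (V j) (V i).
  by move=> /subnK <-; elim: (j - i)%N => // k IH x; rewrite addSn => /dV/IH.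
have up i j f : (i <= j)%N -> vanish (V i) f -> vanish (V j) f.
  by move=> ij hf x /(dV' _ _ ij)/hf.
have [|S [hS gS]] := @noetherian_mpoly K n (fun f => exists i, vanish (V i) f).
  split=> [|f g [i hi] [j hj]|c f [i hi]].
  - by exists 0%N; apply: ideal0 (vanish_ideal _).
  - exists (maxn i j); apply: idealD (vanish_ideal _) _ _ _ _.
      by apply: up hi; apply: leq_maxl.
    by apply: up hj; apply: leq_maxr.
  - by exists i; apply: idealM (vanish_ideal _) _ _ _.
have [k hk] : exists k, forall f, f \in S -> vanish (V k) f.
  elim: S hS {gS} => [|f S IH] hS; first by exists 0%N.
  have [|k hk] := IH; first by move=> g gS; apply: hS; rewrite inE gS orbT.
  have [|i hi] := hS f; first by rewrite mem_head.
  exists (maxn i k) => g; rewrite inE => /predU1P[->|/hk hg].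
    by apply: up hi; apply: leq_maxl.
  by apply: up hg; apply: leq_maxr.
exists k; apply: closed_sub (cV _) _ => f hf.
apply: (gS f) => //; first by exists k.+1.
exact: vanish_ideal.
Qed.

(** Noetherian induction: a closed set that is no finite union of irreducible ones contains a
    strictly smaller set of the same kind, and choice builds an infinite descent. *)
Lemma closed_irreducible_union S : zariski_closed S -> irreducible_union S.
Proof.
move=> cS; apply: contrapT => nS.
pose bad V := zariski_closed V /\ ~ irreducible_union V.
have step (V : {V | bad V}) : exists W : {V | bad V},
    sub_set (sval W) (sval V) /\ ~ sub_set (sval V) (sval W).
  case: V => V [cV nV] /=.
  have [Vne|Ve] := pselect (exists x, V x); last first.
    case: nV; exists 0%N, (fun _ => V); split=> [[]|x] //.
    by split=> [Vx|[[]]] //; case: Ve; exists x.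
  have : ~ irreducible_variety V.
    move=> iV; apply: nV; exists 1%N, (fun _ => V); split=> // x.
    by split=> [|[]] //; exists ord0.
  move=> niV; have [A [B [cA cB VAB nVA nVB]]] : exists A B, [/\ zariski_closed A,
      zariski_closed B, sub_set V (fun x => A x \/ B x), ~ sub_set V A & ~ sub_set V B].
    apply: contrapT => h; apply: niV; split=> // A B cA cB VAB.
    by apply: contrapT => /not_orP[nA nB]; apply: h; exists A, B.
  have [uA|nA] := pselect (irreducible_union (fun x => V x /\ A x)); last first.
    exists (exist bad _ (conj (closedI cV cA) nA)) => /=; split=> [x []|h] //.
    by apply: nVA => x /h [].
  have [uB|nB] := pselect (irreducible_union (fun x => V x /\ B x)); last first.
    exists (exist bad _ (conj (closedI cV cB) nB)) => /=; split=> [x []|h] //.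
    by apply: nVB => x /h [].
  case: nV; have [m [C [iC hC]]] := irreducible_unionU uA uB.
  exists m, C; split=> // x; rewrite -hC; split=> [Vx|[[]|[]]] //.
  by case: (VAB x Vx); [left|right].
have [next hnext] := choice step.
pose V i := sval (iter i next (exist bad S (conj cS nS))).
have [i hi] := closed_descending (V := V)
  (fun i => (svalP (iter i next (exist bad S (conj cS nS)))).1) (fun i => (hnext _).1).
exact: (hnext _).2 hi.
Qed.

(** A representation with the fewest irreducible pieces is irredundant, since a piece inside another
    one could be dropped. *)
Lemma closed_component_decomposition S : zariski_closed S ->
  exists m (C : 'I_m -> subset_of K n), component_decomposition S C.
Proof.
move=> /closed_irreducible_union h.
pose P m := `[< exists C : 'I_m -> subset_of K n,
  (forall i, irreducible_variety (C i)) /\ forall x, S x <-> exists i, C i x >].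
have exP : exists m, P m by case: h => m hm; exists m; apply/asboolP.
have [m /asboolP[C [iC hC]] minm] := ex_minnP exP.
exists m, C; split=> // i j ij sub.
case: m i j ij C iC hC minm sub => [|m] i j ij C iC hC minm sub; first by case: i {sub ij}.
suff /minm : P m by rewrite ltnn.
apply/asboolP; exists (fun l => C (lift i l)); split=> // x.
rewrite hC; split=> [[l hl]|[l hl]]; last by exists (lift i l).
case: (unliftP i l) hl => [l' ->|->] hl; first by exists l'.
case: (unliftP i j) ij sub => [j' ->|->] ij sub; last by rewrite eqxx in ij.
by exists j'; apply: sub.
Qed.

End Zariski.

(** * Dimension and components of a finite cover *)

Section AlgDep.
Variable K : fieldType.

Lemma nontrivial_relation m n (M : 'M[K]_(m, n)) : (n < m)%N ->
  exists2 v : 'rV_m, v != 0 & v *m M = 0.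
Proof.
move=> nm; have : kermx M != 0.
  rewrite -mxrank_eq0 mxrank_ker -lt0n subn_gt0.
  exact: leq_ltn_trans (rank_leq_col _) nm.
case/rowV0Pn => v /sub_kermxP vM v0; exists v => //.
Qed.

(** A count: the monomials in the [k.+1] polynomials with exponents below [J] outnumber the
    monomials in [k] variables that can occur in their values. *)
Lemma algebraic_dependence k (p : 'I_k.+1 -> {mpoly K[k]}) :
  exists2 F : {mpoly K[k.+1]}, F != 0 & F \mPo [tuple p i | i < k.+1] = 0.
Proof.
have [d hd] : exists d, forall i, degle d (p i).
  exists (\max_i msize (p i))%N => i; apply: leqW; exact: (leq_bigmax i).
(* The values have degree at most [d * k.+1 * J.-1 < L], while
   [L ^ k = c ^ k * J ^ k < J ^ k.+1]. *)
pose c := (d * k.+1).+1; pose J := (c ^ k).+1; pose L := (c * J)%N.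
pose E := {ffun 'I_k.+1 -> 'I_J}; pose G := {ffun 'I_k -> 'I_L}.
pose mn r (s : nat) (e : {ffun 'I_r -> 'I_s}) : 'X_{1..r} := [multinom (e i : nat) | i < r].
have mn_inj r s : injective (@mn r s).
  move=> e f h; apply/ffunP => i; apply: val_inj.
  by have /mnmP/(_ i) := h; rewrite !mnmE.
pose pw (e : E) := 'X_[mn _ _ e] \mPo [tuple p i | i < k.+1].
pose M : 'M[K]_(#|E|, #|G|) := \matrix_(i, j) (pw (enum_val i))@_(mn _ _ (enum_val j)).
have cardlt : (#|G| < #|E|)%N.
  rewrite !card_ffun !card_ord /L expnMn expnS ltn_pmul2r //.
  by rewrite expn_gt0.
have [v v0 vM] := nontrivial_relation M cardlt.
exists (\sum_i v 0 i *: 'X_[mn _ _ (enum_val i)]).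
  have [i vi] : exists i, v 0 i != 0.
    apply: contrapT => h; move/eqP: v0; apply; apply/rowP => i; rewrite mxE.
    by apply: contrapT => /eqP hi; apply: h; exists i.
  apply: contra_neq vi => /(congr1 (mcoeff (mn _ _ (enum_val i)))).
  rewrite raddf_sum /= mcoeff0 (bigD1 i) //= mcoeffZ mcoeffX eqxx mulr1 big1 ?addr0 //.
  move=> j ji; rewrite mcoeffZ mcoeffX (inj_eq (@mn_inj _ _)) (inj_eq enum_val_inj).
  by rewrite (negPf ji) mulr0.
have dpw e : degle (d * (k.+1 * J.-1)) (pw e).
  rewrite /pw comp_mpolyX.
  have -> : (d * (k.+1 * J.-1) = \sum_(i < k.+1) d * J.-1)%N.
    by rewrite sum_nat_const card_ord mulnCA.
  elim/big_rec2: _ => [|i x y _ h]; first exact: (degleC _ _ 1).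
  apply: degleM => //; rewrite tnth_mktuple mnmE.
  apply: degleW (degle_exp _ (hd i)); rewrite leq_mul2l -ltnS ltn_ord orbT //.
apply/mpolyP => m; rewrite mcoeff0 rmorph_sum.
rewrite raddf_sum /=.
under eq_bigr do rewrite comp_mpolyZ mcoeffZ.
have [hm|hm] := boolP [forall i, (m i < L)%N].
  have hm' i : (m i < L)%N by apply: (forallP hm).
  pose e : G := [ffun i => Ordinal (hm' i)].
  have em : mn _ _ e = m by apply/mnmP => i; rewrite mnmE ffunE.
  have := congr1 (fun x : 'rV_#|G| => x 0 (enum_rank e)) vM.
  rewrite !mxE => h; rewrite -[RHS]h; apply: eq_bigr => i _.
  by rewrite mxE enum_rankK em.
move: hm; rewrite negb_forall => /existsP[j]; rewrite -leqNgt => hj.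
apply: big1 => i _; suff -> : (pw (enum_val i))@_m = 0 by rewrite mulr0.
apply/eqP; rewrite mcoeff_eq0; apply/negP => /(degle_mdeg (dpw _)) hmd.
have mj : (m j <= mdeg m)%N by rewrite mdegE (bigD1 j) //= leq_addr.
have := leq_trans hj (leq_trans mj hmd); apply/negP; rewrite -ltnNge /L /c mulnA mulSn.
apply: (@leq_trans (J + d * k.+1 * J.-1)); first by rewrite -[X in (X < _)%N]add0n ltn_add2r.
by rewrite leq_add2l leq_mul2l leq_pred orbT.
Qed.

End AlgDep.

Section PolySub.
Variables (K : numClosedFieldType) (n k : nat) (pi : k.-tuple {mpoly K[n]}).

(** A relation over the base read on the total space: the coefficients are pulled back along the
    projection. *)
Definition polysub (q : {poly {mpoly K[k]}}) (h : {mpoly K[n]}) : {mpoly K[n]} :=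
  (map_poly (comp_mpoly pi) q).[h].

Lemma comp_eval (c : {mpoly K[k]}) y : (c \mPo pi).@[y] = c.@[mpoly_map pi y].
Proof. by rewrite comp_mpoly_meval. Qed.

Lemma polysubE q h y :
  (polysub q h).@[y] = (map_poly (meval (mpoly_map pi y)) q).[h.@[y]].
Proof.
rewrite /polysub -[LHS]/(meval y _) -horner_map /= -map_poly_comp; congr (_.[_]).
by apply: eq_map_poly => c /=; rewrite comp_eval.
Qed.

Lemma polysubM q1 q2 h : polysub (q1 * q2) h = polysub q1 h * polysub q2 h.
Proof. by rewrite /polysub rmorphM hornerM. Qed.

Lemma polysub_degle d q h : (forall i, degle 1 (tnth pi i)) -> degle 1 h ->
  poly_filt (@degle K k) d q -> degle (d + d) (polysub q h).
Proof.
move=> hpi hh [sq hq]; rewrite /polysub horner_coef; apply: degle_sum => i _.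
apply: degleM; first by rewrite coef_map; apply: degle_comp.
apply: degleW (degle_exp i hh); rewrite mul1n -ltnS.
by apply: leq_trans (ltn_ord i) (leq_trans (size_poly _ _) sq).
Qed.

End PolySub.

(** A relation is a polynomial in its last argument [C m]. Powers of [C m] can be divided out, as it
    does not vanish on the irreducible [V m.+1]; on [V m] it does vanish, so the remaining constant
    coefficient is a relation among the earlier functions. *)
Lemma chain_independent (K : fieldType) n (V : nat -> subset_of K n)
    (C : nat -> {mpoly K[n]}) m (F : {mpoly K[m]}) :
  (forall i, (i <= m)%N -> irreducible_variety (V i)) ->
  (forall i, (i < m)%N -> sub_set (V i) (V i.+1)) ->
  (forall i, (i < m)%N -> vanish (V i) (C i) /\ ~ vanish (V i.+1) (C i)) ->
  vanish (V m) (F \mPo [tuple C i | i < m]) -> F = 0.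
Proof.
elim: m F => [|m IH] F irr sub hC hF.
  have [_ [x Vx] _] := irr 0%N (leqnn _).
  have := hF _ Vx; rewrite (mpoly0_const F) comp_mpolyC mevalC => ->.
  by rewrite mpolyC0.
apply: contrapT => /eqP F0.
have q0 : muni F != 0 by apply: contra_neq F0 => e; rewrite -(muniK F) e rmorph0.
have [j [q' hq' eq']] := multiplicity_XsubC (muni F) 0.
move: hq'; rewrite q0 /= => nr.
have eval (G : {poly {mpoly K[m]}}) x : (munV G \mPo [tuple C i | i < m.+1]).@[x] =
    (map_poly (meval (fun i : 'I_m => (C i).@[x])) G).[(C m).@[x]].
  rewrite comp_mpoly_meval munV_eval tnth_mktuple; congr (_.[_]).
  apply: eq_map_poly => c; apply: meval_eq => i.
  by rewrite /init tnth_mktuple.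
have : vanish (V m.+1) (munV q' \mPo [tuple C i | i < m.+1]).
  have [|||h] := @irreducible_mul _ _ (V m.+1) (munV q' \mPo [tuple C i | i < m.+1]) (C m ^+ j).
  - exact: irr.
  - move=> x /hF; rewrite -(muniK F) eq' eval mevalM eval rmorphM /= hornerM => <-.
    by rewrite polyC0 subr0 map_polyXn hornerXn rmorphXn.
  - by [].
  - by have [_] := hC m (leqnn _); case; apply: irreducible_exp h; apply: irr.
move=> hq; case/negP: nr; apply/rootP; rewrite horner_coef0.
apply: IH => [i im|i im|i im|x Vx].
- exact/irr/leqW.
- exact/sub/leqW.
- exact/hC/leqW.
have := hq x (sub _ (leqnn _) _ Vx).
have [h _] := hC m (leqnn _); rewrite eval (h x Vx) horner_coef0 coef_map /= => <-.
by rewrite comp_mpoly_meval; apply: meval_eq => i; rewrite tnth_mktuple.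
Qed.

Lemma chain_sub (K : fieldType) n (V : nat -> subset_of K n) m :
  (forall i, (i < m)%N -> sub_set (V i) (V i.+1)) ->
  forall i, (i <= m)%N -> sub_set (V i) (V m).
Proof.
elim: m => [|m IH] h i; first by rewrite leqn0 => /eqP -> x.
rewrite leq_eqVlt ltnS => /predU1P[->|im] x Vx //.
by apply: (h m) => //; apply: IH im _ Vx => j /leqW/h.
Qed.

Section CoverTheory.
Variables (K : numClosedFieldType) (n k : nat) (Y : subset_of K n).
Variables (pi : k.-tuple {mpoly K[n]}) (N : nat) (fib : pt K k -> 'I_N -> pt K n).
Variable (d : nat).
Hypothesis hY : finite_cover Y pi fib d.

Local Notation proj := (mpoly_map pi).

Lemma cover_fib y : Y y -> exists i, fib (proj y) i = y.
Proof. by case: hY => h _ _; apply: h. Qed.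

Lemma fib_cover a i : Y (fib a i).
Proof. by case: hY => _ /(_ a i)[]. Qed.

Lemma fib_proj a i : proj (fib a i) = a.
Proof. by case: hY => _ /(_ a i)[]. Qed.

Lemma cover_chi w : exists chi : {poly {mpoly K[k]}},
  [/\ chi \is monic,
      forall a t, (map_poly (meval a) chi).[t] = \prod_i (t - w.@[fib a i]),
      vanish Y (polysub pi chi w) &
      degle 1 w -> poly_filt (@degle K k) d chi].
Proof.
case: hY => _ _ /(_ w)[chi [cm cE cd]].
have cE' a t : (map_poly (meval a) chi).[t] = \prod_i (t - w.@[fib a i]).
  by rewrite cE horner_prod; apply: eq_bigr => i _; rewrite !hornerE.
exists chi; split=> // y /cover_fib[i hi].
by rewrite polysubE cE' (bigD1 i) //= hi subrr mul0r.
Qed.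

(* Elements of the coordinate ring are integral over the base, so a strict
   inclusion of irreducible sets is already visible on the base. *)
Lemma strict_sub_base V W : irreducible_variety V -> irreducible_variety W ->
  sub_set W Y -> strict_sub_set V W ->
  exists c : {mpoly K[k]}, vanish V (c \mPo pi) /\ ~ vanish W (c \mPo pi).
Proof.
move=> [cV _ _] iW WY [VW [x [Wx nVx]]].
have [h hV hx] := closed_vanish cV nVx.
have [chi [cm _ cY _]] := cover_chi h.
have {cY} : vanish W (polysub pi chi h) by move=> y /WY/cY.
have : exists i, ~ vanish W (chi`_i \mPo pi).
  exists (size chi).-1; rewrite -lead_coefE (monicP cm) => /(_ x Wx)/eqP.
  by rewrite comp_eval meval1 oner_eq0.
(* Induction on a relation for [h] valid on [W]. A constant coefficient that does not vanish on [W]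
   is the function sought, since [h] is zero on [V]; otherwise [h] is divided out, not being
   identically zero on [W]. *)
elim/poly_ind: chi {cm} => [|q c IH] [i hi] hq.
  by case: hi => y _; rewrite coef0 comp_eval meval0.
have [hc|hc] := pselect (vanish W (c \mPo pi)); last first.
  exists c; split=> // y Vy; have := hq y (VW _ Vy).
  rewrite polysubE rmorphD rmorphM /= map_polyX map_polyC !hornerE (hV y Vy) mulr0 add0r.
  by rewrite comp_eval.
apply: IH.
  case: i hi => [|i] hi; last by exists i; move: hi; rewrite coefD coefC coefMX addr0.
  by case: hi; rewrite coefD coefC coefMX add0r.
have [//||h1|h1] := @irreducible_mul _ _ W (polysub pi q h) h.
- move=> y Wy; have := hq y Wy.
  rewrite mevalM !polysubE rmorphD rmorphM /= map_polyX map_polyC !hornerE.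
  by move=> /= <-; have := hc y Wy; rewrite comp_eval => ->; rewrite addr0.
- exact: h1.
- by move: hx; rewrite (h1 x Wx) eqxx.
Qed.

(** Each strict inclusion of a chain gives a function from the base; [chain_independent] makes these
    independent, while [k.+1] polynomials in [k] variables never are. *)
Lemma cover_dim_le : dim_le Y k.
Proof.
move=> [V [irrV subV VY]].
have subY i : (i <= k.+1)%N -> sub_set (V i) Y.
  move=> ik x Vx; apply: VY; apply: (@chain_sub _ _ V k.+1 _ i ik x Vx).
  by move=> j /subV[].
have /choice[c hc] : forall i : 'I_k.+1, exists c : {mpoly K[k]},
    vanish (V i) (c \mPo pi) /\ ~ vanish (V i.+1) (c \mPo pi).
  move=> i; have ik := ltn_ord i; apply: strict_sub_base.
  - exact/irrV/ltnW.
  - exact: irrV.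
  - exact: subY.
  - exact: subV.
have [F F0 Fc] := algebraic_dependence c.
pose C i := c (inord i) \mPo pi.
have CE (i : 'I_k.+1) : C i = c i \mPo pi by rewrite /C inord_val.
move/eqP: F0; apply; apply: (@chain_independent K n V C k.+1 F) => //.
- by move=> i /subV[].
- by move=> i ik; rewrite -[i ]/(nat_of_ord (Ordinal ik)) CE; apply: hc.
move=> x Vx; transitivity ((F \mPo [tuple c i | i < k.+1]) \mPo pi).@[x].
  rewrite [RHS]comp_eval !comp_mpoly_meval; apply: meval_eq => i.
  by rewrite !tnth_mktuple /C inord_val comp_eval.
by rewrite Fc comp_mpoly0 meval0.
Qed.

(** If [chi] had no lower coefficient it would be a power of the variable and [g] would be zero on
    [Y]. A nonzero lower coefficient serves as [e]: where [g] vanishes on the whole fibre, [chi]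
    becomes [X^N]. So a function nonzero at a single point is nonzero on the generic fibre, which
    leaves no room for components of smaller dimension. *)
Lemma cover_nonvanishing g y : Y y -> g.@[y] != 0 ->
  exists2 e : {mpoly K[k]}, e != 0 &
    forall a, e.@[a] != 0 -> exists i, g.@[fib a i] != 0.
Proof.
move=> Yy gy; have [chi [cm cE cY _]] := cover_chi g.
have [[i [ci i0]]|h] := pselect (exists i, (i < (size chi).-1)%N /\ chi`_i != 0).
  exists chi`_i => // a ha; apply: contrapT => nh; move/eqP: ha; apply.
  have ca : map_poly (meval a) chi = 'X^N.
    apply: poly_eval_eq => t; rewrite cE hornerXn.
    transitivity (\prod_(i < N) t); last by rewrite prodr_const card_ord.
    apply: eq_bigr => j _.
    suff -> : g.@[fib a j] = 0 by rewrite subr0.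
    by apply: contrapT => /eqP hj; apply: nh; exists j.
  rewrite -coef_map ca coefXn; case: eqP => // eN.
  have := size_map_monic (meval a) cm; rewrite ca size_polyXn => sN.
  by move: ci; rewrite -sN eN ltnn.
have chiX : chi = 'X^((size chi).-1).
  apply/polyP => i; rewrite coefXn; case: ltngtP => [hi|hi|->].
  - by apply: contrapT => /eqP ci; apply: h; exists i.
  - by rewrite nth_default // (leq_trans _ hi) // leqSpred.
  - exact: (monicP cm).
have := cY y Yy; rewrite polysubE chiX map_polyXn hornerXn => /eqP.
by rewrite expf_eq0 (negPf gy) andbF.
Qed.

Section Components.
Variables (m : nat) (C : 'I_m -> subset_of K n).
Hypothesis hC : component_decomposition Y C.

Let irrC i : irreducible_variety (C i). Proof. by case: hC. Qed.
Let CY i y : C i y -> Y y.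
Proof. by case: hC => _ _ h Cy; apply/h; exists i. Qed.
Let YC y : Y y -> exists i, C i y.
Proof. by case: hC => _ _ h /h. Qed.

Lemma separating_component i : exists g,
  (exists2 y, C i y & g.@[y] != 0) /\ forall j, j != i -> vanish (C j) g.
Proof.
have /choice[f hf] : forall j, exists f, j != i -> vanish (C j) f /\ ~ vanish (C i) f.
  move=> j; have [->|ji] := eqVneq j i; first by exists 0.
  have [_ /(_ i j) h _] := hC; rewrite eq_sym in h.
  have [[y [Cy nCy]]|nh] := pselect (exists y, C i y /\ ~ C j y).
    have [cCj _ _] := irrC j; have [g gj gy] := closed_vanish cCj nCy.
    by exists g => _; split=> // /(_ y Cy)/eqP; rewrite (negPf gy).
  by case: (h ji) => y Cy; apply: contrapT => nCy; apply: nh; exists y.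
pose g := \prod_(j <- [seq f j | j <- enum 'I_m & j != i]) j.
exists g; split; last first.
  move=> j ji y Cy; rewrite /g big_map (bigD1_seq j) /=.
  - by rewrite mevalM (hf j ji).1 // mul0r.
  - by rewrite mem_filter ji mem_enum.
  - by rewrite filter_uniq // enum_uniq.
apply: contrapT => h; have : vanish (C i) g.
  by move=> z Cz; apply: contrapT => /eqP gz; apply: h; exists z.
case/(irreducible_prod (irrC i)) => _ /mapP[j + ->].
by rewrite mem_filter => /andP[ji _]; apply: (hf j ji).2.
Qed.

Lemma component_base i : exists2 e : {mpoly K[k]}, e != 0 &
  forall a, e.@[a] != 0 -> exists2 y, C i y & proj y = a /\
    forall j, j != i -> ~ C j y.
Proof.
have [g [[y Cy gy] hg]] := separating_component i.
have [e e0 he] := cover_nonvanishing (CY Cy) gy.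
exists e => // a /he[l hl]; exists (fib a l).
  have [j Cj] := YC (fib_cover a l).
  have [<-//|ji] := eqVneq j i.
  by move: hl; rewrite (hg j ji) ?eqxx.
split; first exact: fib_proj.
by move=> j ji Cj; move: hl; rewrite (hg j ji) ?eqxx.
Qed.

Lemma component_dominant i (c : {mpoly K[k]}) : vanish (C i) (c \mPo pi) -> c = 0.
Proof.
move=> hc; have [e e0 he] := component_base i.
apply: contrapT => /eqP c0.
have [a] : exists a, (e * c).@[a] != 0 by apply/mpoly_nonroot/mulf_neq0.
rewrite mevalM mulf_eq0 negb_or => /andP[/he[y Cy [<- _]]].
by rewrite -comp_eval hc ?eqxx.
Qed.

(** Over a generic point each component owns a fibre point that lies on no other component. *)
Lemma components_number : (m <= N)%N.
Proof.
have /choice[e he] : forall i, exists e : {mpoly K[k]}, e != 0 /\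
    forall a, e.@[a] != 0 -> exists2 y, C i y & proj y = a /\
    forall j, j != i -> ~ C j y.
  by move=> i; have [e e0 h] := component_base i; exists e.
have [a] : exists a, (\prod_i e i).@[a] != 0.
  by apply/mpoly_nonroot/prodf_neq0 => i _; apply: (he i).1.
rewrite rmorph_prod => /prodf_neq0 ha.
have /choice[l hl] : forall i, exists l, C i (fib a l) /\ forall j, j != i -> ~ C j (fib a l).
  move=> i; have [y Cy [ya hy]] := (he i).2 a (ha i isT).
  by have [l hl] := cover_fib (CY Cy); exists l; rewrite -ya hl.
have linj : injective l.
  move=> i j lij; apply: contrapT => /eqP ij.
  by apply: ((hl j).2 i ij); rewrite -lij; apply: (hl i).1.
by have := leq_card l linj; rewrite !card_ord.
Qed.

End Components.
End CoverTheory.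

(** * Bezout bound in the plane *)

Section ShearIso.
Variables (K : numFieldType) (n : nat) (v : pt K n.+1).
Hypothesis v0 : v ord_max != 0.

Lemma shear_compK : cancel (comp_mpoly (shear_tuple v)) (comp_mpoly (unshear_tuple v)).
Proof.
by move=> p; apply: mpoly_eval_eq => x; rewrite unshear_eval shear_eval unshearK.
Qed.

Lemma unshear_compK : cancel (comp_mpoly (unshear_tuple v)) (comp_mpoly (shear_tuple v)).
Proof.
by move=> p; apply: mpoly_eval_eq => x; rewrite shear_eval unshear_eval shearK.
Qed.

Lemma prime_shear p : prime_elt p -> prime_elt (p \mPo shear_tuple v).
Proof. exact: prime_transfer shear_compK unshear_compK p. Qed.

End ShearIso.

Lemma mpoly_const_unit (K : fieldType) n (p : {mpoly K[n]}) :
  p != 0 -> degle 0 p -> p \is a GRing.unit.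
Proof.
move=> p0 /degle_const e; rewrite e rmorph_unit // unitfE.
by apply: contra_neq p0 => h; rewrite e h.
Qed.

Lemma prime_msize (K : fieldType) n (p : {mpoly K[n]}) : prime_elt p -> (1 < msize p)%N.
Proof.
move=> [p0 pu _]; rewrite ltnNge; apply: contra pu => h.
exact: mpoly_const_unit.
Qed.

Section MonicShear.
Variables (F : numFieldType) (n : nat).
Implicit Types p q : {mpoly F[n.+1]}.

(** A general direction [v] works: a nonzero top form makes the leading coefficient a nonzero
    constant, a nonzero last coordinate makes the shear invertible, and [q] carries any further open
    condition. *)
Lemma monic_shear p q : p != 0 -> q != 0 ->
  exists (v : pt F n.+1) (c : F), [/\ v ord_max != 0, q.@[v] != 0, c != 0,
    c%:MP *: muni (p \mPo shear_tuple v) \is monic &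
    size (muni (p \mPo shear_tuple v)) = msize p].
Proof.
move=> p0 q0.
have [v] : exists v, (q * ('X_ord_max * topform (msize p).-1 p)).@[v] != 0.
  apply: mpoly_nonroot; rewrite mulf_neq0 // mulf_neq0 ?topform_neq0 //.
  by rewrite -msize_poly_eq0 msizeX mdeg1.
rewrite !mevalM mevalXU !mulf_eq0 !negb_or => /and3P[qv v0 tv].
have dp : degle (msize p).-1 p by rewrite /degle leqSpred.
have [sP [c c0 lcP]] := shear_lead dp tv.
exists v, c^-1; split; rewrite ?invr_eq0 //.
  by rewrite monicE lead_coefZ lcP -mpolyCM mulVf.
by rewrite sP prednK // lt0n msize_poly_eq0.
Qed.

Lemma muni_prime p : prime_elt p -> prime_elt (muni p).
Proof. exact: (prime_transfer (@muniK F n) (@munVK F n)). Qed.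

Lemma prime_mulu (A : idomainType) (u a : A) :
  u \is a GRing.unit -> prime_elt a -> prime_elt (u * a).
Proof.
move=> uu [a0 au pa]; split.
- by rewrite mulf_neq0 // (contraTneq _ uu) // => ->; rewrite unitr0.
- by rewrite unitrM negb_and au orbT.
move=> b c [d e]; have [] := pa b c; first by exists (d * u); rewrite e mulrA.
- by case=> h ->; left; exists (h * u^-1); rewrite mulrA divrK.
- by case=> h ->; right; exists (h * u^-1); rewrite mulrA divrK.
Qed.

Lemma prime_monic_shear p q D : prime_elt p -> q != 0 -> degle D p ->
  exists v : pt F n.+1, [/\ v ord_max != 0, q.@[v] != 0 &
    exists c P, [/\ c != 0, P = c%:MP *: muni (p \mPo shear_tuple v) &
      [/\ prime_elt P, P \is monic, (1 < size P)%N & poly_filt (@degle F n) D P]]].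
Proof.
move=> pp q0 dp; have [p0 _ _] := pp.
have [v [c [v0 qv c0 Pm sP]]] := monic_shear p0 q0.
exists v; split=> //; exists c, (c%:MP *: muni (p \mPo shear_tuple v)); split=> //.
have cu : c%:MP_[n] \is a GRing.unit by rewrite rmorph_unit // unitfE.
split=> //.
- rewrite -mul_polyC; apply: prime_mulu; first by rewrite polyC_unitE.
  exact/muni_prime/prime_shear.
- by rewrite size_scale ?mpolyC_eq0 // sP prime_msize.
have [sf hf] : poly_filt (@degle F n) D (muni (p \mPo shear_tuple v)).
  by apply/muni_filt/degle_comp => // i; apply: shear_tuple_degle.
split=> [|i]; first by apply: leq_trans (size_scale_leq _ _) sf.
by rewrite coefZ mul_mpolyC; apply/degleZ.
Qed.

Lemma sheared_eval p v c x :
  (map_poly (meval (init x)) (c%:MP *: muni (p \mPo shear_tuple v))).[x ord_max] =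
  c * p.@[shear v x].
Proof.
by rewrite -shear_eval muni_eval -mul_polyC rmorphM /= map_polyC /= hornerM hornerC mevalC.
Qed.

(** Completes [normp_eq0_dvd]: the cofactor found there is too small to be a multiple of the
    prime. *)
Lemma prime_small_divides (P w w' : {poly {mpoly F[n]}}) : prime_elt P -> w != 0 ->
  (size w < size P)%N -> divides P (w * w') -> divides P w'.
Proof.
move=> [P0 _ pP] w0 sw /pP[[g e]|//]; have g0 : g != 0.
  by apply: contra_neq w0 => g0; rewrite e g0 mul0r.
have := size_mul g0 P0; rewrite -e => ew.
have := ew; rewrite (polySpred g0) addSn /= => ew'.
by move: sw; rewrite ew' ltnNge leq_addl.
Qed.

Lemma sheared_divides p v c (w : {poly {mpoly F[n]}}) : v ord_max != 0 ->
  divides (c%:MP *: muni (p \mPo shear_tuple v)) w ->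
  divides p (munV w \mPo unshear_tuple v).
Proof.
move=> v0 [g ->]; exists ((munV (g * c%:MP%:P)) \mPo unshear_tuple v).
by rewrite -mul_polyC mulrA rmorphM /= muniK rmorphM /= (shear_compK v0).
Qed.

End MonicShear.

Section Bezout.
Variable (K : numClosedFieldType).
Implicit Types (p g : {mpoly K[2]}).

(** The degree that [normp_filt] gives to the norm of one polynomial modulo another, both of degree
    [D]; it is cruder than the classical [D * D]. *)
Definition bezout_bound D := (D * (D + D * D))%N.

(** A curve is infinite: after a shear it has a point over every value of the first coordinate, and
    some value differs from those of the finite set [E]. *)
Lemma prime_zero_outside p e (E : 'I_e -> pt K 2) : prime_elt p ->
  exists x, p.@[x] = 0 /\ forall i, E i <> x.
Proof.
move=> pp; have [v [v0 _ [c [P [c0 eP [_ Pm sP _]]]]]] :=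
  prime_monic_shear pp (oner_neq0 _) (leqSpred _ : degle (msize p).-1 p).
have [|t ht] := @poly_nonroot K (\prod_(i < e) ('X - (unshear v (E i) (widen1 ord0))%:P)).
  by apply/prodf_neq0 => i _; rewrite polyXsubC_eq0.
pose a : pt K 1 := fun=> t.
have := size_rootseq (monic_map (meval a) Pm); rewrite size_map_monic //.
case eR : (rootseq _) => [|z rs] /=; first by case: (size P) sP => [|[]].
move=> _; exists (shear v (snoc a z)); split.
  have /eqP : c * p.@[shear v (snoc a z)] = 0.
    rewrite -sheared_eval -eP snocK snoc_max; apply/rootP.
    by rewrite -mem_rootseq ?monic_map // eR mem_head.
  by rewrite mulf_eq0 (negPf c0) => /eqP.
move=> i Ei; move/eqP: ht; apply.
rewrite horner_prod (bigD1 i) //= Ei shearK // snoc_widen.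
by rewrite !hornerE subrr mul0r.
Qed.

(** The norm of [g] modulo [p] is a polynomial in one variable, nonzero because [p] does not divide
    [g]. It vanishes at the projections of the common zeros, which the choice of [v] keeps
    distinct. *)
Lemma bezout_prime p g D e (E : 'I_e -> pt K 2) : prime_elt p -> ~ divides p g ->
  degle D p -> degle D g -> injective E ->
  (forall i, p.@[E i] = 0 /\ g.@[E i] = 0) -> (e <= bezout_bound D)%N.
Proof.
move=> pp npg dp dg injE hE.
pose l0 : 'I_2 := widen1 ord0.
(* The determinant of [E i - E j] and the direction: where it is nonzero, projecting along that
   direction separates the two points. *)
pose sep (i j : 'I_e) : {mpoly K[2]} :=
  (E i l0 - E j l0) *: 'X_ord_max - (E i ord_max - E j ord_max) *: 'X_l0.
have sep0 i j : i != j -> sep i j != 0.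
  move=> ij; apply: contra_neq ij => h; apply: injE; apply/funext => l.
  have := congr1 (meval (fun l => (l == ord_max)%:R)) h.
  have := congr1 (meval (fun l => (l == l0)%:R)) h.
  rewrite /sep !mevalB !mevalZ !mevalXU !meval0 !eqxx /=.
  rewrite !mulr1 !mulr0 subr0 sub0r => /eqP; rewrite oppr_eq0 => /eqP h1 h2.
  apply/eqP; rewrite -subr_eq0; apply/eqP.
  have [->|[j' ->]] := ord_maxVwiden l; first exact: h1.
  by rewrite [j']ord1; exact: h2.
have sepP : \prod_(ij : 'I_e * 'I_e | ij.1 != ij.2) sep ij.1 ij.2 != 0.
  by apply/prodf_neq0 => ij /sep0.
have [v [v0 qv [c [P [c0 eP [pP Pm sP dP]]]]]] := prime_monic_shear pp sepP dp.
pose G := muni (g \mPo shear_tuple v).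
have dG : poly_filt (@degle K 1) D G.
  by apply/muni_filt/degle_comp => // i; apply: shear_tuple_degle.
pose N := normp P G.
have N0 : N != 0.
  apply/eqP => /(normp_eq0_dvd Pm sP)[w [q [w0 sw e1]]]; apply: npg.
  have := prime_small_divides pP w0 sw (ex_intro _ q e1).
  by rewrite eP => /(sheared_divides v0); rewrite /G muniK shear_compK.
have dN : degle (bezout_bound D) N by apply: (normp_filt (degle_filtration K 1)).
pose x i := unshear v (E i).
have Nx i : N.@[init (x i)] = 0.
  rewrite /N -normp_map // normp_rootseq ?monic_map ?size_map_monic //.
  apply/eqP; rewrite prodf_seq_eq0; apply/hasP; exists (x i ord_max).
    by rewrite mem_rootseq ?monic_map // /root eP sheared_eval unshearK // (hE i).1 mulr0.
  by rewrite /= -muni_eval shear_eval unshearK // (hE i).2.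
have xinj : injective (fun i => x i l0).
  move=> i j xij; apply: contrapT => /eqP ij; move/eqP: qv; apply.
  rewrite rmorph_prod; apply/eqP; rewrite prodf_seq_eq0; apply/hasP.
  exists (i, j); first exact: mem_index_enum.
  have ab : E i l0 - E j l0 =
      v l0 * (E i ord_max / v ord_max) - v l0 * (E j ord_max / v ord_max).
    move: xij; rewrite /x /unshear -val_eqE /= !addr0 => xij.
    by rewrite -(subrK (v l0 * (E i ord_max / v ord_max)) (E i l0)) xij; ring.
  by rewrite /= ij /sep mevalB !mevalZ !mevalXU ab; apply/eqP; field.
have R0 : muni N != 0 by apply: contra_neq N0 => h; rewrite -(muniK N) h rmorph0.
pose r := map_poly (meval (fun=> 0)) (muni N).
have init0 (y : pt K 1) : init y = fun=> 0 by apply/funext => -[].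
have r0 : r != 0.
  have [y Ny] := mpoly_nonroot N0; apply: contra_neq Ny => h.
  by rewrite muni_eval init0 -/r h horner0.
have sr : (size r <= (bezout_bound D).+1)%N.
  by apply: leq_trans (size_poly _ _) (size_muni dN).
suff : (e < size r)%N by move=> h; rewrite -ltnS; apply: leq_trans h sr.
have -> : e = size [seq x i l0 | i <- enum 'I_e] by rewrite size_map size_enum_ord.
apply: max_poly_roots => //; last by rewrite map_inj_uniq ?enum_uniq.
apply/allP => _ /mapP[i _ ->]; rewrite /root.
have := Nx i; rewrite muni_eval init0 -/r => h.
by apply/eqP; rewrite -[RHS]h; congr (_.[_]); rewrite /init; congr (x i _); apply: val_inj.
Qed.

Lemma prime_count (s : seq {mpoly K[2]}) f u D : f != 0 -> degle D f ->
  f = u * \prod_(p <- s) p -> (forall p, p \in s -> prime_elt p) -> (size s <= D)%N.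
Proof.
move=> f0 df ef ps; have := degle_dvd f0 (ex_intro _ u ef) df.
have ps0 : \prod_(p <- s) p != 0 by apply: contra_neq f0 => h; rewrite ef h mulr0.
elim: s D ps ps0 {ef df} => // p s IH D ps; rewrite big_cons mulf_eq0 negb_or.
move=> /andP[p0 ps0]; rewrite /degle msizeM // => h.
have := prime_msize (ps _ (mem_head _ _)); move: h.
have := IH D.-1 _ ps0; rewrite /degle.
case: D => [|D] h; case: (msize p) => [|[|a]] //= h1 _.
  move: h1; rewrite addnC addnS /= leqNgt; have := ps0.
  by rewrite -msize_poly_eq0 -lt0n; case: (msize _).
apply: h => [q qs|]; first by apply: ps; rewrite inE qs orbT.
by rewrite -ltnS; apply: leq_trans h1; rewrite addSn ltnS leq_addl.
Qed.

Lemma card_has_le e (T : eqType) (s : seq T) (P : T -> pred 'I_e) B :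
  (forall q : T, q \in s -> (#|[set i | P q i]| <= B)%N) ->
  (#|[set i | has (fun q => P q i) s]| <= size s * B)%N.
Proof.
elim: s => [|q s IH] h /=; first by rewrite (_ : [set i | _] = set0) ?cards0.
rewrite (_ : [set i | _] = [set i | P q i] :|: [set i | has (fun q => P q i) s]); last first.
  by apply/setP => i; rewrite !inE.
apply: leq_trans (leq_card_setU _ _) _; rewrite mulSn.
apply: leq_add; first by apply: h; rewrite mem_head.
by apply: IH => r rs; apply: h; rewrite inE rs orbT.
Qed.

(** Curves are infinite, so a family with finite zero set has no common prime factor. Each of the at
    most [D] primes of a nonzero member [f] then fails to divide some member, and [bezout_prime]
    counts the zeros on it. *)
Lemma bezout_finite (Phi : {mpoly K[2]} -> Prop) D e (E : 'I_e -> pt K 2) :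
  (forall f, Phi f -> degle D f) -> injective E ->
  (forall x, (forall f, Phi f -> f.@[x] = 0) <-> exists i, E i = x) ->
  (e <= D * bezout_bound D)%N.
Proof.
move=> dPhi injE hE.
have out p : prime_elt p -> exists g, Phi g /\ ~ divides p g.
  move=> pp; have [x [px nx]] := prime_zero_outside E pp.
  apply: contrapT => h; have /hE[i /(nx i)] // : forall f, Phi f -> f.@[x] = 0.
  move=> f hf; have [[c ->]|nd] := pselect (divides p f).
    by rewrite mevalM px mulr0.
  by case: h; exists f.
(* If every member is zero, the zero set is the whole plane, which is infinite. *)
have [[f [hf f0]]|nf] := pselect (exists f, Phi f /\ f != 0); last first.
  have [|t ht] := @poly_nonroot K (\prod_(i < e) ('X - (E i ord0)%:P)).
    by apply/prodf_neq0 => i _; rewrite polyXsubC_eq0.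
  have /hE[i Ei] : forall f, Phi f -> f.@[fun=> t] = 0.
    move=> f hf; suff -> : f = 0 by rewrite meval0.
    by apply: contrapT => /eqP f0; apply: nf; exists f.
  move/eqP: ht; case; rewrite horner_prod (bigD1 i) //= Ei.
  by rewrite !hornerE subrr mul0r.
have [u [s [uu ps ef]]] := factorial_mpoly f0.
have ss := prime_count f0 (dPhi f hf) ef ps.
apply: leq_trans (leq_mul ss (leqnn _)).
have -> : e = #|[set i | has (fun p => p.@[E i] == 0) s]|.
  rewrite (_ : [set i | _] = setT) ?cardsT ?card_ord //; apply/setP => i; rewrite !inE.
  have : f.@[E i] = 0 by have /hE : exists j, E j = E i by [exists i]; apply.
  rewrite ef mevalM rmorph_prod /= => /eqP; rewrite mulf_eq0 prodf_seq_eq0.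
  case/orP => // /eqP h; have := rmorph_unit (meval (E i)) uu.
  by rewrite /= h unitr0.
apply: (card_has_le (P := fun p i => p.@[E i] == 0)) => p pfs.
have [g [hg pg]] := out p (ps p pfs).
pose A := [set i | p.@[E i] == 0].
apply: (@bezout_prime p g D #|A| (fun i => E (enum_val i))) => //.
- exact: ps.
- apply: degle_dvd f0 _ (dPhi f hf); exists (u * \prod_(q <- rem p s) q).
  by rewrite ef (perm_big _ (perm_to_rem pfs)) big_cons /= mulrCA mulrC.
- exact: dPhi.
- by move=> i j /injE/enum_val_inj.
move=> i; split; first by have := enum_valP i; rewrite inE => /eqP.
by have /hE : exists j, E j = E (enum_val i) by [exists (enum_val i)]; apply.
Qed.
End Bezout.

(** * Degree of a surface finite over the plane *)

Section Separation.
Variable K : numFieldType.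

(** The coefficients of [u] form a point off the finitely many hyperplanes orthogonal to the nonzero
    differences [y l - x]. *)
Lemma separating_form n N (x : pt K n) (y : 'I_N -> pt K n) :
  exists u : {mpoly K[n]}, degle 1 u /\ forall l, y l <> x -> u.@[y l] != u.@[x].
Proof.
pose f l : {mpoly K[n]} := \sum_j (y l j - x j) *: 'X_j.
have fE l v : (f l).@[v] = \sum_j v j * (y l j - x j).
  by rewrite raddf_sum /=; apply: eq_bigr => j _; rewrite mevalZ mevalXU mulrC.
have f0 l : y l <> x -> f l != 0.
  move=> h; apply: contra_not_neq h => h; apply/funext => j.
  have := fE l (fun i => (i == j)%:R); rewrite h meval0 (bigD1 j) //= eqxx mul1r.
  rewrite big1 ?addr0 => [/eqP|i /negPf ->]; last by rewrite mul0r.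
  by rewrite eq_sym subr_eq0 => /eqP.
have [v] : exists v, (\prod_(l < N | `[< y l <> x >]) f l).@[v] != 0.
  by apply/mpoly_nonroot/prodf_neq0 => l /asboolP/f0.
rewrite rmorph_prod => /prodf_neq0 hv; exists (\sum_j v j *: 'X_j); split.
  by apply: degle_sum => j _; apply/degleZ/degleX.
have uE z : (\sum_j v j *: 'X_j).@[z] = \sum_j v j * z j.
  by rewrite raddf_sum /=; apply: eq_bigr => j _; rewrite mevalZ mevalXU.
move=> l hl; have := hv l (asboolT hl); rewrite /= fE !uE => h.
rewrite -subr_eq0 -sumrB; under eq_bigr do rewrite -mulrBr.
exact: h.
Qed.

Lemma avoid_scalars N (c g : 'I_N -> K) : (forall l, c l != 0 \/ g l != 0) ->
  exists s, forall l, c l + s * g l != 0.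
Proof.
move=> h; have [s] : exists s, (\prod_(l < N) ((c l)%:P + (g l)%:P * 'X)).[s] != 0.
  apply/poly_nonroot/prodf_neq0 => l _; apply/eqP => e.
  have := congr1 (fun q : {poly K} => q`_0) e; have := congr1 (fun q : {poly K} => q`_1) e.
  rewrite /= !(coefD, coefC, coefMX, coef0) /= add0r addr0 => g0 c0.
  by case: (h l) => /eqP.
rewrite horner_prod => /prodf_neq0 hs; exists s => l.
by have := hs l isT; rewrite !hornerE mulrC.
Qed.

End Separation.

Section CoverDegree.
Variables (K : numClosedFieldType) (n k : nat) (Y : subset_of K n).
Variables (pi : k.-tuple {mpoly K[n]}) (N : nat) (fib : pt K k -> 'I_N -> pt K n).
Variable (d : nat).
Hypothesis hY : finite_cover Y pi fib d.
Hypothesis hpi : forall i, degle 1 (tnth pi i).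
Variables (m : nat) (C : 'I_m -> subset_of K n).
Hypothesis hC : component_decomposition Y C.
Local Notation proj := (mpoly_map pi).

Let irrC i : irreducible_variety (C i). Proof. by case: hC. Qed.
Let CY i y : C i y -> Y y.
Proof. by case: hC => _ _ h Cy; apply/h; exists i. Qed.

Lemma polysub_unit u h y : u \is a GRing.unit -> (polysub pi u h).@[y] != 0.
Proof.
move=> uu; have : polysub pi u h * polysub pi u^-1 h = 1.
  by rewrite -polysubM mulrV // /polysub rmorph1 hornerC.
move=> /(congr1 (meval y)); rewrite mevalM meval1 => e.
by apply/eqP => e0; move/eqP: e; rewrite e0 mul0r eq_sym oner_eq0.
Qed.

(* The prime factor of the characteristic polynomial of [u] that vanishes on the
   component also divides the characteristic polynomial of [u + s g] for every
   [g] vanishing on the component, and the latter can be made nonzero at [x]. *)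
Lemma component_equation i x : ~ C i x ->
  exists F, [/\ degle (4 * d) F, vanish (C i) F & F.@[x] != 0].
Proof.
move=> nCx; have [cCi _ _] := irrC i; have [g gC gx] := closed_vanish cCi nCx.
set a := proj x; have [u [du hu]] := separating_form x (fib a).
(* The form [u + s g] must miss the value of [u] at [x] on the whole fibre through [a]; at a fibre
   point equal to [x] this holds because [g] is nonzero there. *)
have [s hs] : exists s, forall l, (u.@[fib a l] - u.@[x]) + s * g.@[fib a l] != 0.
  apply: avoid_scalars => l; have [->|ne] := pselect (fib a l = x); first by right.
  by left; rewrite subr_eq0 hu.
pose w := u + s *: g.
have [chiu [mu _ Yu /(_ du) fu]] := cover_chi hY u.
have [chiw [mw wE Yw _]] := cover_chi hY w.
have wx : (map_poly (meval a) chiw).[u.@[x]] != 0.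
  rewrite wE; apply/prodf_neq0 => l _; rewrite /w mevalD mevalZ.
  by rewrite -oppr_eq0 opprB addrAC.
have chiu0 : chiu != 0 by apply: monic_neq0.
have fact := factorial_poly (@factorial_mpoly K k).
have [U [Fs [Uu pF eF]]] := fact _ chiu0.
have [F FFs CF] : exists2 F, F \in Fs & vanish (C i) (polysub pi F u).
  have : vanish (C i) (polysub pi U u * \prod_(F <- [seq polysub pi F u | F <- Fs]) F).
    have -> : \prod_(F <- [seq polysub pi F u | F <- Fs]) F = polysub pi (\prod_(F <- Fs) F) u.
      rewrite big_map; elim: (Fs) => [|F Gs IH]; last by rewrite !big_cons polysubM IH.
      by rewrite !big_nil /polysub rmorph1 hornerC.
    by rewrite -polysubM -eF => y /CY/Yu.
  case/(irreducible_mul (irrC i)) => [h|/(irreducible_prod (irrC i))[_ /mapP[F FFs ->] h]].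
    have [_ [y Cy] _] := irrC i.
    by have := polysub_unit u y Uu; rewrite (h y Cy) eqxx.
  by exists F.
have pFF := pF _ FFs; have [F0 Fu Fp] := pFF.
have [cF ecF] : divides F chiu.
  exists (U * \prod_(G <- rem F Fs) G).
  by rewrite eF (perm_big _ (perm_to_rem FFs)) big_cons /= mulrCA mulrC.
(* A factor of a monic polynomial has an invertible leading coefficient, so it can be made monic and
   norms modulo it make sense. *)
have lcu : lead_coef F \is a GRing.unit.
  apply/unitrPr; exists (lead_coef cF); rewrite mulrC -lead_coefM -ecF.
  exact: (monicP mu).
have lc0 : (lead_coef F)^-1 != 0 by rewrite invr_eq0 lead_coef_eq0.
pose F' := (lead_coef F)^-1 *: F.
have mF' : F' \is monic by rewrite monicE lead_coefZ mulVr.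
have sF' : size F' = size F by rewrite size_scale.
have sF : (1 < size F)%N.
  rewrite ltnNge; apply: contra Fu => /size1_polyC e; rewrite e polyC_unitE.
  by have -> : F`_0 = lead_coef F by rewrite [in RHS]e lead_coefC.
have FF' q : divides F (q * F').
  by exists (q * ((lead_coef F)^-1)%:P); rewrite /F' -mul_polyC mulrA.
have [G eG] : divides F chiw.
  (* On the component [w = u], so the value of [u] is a common root of [F'] and [chiw], and the norm
     vanishes there. A base function that vanishes on a component is zero. *)
  have N0 : normp F' chiw = 0.
    apply: (component_dominant hY hC (i := i)) => y Cy; rewrite comp_eval.
    rewrite -normp_map // normp_rootseq ?monic_map ?size_map_monic ?sF' //.
    apply/eqP; rewrite prodf_seq_eq0; apply/hasP; exists u.@[y].
      rewrite mem_rootseq ?monic_map // /root /F' -mul_polyC rmorphM /= hornerM.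
      by have := CF y Cy; rewrite polysubE => ->; rewrite mulr0.
    have := Yw y (CY Cy); rewrite polysubE /w mevalD mevalZ (gC y Cy) mulr0 addr0.
    by move=> -> /=.
  have [|v [q [v0 sv e]]] := normp_eq0_dvd mF' _ N0; first by rewrite sF'.
  have [|[h eh]|//] := Fp v chiw; first by rewrite e; apply: FF'.
  have h0 : h != 0 by apply: contra_neq v0 => h0; rewrite eh h0 mul0r.
  have := sv; rewrite sF' eh (size_mul h0 F0) (polySpred h0) addSn /=.
  by rewrite ltnNge leq_addl.
exists (polysub pi F u); split=> //; last first.
  by rewrite polysubE; apply: contra_neq wx => e; rewrite eG rmorphM hornerM /= e mulr0.
(* Divisors inherit bounds on the total degree: it is at most [d + d] for [chiu], hence for [F].
   Substituting [u] and the projections doubles it once more. *)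
have munu : degle (d + d) (munV chiu).
  by case: fu => sfu hfu; apply: munV_degle.
have munF : degle (d + d) (munV F).
  apply: degle_dvd munu.
    by apply: contra_neq chiu0 => e; rewrite -(munVK chiu) e rmorph0.
  by exists (munV cF); rewrite -rmorphM -ecF.
have -> : (4 * d = (d + d) + (d + d))%N by rewrite addnn addnn -!mul2n mulnA.
by apply: polysub_degle => //; have := muni_filt munF; rewrite munVK.
Qed.

End CoverDegree.

Lemma nonroot_seq (K : numFieldType) (q : {poly K}) m : q != 0 ->
  exists s : seq K, [/\ size s = m, uniq s & forall t, t \in s -> q.[t] != 0].
Proof.
move=> q0; elim: m => [|m [s [ss us hs]]]; first by exists [::].
have [t] : exists t, (q * \prod_(r <- s) ('X - r%:P)).[t] != 0.
  apply/poly_nonroot/mulf_neq0 => //; apply/monic_neq0/monic_prod => i _.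
  exact: monicXsubC.
rewrite hornerM mulf_eq0 negb_or => /andP[qt st]; exists (t :: s); split=> /=.
- by rewrite ss.
- by rewrite us andbT -root_prod_XsubC.
- by move=> r; rewrite inE => /predU1P[->|/hs].
Qed.

Lemma degle1_eval (K : fieldType) n (p : {mpoly K[n]}) x : degle 1 p ->
  p.@[x] = p@_0 + \sum_j p@_(U_(j))%MM * x j.
Proof.
move=> dp; have {1}-> : p = (p@_0)%:MP + \sum_j p@_(U_(j))%MM *: 'X_j.
  apply/mpolyP => m; rewrite mcoeffD mcoeffC raddf_sum /=.
  have [hm|hm] := leqP (mdeg m) 1; last first.
    rewrite (_ : p@_m = 0); last first.
      apply/eqP; rewrite mcoeff_eq0; apply/negP => /(degle_mdeg dp).
      by rewrite leqNgt hm.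
    have [e|_] := eqVneq; first by rewrite e mdeg0 in hm.
    rewrite mulr0 add0r big1 // => j _; rewrite mcoeffZ mcoeffX.
    by have [e|_] := eqVneq; [rewrite -e mdeg1 in hm|rewrite mulr0].
  move: hm; rewrite leq_eqVlt ltnS leqn0 mdeg_eq0 => /predU1P[/eqP|/eqP ->].
    rewrite mdeg_eq1 => /existsP[j /eqP ->].
    have [e|_] := eqVneq; first by have := mdeg1 j; rewrite e mdeg0.
    rewrite mulr0 add0r (bigD1 j) //= mcoeffZ mcoeffX eqxx mulr1 big1 ?addr0 //.
    move=> l lj; rewrite mcoeffZ mcoeffX.
    have [/mnmP/(_ j)|_] := eqVneq; last by rewrite mulr0.
    by rewrite !mnm1E eqxx (negPf lj).
  rewrite eqxx mulr1 big1 ?addr0 // => j _; rewrite mcoeffZ mcoeffX.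
  have [/(congr1 mdeg)|_] := eqVneq; last by rewrite mulr0.
  by rewrite mdeg1 mdeg0.
rewrite mevalD mevalC raddf_sum /=; congr (_ + _); apply: eq_bigr => j _.
by rewrite mevalZ mevalXU.
Qed.

Lemma card_eq_sub (K : fieldType) n (S : subset_of K n) N (f : 'I_N -> pt K n) :
  (forall x, S x -> exists l, f l = x) -> exists e, card_eq S e.
Proof.
move=> hS; pose A := [set l | `[< S (f l) /\ forall l' : 'I_N, (l' < l)%N -> f l' <> f l >]].
have hA l : reflect (S (f l) /\ forall l' : 'I_N, (l' < l)%N -> f l' <> f l) (l \in A).
  by rewrite inE; apply: asboolP.
exists #|A|, (fun i => f (enum_val i)); split.
  move=> i j e; apply: enum_val_inj; apply: val_inj.
  have /hA[_ hi] := enum_valP i; have /hA[_ hj] := enum_valP j.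
  by case: (ltngtP (enum_val i) (enum_val j)) => // [/hj|/hi]; rewrite e.
move=> x; split=> [Sx|[i <-]]; last by have /hA[] := enum_valP i.
have [l0 fl0] := hS x Sx.
have [l /asboolP fl minl] :=
  @arg_minnP _ l0 (fun l => `[< f l = x >]) (@nat_of_ord N) (asboolT fl0).
have lA : l \in A.
  apply/hA; rewrite fl; split=> // l' ll' fl'.
  by have := minl l' (asboolT fl'); rewrite leqNgt ll'.
by exists (enum_rank_in lA l); rewrite enum_rankK_in.
Qed.

Section ComponentDim.
Variables (K : numClosedFieldType) (n : nat) (Y : subset_of K n).
Variables (pi : 2.-tuple {mpoly K[n]}) (N : nat) (fib : pt K 2 -> 'I_N -> pt K n).
Variable (d : nat).
Hypothesis hY : finite_cover Y pi fib d.
Hypothesis hpi : forall i, degle 1 (tnth pi i).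
Variables (m : nat) (C : 'I_m -> subset_of K n).
Hypothesis hC : component_decomposition Y C.
Local Notation proj := (mpoly_map pi).

Let irrC i : irreducible_variety (C i). Proof. by case: hC. Qed.
Let CY i : sub_set (C i) Y.
Proof. by case: hC => _ _ h y Cy; apply/h; exists i. Qed.

(** The section of the component by a level set of one base coordinate is infinite and has finitely
    many irreducible pieces, so one piece contains two points. It lies strictly between a point and
    the component, which completes a chain of length two. *)
Lemma component_dim i : dim_eq (C i) 2.
Proof.
split; last first.
  move=> [V [irrV subV VC]]; apply: (cover_dim_le hY); exists V; split=> // x /VC.
  exact: CY.
have [e e0 he] := component_base hY hC i.
have [a ea] := mpoly_nonroot e0; pose l0 : 'I_2 := widen1 ord0; pose c := init a.
pose q := map_poly (meval c) (muni e).
have q0 : q != 0 by apply: contra_neq ea => h; rewrite muni_eval -/c -/q h horner0.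
have pts t : q.[t] != 0 -> exists y, C i y /\ proj y = snoc c t.
  move=> qt; have [|y Cy [ey _]] := he (snoc c t); last by exists y.
  by rewrite muni_eval snocK snoc_max.
pose f := tnth pi l0 - (a l0)%:MP.
have fE y : f.@[y] = proj y l0 - a l0 by rewrite mevalB mevalC.
have cW : zariski_closed (fun y => C i y /\ f.@[y] = 0).
  by apply: closedI; [case: (irrC i)|apply: closed_zero].
have [r [D [irrD hD]]] := closed_irreducible_union cW.
(* One more point than there are irreducible pieces. *)
have [s [ss us hs]] := nonroot_seq r.+1 q0.
have /choice[j hj] : forall l : 'I_r.+1, exists jy : 'I_r * pt K n,
    D jy.1 jy.2 /\ proj jy.2 = snoc c s`_l.
  move=> l; have [|y [Cy py]] := pts s`_l; first by apply/hs/mem_nth; rewrite ss.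
  have /hD[j Dj] : C i y /\ f.@[y] = 0.
    by split=> //; rewrite fE py snoc_widen subrr.
  by exists (j, y).
have : ~ injective (fun l => (j l).1).
  by move=> /leq_card; rewrite !card_ord ltnn.
move=> ninj; have [l [l' [ll' ejl]]] : exists l l', l <> l' /\ (j l).1 = (j l').1.
  apply: contrapT => h; apply: ninj => l l' e1; apply: contrapT => ne.
  by apply: h; exists l, l'.
pose W := D (j l).1; set y := (j l).2; set y' := (j l').2.
have Wy : W y by have [] := hj l.
have Wy' : W y' by have [h _] := hj l'; rewrite /W ejl.
have yy' : y' <> y.
  move=> e1; apply: ll'; have [_ p1] := hj l; have [_ p2] := hj l'.
  have : s`_l = s`_l' by rewrite -(snoc_max c s`_l) -p1 -/y -e1 p2 snoc_max.
  by move/eqP; rewrite nth_uniq ?ss // => /eqP/val_inj.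
have WC : sub_set W (C i) by move=> z Dz; have [] := (hD z).2 (ex_intro (fun i => D i z) _ Dz).
have [z Cz fz] : exists2 z, C i z & f.@[z] != 0.
  apply: contrapT => h; have : ('X_l0 - (a l0)%:MP : {mpoly K[2]}) = 0.
    apply: (component_dominant hY hC (i := i)) => z Cz.
    rewrite comp_eval mevalB mevalXU mevalC -fE.
    by apply: contrapT => /eqP fz; apply: h; exists z.
  move/(congr1 (meval (fun=> a l0 + 1))); rewrite mevalB mevalXU mevalC meval0.
  by rewrite addrAC subrr add0r => /eqP; rewrite oner_eq0.
exists (fun l => if l is l.+1 then if l is 0 then W else C i else fun x => x = y).
split=> [[|[|[|]]] //= _|[|[|]] //= _|//].
- exact: irreducible_pt.
- exact: irrD.
- by split=> [x ->|] //; exists y'.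
- split=> //; exists z; split=> // Wz.
  have [_ f0] := (hD z).2 (ex_intro (fun i => D i z) _ Wz).
  by rewrite f0 eqxx in fz.
Qed.

(** Every value of the projection is attained, so its two linear forms are independent, and the
    fibres are sections of the kind counted in [irr_degree]. *)
Lemma fibre_affine : (0 < N)%N -> exists2 A : 'M[K]_(2, n), row_free A &
  forall a, exists b, forall x, affine_subspace A b x <-> proj x = a.
Proof.
move=> N0; pose A := \matrix_(i < 2, j < n) (tnth pi i)@_(U_(j))%MM.
have projE x i : proj x i = (tnth pi i)@_0 + (A *m \col_j x j) i 0.
  rewrite /mpoly_map degle1_eval // mxE; congr (_ + _).
  by apply: eq_bigr => j _; rewrite !mxE.
exists A.
  rewrite -kermx_eq0; apply/eqP/row_matrixP => i; rewrite row0; set v := row i _.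
  have vA : v *m A = 0 by apply/sub_kermxP; apply: row_sub.
  have vp (a : pt K 2) : \sum_j v 0 j * (a j - (tnth pi j)@_0) = 0.
    have := fib_proj hY a (Ordinal N0); set x := fib _ _ => xa.
    transitivity ((v *m A *m \col_j x j) 0 0); last by rewrite vA mul0mx mxE.
    rewrite -mulmxA mxE; apply: eq_bigr => j _.
    by rewrite -xa projE addrAC subrr add0r.
  apply/rowP => j; rewrite [RHS]mxE.
  rewrite -[LHS]mulr1 -[RHS](vp (fun l => (tnth pi l)@_0 + (l == j)%:R)).
  rewrite (bigD1 j) //= eqxx addrAC subrr add0r mulr1 big1 ?addr0 ?mulr1 //.
  by move=> l /negPf ->; rewrite addr0 subrr mulr0.
move=> a; exists (\col_i (a i - (tnth pi i)@_0)) => x; split=> [h|xa].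
  by apply/funext => i; rewrite projE h mxE addrC subrK.
by apply/colP => i; rewrite [RHS]mxE -xa projE addrAC subrr add0r.
Qed.

End ComponentDim.

Section PlaneSection.
Variable K : numClosedFieldType.

Lemma affine_plane_param (A : 'M[K]_(2, 4)) (x0 : pt K 4) : row_free A ->
  exists2 B : 'M[K]_(2, 4), row_free B & forall x,
    affine_subspace A (A *m \col_j x0 j) x <->
    exists t : pt K 2, x = fun j => x0 j + \sum_l t l * B l j.
Proof.
move=> fA; set k := kermx A^T.
have rk : \rank k = 2%N by rewrite mxrank_ker mxrank_tr (eqP fA).
have [B fB kB] : exists2 B : 'M[K]_(2, 4), row_free B & (B :=: k)%MS.
  move: (row_base k) (row_base_free k) (eq_row_base k).
  by rewrite {1 2 3}rk => B fB eB; exists B.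
exists B => // x.
have sub : affine_subspace A (A *m \col_j x0 j) x <-> ((\row_j (x j - x0 j)) <= B)%MS.
  rewrite kB; have -> : \row_j (x j - x0 j) = (\col_j x j - \col_j x0 j)^T.
    by apply/rowP => j; rewrite !mxE.
  rewrite /affine_subspace; split=> [e|/sub_kermxP].
    by apply/sub_kermxP; rewrite -trmx_mul mulmxBr e subrr trmx0.
  rewrite -trmx_mul => /(congr1 trmx); rewrite trmxK trmx0 mulmxBr => /eqP.
  by rewrite subr_eq0 => /eqP.
rewrite sub; split=> [/submxP[D e]|[t ->]].
  exists (fun l => D 0 l); apply/funext => j.
  have := congr1 (fun M : 'rV_4 => M 0 j) e; rewrite !mxE => <-.
  by rewrite addrC subrK.
apply/submxP; exists (\row_l t l); apply/rowP => j; rewrite !mxE addrAC subrr add0r.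
by apply: eq_bigr => l _; rewrite mxE.
Qed.

(** The equations of bounded degree that cut out [V] are restricted to a parametrized plane, where
    [bezout_finite] applies. *)
Lemma plane_section_bound (V : subset_of K 4) D (A : 'M[K]_(2, 4)) b e :
  (forall x, ~ V x -> exists F, [/\ degle D F, vanish V F & F.@[x] != 0]) ->
  row_free A -> card_eq (fun x => V x /\ affine_subspace A b x) e ->
  (e <= D * bezout_bound D)%N.
Proof.
move=> cut fA [f [injf hf]]; case: e f injf hf => // e f injf hf.
pose x0 := f ord0; have Lf i : affine_subspace A b (f i).
  by have [] := (hf (f i)).2 (ex_intro _ i erefl).
have Vf i : V (f i) by have [] := (hf (f i)).2 (ex_intro _ i erefl).
have eb : b = A *m \col_j x0 j by rewrite -(Lf ord0).
have [B fB hB] := affine_plane_param x0 fA.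
pose par (t : pt K 2) : pt K 4 := fun j => x0 j + \sum_l t l * B l j.
have parI : injective par.
  move=> t t' e1; apply/funext => l.
  have : (\row_l t l) *m B = (\row_l t' l) *m B.
    apply/rowP => j; have := congr1 (fun x : pt K 4 => x j) e1.
    rewrite /par => /addrI; rewrite !mxE => e2.
    transitivity (\sum_l t l * B l j); first by apply: eq_bigr => i _; rewrite mxE.
    by rewrite e2; apply: eq_bigr => i _; rewrite mxE.
  move/(row_free_inj fB)/(congr1 (fun M : 'rV_2 => M 0 l)).
  by rewrite !mxE.
have /choice[E hE] : forall i, exists t, par t = f i.
  by move=> i; have := Lf i; rewrite eb => /hB[t ->]; exists t.
pose T : 4.-tuple {mpoly K[2]} := [tuple (x0 j)%:MP + \sum_l B l j *: 'X_l | j < 4].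
have TE (F : {mpoly K[4]}) t : (F \mPo T).@[t] = F.@[par t].
  rewrite comp_mpoly_meval; apply: meval_eq => j.
  rewrite tnth_mktuple mevalD mevalC raddf_sum /=; congr (_ + _).
  by apply: eq_bigr => l _; rewrite mevalZ mevalXU mulrC.
apply: (@bezout_finite K
  (fun g => exists F, [/\ degle D F, vanish V F & g = F \mPo T]) D e.+1 E).
- move=> _ [F [dF _ ->]]; apply: degle_comp => // j; rewrite tnth_mktuple.
  apply: degleD; first exact: degleC.
  by apply: degle_sum => l _; apply/degleZ/degleX.
- by move=> i j e1; apply: injf; rewrite -!hE e1.
move=> t; split=> [h|[i <-] _ [F [_ vF ->]]]; last by rewrite TE hE; apply: vF.
have Vt : V (par t).
  apply: contrapT => /cut[F [dF vF]]; rewrite -TE h ?eqxx //.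
  by exists F.
have Lt : affine_subspace A b (par t) by rewrite eb; apply/hB; exists t.
have [i fi] := (hf (par t)).1 (conj Vt Lt).
by exists i; apply: parI; rewrite hE.
Qed.

End PlaneSection.

Section VarietyDegree.
Variables (K : numClosedFieldType) (Y : subset_of K 4).
Variables (pi : 2.-tuple {mpoly K[4]}) (N : nat) (fib : pt K 2 -> 'I_N -> pt K 4).
Variable (d : nat).
Hypothesis hY : finite_cover Y pi fib d.
Hypothesis hpi : forall i, degle 1 (tnth pi i).

Definition component_bound := ((4 * d) * bezout_bound (4 * d))%N.

(** A fibre provides one finite plane section and all finite ones are bounded, so the maximum in
    [irr_degree] is attained. *)
Lemma component_degree m (C : 'I_m -> subset_of K 4) i : component_decomposition Y C ->
  exists e, irr_degree (C i) e /\ (e <= component_bound)%N.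
Proof.
move=> hC; have [irrC _ CY] := hC.
have [_ [y Cy] _] := irrC i.
have Yy : Y y by apply/CY; exists i.
have N0 : (0 < N)%N by have [l _] := cover_fib hY Yy; apply: leq_ltn_trans (ltn_ord l).
have bnd (A : 'M[K]_(2, 4)) b e : row_free A ->
    card_eq (fun x => C i x /\ affine_subspace A b x) e -> (e <= component_bound)%N.
  by apply: plane_section_bound => x; exact: (component_equation hY hpi hC).
pose P e := `[< exists (A : 'M[K]_(2, 4)) b, row_free A /\
  card_eq (fun x => C i x /\ affine_subspace A b x) e >].
have [A fA hA] := fibre_affine hY hpi N0.
have exP : exists e, P e.
  have [b hb] := hA (mpoly_map pi y).
  have [|e he] := @card_eq_sub K 4 (fun x => C i x /\ affine_subspace A b x) N
      (fib (mpoly_map pi y)).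
    move=> x [Cx /hb <-]; apply: cover_fib hY _ _.
    by apply/CY; exists i.
  by exists e; apply/asboolP; exists A, b.
have ubP e : P e -> (e <= component_bound)%N.
  by move=> /asboolP[A' [b [fA' he]]]; apply: bnd he.
case: (ex_maxnP exP ubP) => e Pe maxe; exists e; split; last exact: ubP.
exists 2; split.
- exact: (component_dim hY hC).
- by move/asboolP: Pe.
- by move=> A' b e' fA' he'; apply: maxe; apply/asboolP; exists A', b.
Qed.

Lemma cover_variety_degree : zariski_closed Y ->
  exists D, variety_degree Y D /\ (D <= N * component_bound)%N.
Proof.
move=> cY; have [m [C hC]] := closed_component_decomposition cY.
have /choice[ds hds] := fun i => component_degree i hC.
exists (\sum_(i < m) ds i)%N; split.
  by exists m, C, ds; split=> // i; have [] := hds i.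
apply: (@leq_trans (\sum_(i < m) component_bound)).
  by apply: leq_sum => i _; have [] := hds i.
rewrite sum_nat_const card_ord leq_mul2r; apply/orP; right.
exact: (components_number hY hC).
Qed.

End VarietyDegree.

(** * Polarization *)

Section HypersurfaceIdeal.
Variable K : numClosedFieldType.

Lemma irreducible_mpoly_prime (F : fieldType) n (f : {mpoly F[n]}) :
  irreducible_mpoly f -> prime_elt f.
Proof.
move=> [nc irr]; have constU (p : {mpoly F[n]}) : mpoly_const p -> p != 0 -> p \is a GRing.unit.
  move=> [c ->] h; apply: rmorph_unit; rewrite unitfE.
  by apply: contra_neq h => ->.
have unitC (p : {mpoly F[n]}) : p \is a GRing.unit -> mpoly_const p.
  by case/andP => /eqP e _; exists p@_0.
have f0 : f != 0 by apply/eqP => e; apply: nc; exists 0; rewrite e.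
have [u [s [uu ps e]]] := factorial_mpoly f0.
case: s ps e => [|p s] ps e.
  by case: nc; apply: unitC; rewrite e big_nil mulr1.
have pp : prime_elt p by apply: ps; rewrite mem_head.
have e' : f = p * (u * \prod_(q <- s) q) by rewrite e big_cons mulrCA.
have [p0 pu ppp] := pp; have [cp|cr] := irr _ _ e'.
  by case/negP: pu; apply: constU.
have ru : u * \prod_(q <- s) q \is a GRing.unit.
  by apply: constU => //; apply: contra_neq f0 => h; rewrite e' h mulr0.
split=> //; first by rewrite e' unitrM negb_and pu.
move=> a b [c ec]; have [] := ppp a b.
- by exists (c * (u * \prod_(q <- s) q)); rewrite ec e' [p * _]mulrC mulrA.
- case=> h eh; left; exists (h * (u * \prod_(q <- s) q)^-1).
  by rewrite e' eh [p * _]mulrC mulrA divrK.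
- case=> h eh; right; exists (h * (u * \prod_(q <- s) q)^-1).
  by rewrite e' eh [p * _]mulrC mulrA divrK.
Qed.

(** The Nullstellensatz for a hypersurface: over every base point [h] vanishes at a root of the
    sheared [p], so the norm of [h] is zero. *)
Lemma prime_vanish_divides n (p h : {mpoly K[n.+1]}) : prime_elt p ->
  (forall x, p.@[x] = 0 -> h.@[x] = 0) -> divides p h.
Proof.
move=> pp hp; have [v [v0 _ [c [P [c0 eP [pP Pm sP _]]]]]] :=
  prime_monic_shear pp (oner_neq0 _) (leqSpred _ : degle (msize p).-1 p).
pose G := muni (h \mPo shear_tuple v).
suff /(normp_eq0_dvd Pm sP)[w [q [w0 sw e]]] : normp P G = 0.
  have := prime_small_divides pP w0 sw (ex_intro _ q e).
  by rewrite eP => /(sheared_divides v0); rewrite /G muniK shear_compK.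
apply: mpoly_eval_eq => a; rewrite meval0 -normp_map //.
have Pma := monic_map (meval a) Pm.
rewrite normp_rootseq ?size_map_monic //; apply/eqP; rewrite prodf_seq_eq0.
have := size_rootseq Pma; rewrite size_map_monic //.
case eR : (rootseq _) => [|z rs] /=; first by case: (size P) sP => [|[|]].
move=> _; apply/orP; left; apply/eqP.
transitivity (h \mPo shear_tuple v).@[snoc a z].
  by rewrite muni_eval snocK snoc_max.
rewrite shear_eval; apply: hp.
have /eqP : c * p.@[shear v (snoc a z)] = 0.
  rewrite -sheared_eval -eP snocK snoc_max; apply/rootP.
  by rewrite -mem_rootseq // eR mem_head.
by rewrite mulf_eq0 (negPf c0) => /eqP.
Qed.

End HypersurfaceIdeal.

Section Polarization.
Variable K : numClosedFieldType.

Definition joinpt (z w : pt K 2) : pt K 4 :=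
  fun j => match split (j : 'I_(2 + 2)) with inl k => z k | inr k => w k end.

Definition conjpt n (z : pt K n) : pt K n := fun i => (z i)^*.

(** The change of variables [T] sends natural coordinates [a], [b] to the conjugate pair [a - i b],
    [a + i b]. A polynomial vanishing at all natural points is zero, and [T] is invertible. *)
Lemma conj_diagonal_dense (c : {mpoly K[2]}) :
  (forall t, c.@[snoc (fun=> t^*) t] = 0) -> c = 0.
Proof.
move=> h; pose i0 : 'I_2 := widen1 ord0.
pose T := [tuple snoc (fun=> 'X_i0 - 'i *: 'X_ord_max) ('X_i0 + 'i *: 'X_ord_max) k | k < 2]
  : 2.-tuple {mpoly K[2]}.
have TE x : (c \mPo T).@[x] =
    c.@[snoc (fun=> x i0 - 'i * x ord_max) (x i0 + 'i * x ord_max)].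
  rewrite comp_mpoly_meval; apply: meval_eq => k; rewrite tnth_mktuple.
  have [->|[j ->]] := ord_maxVwiden k.
    by rewrite !snoc_max mevalD mevalZ !mevalXU.
  by rewrite !snoc_widen mevalB mevalZ !mevalXU.
have T0 : c \mPo T = 0.
  apply: contrapT => /eqP/mpoly_nat_nonroot[x]; rewrite TE.
  have <- : ((x i0)%:R + 'i * (x ord_max)%:R)^* = (x i0)%:R - 'i * (x ord_max)%:R :> K.
    by rewrite rmorphD rmorphM /= !rmorph_nat conjCi mulNr.
  by rewrite h eqxx.
apply: mpoly_eval_eq => y; rewrite meval0.
have i0n : 'i != 0 :> K by rewrite neq0Ci.
have two0 : 2%:R != 0 :> K by rewrite pnatr_eq0.
pose x : pt K 2 := snoc (fun=> (y ord_max + y i0) / 2%:R) ((y ord_max - y i0) / (2%:R * 'i)).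
have <- : snoc (fun=> x i0 - 'i * x ord_max) (x i0 + 'i * x ord_max) = y.
  have e1 : x i0 = (y ord_max + y i0) / 2%:R by rewrite /x snoc_widen.
  have e2 : 'i * x ord_max = (y ord_max - y i0) / 2%:R.
    by rewrite /x snoc_max; field.
  rewrite -[RHS]snoc_init; congr snoc; rewrite e1 e2; last by field.
  by apply/funext => k; rewrite /init [k]ord1 -/i0; field.
by rewrite -TE T0 meval0.
Qed.

Definition map_conj n : {mpoly K[n]} -> {mpoly K[n]} := map_mpoly (@Num.conj_op K).

Lemma map_conj_eval n (p : {mpoly K[n]}) z : (map_conj p).@[conjpt z] = (p.@[z])^*.
Proof.
apply: (mpoly_rmorph_ext (f := meval (conjpt z) \o map_mpoly (@Num.conj_op K))
  (g := @Num.conj_op K \o meval z)) => [c|i] /=.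
  by rewrite map_mpolyC !mevalC.
by rewrite map_mpolyX !mevalXU.
Qed.

(* The product of [g] and its conjugate is irreducible. *)
Lemma joinpt_prime (g : subset_of K 2) (G H : {mpoly K[4]}) : irreducible_variety g ->
  (forall z w, g z -> g w -> (G * H).@[joinpt z (conjpt w)] = 0) ->
  (forall z w, g z -> g w -> G.@[joinpt z (conjpt w)] = 0) \/
  (forall z w, g z -> g w -> H.@[joinpt z (conjpt w)] = 0).
Proof.
move=> irrg h; apply: contrapT => /not_orP[nG nH].
have wit (Q : {mpoly K[4]}) : ~ (forall z w, g z -> g w -> Q.@[joinpt z (conjpt w)] = 0) ->
    exists z w, [/\ g z, g w & Q.@[joinpt z (conjpt w)] != 0].
  move=> nQ; apply: contrapT => k; apply: nQ => z w gz gw.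
  by apply: contrapT => /eqP e; apply: k; exists z, w.
have [z1 [w1 [gz1 gw1 G1]]] := wit G nG.
have [z2 [w2 [gz2 gw2 H2]]] := wit H nH.
pose left_ (Q : {mpoly K[4]}) w := Q \mPo [tuple match split (j : 'I_(2 + 2)) with
  | inl k => 'X_k | inr k => (w k)%:MP end | j < 4] : {mpoly K[2]}.
pose right_ (Q : {mpoly K[4]}) z := Q \mPo [tuple match split (j : 'I_(2 + 2)) with
  | inl k => (z k)%:MP | inr k => 'X_k end | j < 4] : {mpoly K[2]}.
have leftE Q w z : (left_ Q w).@[z] = Q.@[joinpt z w].
  rewrite comp_mpoly_meval; apply: meval_eq => j; rewrite tnth_mktuple /joinpt.
  by case: split => k; rewrite ?mevalXU ?mevalC.
have rightE Q w z : (right_ Q z).@[w] = Q.@[joinpt z w].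
  rewrite comp_mpoly_meval; apply: meval_eq => j; rewrite tnth_mktuple /joinpt.
  by case: split => k; rewrite ?mevalXU ?mevalC.
(* With [z1] and [z2] fixed, both values are conjugates of polynomials in [w], so irreducibility of
   [g] gives a common [w]. It is then fixed and the argument repeated in [z]. *)
have [w gw [Gw Hw]] : exists2 w, g w &
    G.@[joinpt z1 (conjpt w)] != 0 /\ H.@[joinpt z2 (conjpt w)] != 0.
  apply: contrapT => k.
  have cE (Q : {mpoly K[4]}) z w : (map_conj (right_ Q z)).@[w] = (Q.@[joinpt z (conjpt w)])^*.
    have {1}-> : w = conjpt (conjpt w) by apply/funext => j; rewrite /conjpt conjCK.
    by rewrite map_conj_eval rightE.
  have [||v|v] := @irreducible_mul _ _ g (map_conj (right_ G z1)) (map_conj (right_ H z2)) => //.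
  - move=> w gw; rewrite mevalM !cE; apply/eqP; rewrite mulf_eq0 !conjC_eq0.
    apply: contrapT => /negP; rewrite negb_or => /andP[a b].
    by apply: k; exists w.
  - by move: G1; rewrite -conjC_eq0 -cE (v _ gw1) eqxx.
  - by move: H2; rewrite -conjC_eq0 -cE (v _ gw2) eqxx.
have [||v|v] := @irreducible_mul _ _ g (left_ G (conjpt w)) (left_ H (conjpt w)) => //.
- by move=> z gz; rewrite -rmorphM /= -/(left_ (G * H) _) leftE h.
- by move: Gw; rewrite -leftE (v _ gz1) eqxx.
- by move: Hw; rewrite -leftE (v _ gz2) eqxx.
Qed.

End Polarization.

(** * The product of a plane curve and its conjugate as a cover of the plane *)

Section ProductCover.
Variable K : numClosedFieldType.

Lemma meval_snoc n l (a : 'I_l -> {mpoly K[n]}) t x i :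
  (snoc a t i).@[x] = snoc (fun j => (a j).@[x]) t.@[x] i.
Proof.
have [->|[j ->]] := ord_maxVwiden i; first by rewrite !snoc_max.
by rewrite !snoc_widen.
Qed.

Lemma snoc_degle n l (a : 'I_l -> {mpoly K[n]}) t d i :
  (forall j, degle d (a j)) -> degle d t -> degle d (snoc a t i).
Proof.
move=> ha ht; have [->|[j ->]] := ord_maxVwiden i; first by rewrite snoc_max.
by rewrite snoc_widen.
Qed.

Definition joinptl (x : pt K 4) : pt K 2 := fun k => x (lshift 2 k : 'I_(2 + 2)).
Definition joinptr (x : pt K 4) : pt K 2 := fun k => x (rshift 2 k : 'I_(2 + 2)).

Lemma joinptlr x : joinpt (joinptl x) (joinptr x) = x.
Proof.
apply/funext => j; rewrite /joinpt /joinptl /joinptr -[in RHS](splitK (j : 'I_(2 + 2))).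
by case: split.
Qed.

Lemma joinptlK (z w : pt K 2) : joinptl (joinpt z w) = z.
Proof.
apply/funext => k; rewrite /joinptl /joinpt.
by rewrite -[lshift 2 k]/(unsplit (inl k)) unsplitK.
Qed.

Lemma joinptrK (z w : pt K 2) : joinptr (joinpt z w) = w.
Proof.
apply/funext => k; rewrite /joinptr /joinpt.
by rewrite -[rshift 2 k]/(unsplit (inr k)) unsplitK.
Qed.

Lemma conjptK n : involutive (@conjpt K n).
Proof. by move=> z; apply/funext => i; rewrite /conjpt conjCK. Qed.

Lemma conjpt_shear n (v x : pt K n.+1) : conjpt (shear v x) = shear (conjpt v) (conjpt x).
Proof.
apply/funext => i; rewrite /conjpt /shear rmorphD rmorphM /=.
by case: ifP => _; rewrite ?rmorph0.
Qed.

Variables (v : pt K 2) (P : {poly {mpoly K[1]}}).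
Hypotheses (v0 : v ord_max != 0) (Pm : P \is monic) (sP : (1 < size P)%N).

Let j0 : 'I_2 := widen1 ord_max.
Let j1 : 'I_2 := ord_max.

(* Base coordinates (w_0, z_0), then w_1 and z_1, after a shear of each factor. *)
Let unjoin (z w : pt K 2) : pt K 4 :=
  snoc (snoc (snoc (fun=> w j0) (z j0)) (w j1)) (z j1).

Let zpart (x : pt K 4) : pt K 2 := snoc (fun=> x (widen1 (widen1 j1))) (x ord_max).
Let wpart (x : pt K 4) : pt K 2 :=
  snoc (fun=> x (widen1 (widen1 j0))) (x (widen1 ord_max)).

Let unjoinK x : unjoin (zpart x) (wpart x) = x.
Proof.
rewrite /unjoin /zpart /wpart /j1 /j0 !snoc_max !snoc_widen.
rewrite -[RHS]snoc_init; congr snoc; rewrite -[RHS]snoc_init; congr snoc.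
rewrite -[RHS]snoc_init; congr snoc.
by apply/funext => k; rewrite /init [k]ord1; congr (x _); apply: val_inj.
Qed.

Let zpartK z w : zpart (unjoin z w) = z.
Proof.
rewrite /zpart /unjoin !snoc_max !snoc_widen snoc_max -[RHS]snoc_init; congr snoc.
by apply/funext => k; rewrite /init [k]ord1; congr (z _); apply: val_inj.
Qed.

Let wpartK z w : wpart (unjoin z w) = w.
Proof.
rewrite /wpart /unjoin !snoc_widen snoc_max -[RHS]snoc_init; congr snoc.
by apply/funext => k; rewrite /init [k]ord1; congr (w _); apply: val_inj.
Qed.

Definition product_coord : 4.-tuple {mpoly K[4]} :=
  [tuple match split (j : 'I_(2 + 2)) with
     | inl k => tnth (shear_tuple v) k \mPo
         [tuple snoc (fun=> 'X_(widen1 (widen1 j1))) 'X_ord_max l | l < 2]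
     | inr k => tnth (shear_tuple (conjpt v)) k \mPo
         [tuple snoc (fun=> 'X_(widen1 (widen1 j0))) 'X_(widen1 ord_max) l | l < 2]
     end | j < 4].

Definition product_uncoord : 4.-tuple {mpoly K[4]} :=
  let z k := tnth (unshear_tuple v) k \mPo [tuple 'X_(lshift 2 l : 'I_(2 + 2)) | l < 2] in
  let w k := tnth (unshear_tuple (conjpt v)) k \mPo
    [tuple 'X_(rshift 2 l : 'I_(2 + 2)) | l < 2] in
  [tuple snoc (snoc (snoc (fun=> w j0) (z j0)) (w j1)) (z j1) j | j < 4].

Lemma product_coordE x : mpoly_map product_coord x =
  joinpt (shear v (zpart x)) (shear (conjpt v) (wpart x)).
Proof.
apply/funext => j; rewrite /mpoly_map tnth_mktuple /joinpt.
case: split => k; rewrite comp_mpoly_meval tnth_shear_eval; congr (shear _ _ k).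
  by apply/funext => l; rewrite tnth_mktuple meval_snoc /zpart !mevalXU.
by apply/funext => l; rewrite tnth_mktuple meval_snoc /wpart !mevalXU.
Qed.

Lemma product_uncoordE x : mpoly_map product_uncoord x =
  unjoin (unshear v (joinptl x)) (unshear (conjpt v) (joinptr x)).
Proof.
apply/funext => j; rewrite /mpoly_map tnth_mktuple /unjoin !meval_snoc.
have zE k : (tnth (unshear_tuple v) k \mPo
    [tuple 'X_(lshift 2 l : 'I_(2 + 2)) | l < 2]).@[x] = unshear v (joinptl x) k.
  rewrite comp_mpoly_meval tnth_unshear_eval; congr (unshear _ _ k).
  by apply/funext => l; rewrite tnth_mktuple mevalXU.
have wE k : (tnth (unshear_tuple (conjpt v)) k \mPo
    [tuple 'X_(rshift 2 l : 'I_(2 + 2)) | l < 2]).@[x] = unshear (conjpt v) (joinptr x) k.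
  rewrite comp_mpoly_meval tnth_unshear_eval; congr (unshear _ _ k).
  by apply/funext => l; rewrite tnth_mktuple mevalXU.
rewrite zE; congr (snoc _ _ j); apply/funext => j' /=; rewrite meval_snoc wE.
congr (snoc _ _ j'); apply/funext => j'' /=; rewrite meval_snoc zE.
by congr (snoc _ _ j''); apply/funext => j3 /=; rewrite wE.
Qed.

Let cv0 : conjpt v ord_max != 0. Proof. by rewrite /conjpt conjC_eq0. Qed.

Lemma product_coordK x : mpoly_map product_coord (mpoly_map product_uncoord x) = x.
Proof.
by rewrite product_coordE product_uncoordE zpartK wpartK !unshearK // joinptlr.
Qed.

Lemma product_uncoordK x : mpoly_map product_uncoord (mpoly_map product_coord x) = x.
Proof.
by rewrite product_uncoordE product_coordE joinptlK joinptrK !shearK // unjoinK.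
Qed.

Let Pbar : {poly {mpoly K[1]}} := map_poly (map_mpoly (@Num.conj_op K)) P.

(** The equation of [z_1] over [z_0]; [product_eqQ] is the conjugate equation, of [w_1] over [w_0].
    Both are monic in their last variable, so together they form a tower over the plane of [w_0] and
    [z_0]. *)
Definition product_eqP : {mpoly K[4]} :=
  munV (map_poly (comp_mpoly [tuple 'X_(widen1 j1) | l < 1]) P).
Definition product_eqQ : {mpoly K[3]} :=
  munV (map_poly (comp_mpoly [tuple 'X_j0 | l < 1]) Pbar).

Lemma Pbar_root a t : root (map_poly (meval (conjpt a)) Pbar) t^* =
  root (map_poly (meval a) P) t.
Proof.
rewrite /root; have -> : (map_poly (meval (conjpt a)) Pbar).[t^*] =
    ((map_poly (meval a) P).[t])^*.
  rewrite -horner_map -!map_poly_comp; congr (_.[_]); apply: eq_map_poly => c /=.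
  exact: map_conj_eval.
by rewrite conjC_eq0.
Qed.

Definition product_set := tower_set product_uncoord product_eqP product_eqQ.

Lemma product_setE z w : product_set (joinpt z (conjpt w)) <->
  root (map_poly (meval (init (unshear v z))) P) (unshear v z ord_max) /\
  root (map_poly (meval (init (unshear v w))) P) (unshear v w ord_max).
Proof.
have conj_unshear : unshear (conjpt v) (conjpt w) = conjpt (unshear v w).
  by rewrite -[in LHS](unshearK w v0) conjpt_shear shearK.
rewrite /product_set /tower_set product_uncoordE joinptlK joinptrK conj_unshear.
set x := unshear v z; set y := unshear v w.
have init1 (a : pt K 2) : init a = fun=> a j0.
  by apply/funext => k; rewrite /init [k]ord1; congr (a _); apply: val_inj.
have eP : product_eqP.@[unjoin x (conjpt y)] = (map_poly (meval (fun=> x j0)) P).[x j1].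
  rewrite munV_eval -map_poly_comp /unjoin snocK snoc_max; congr (_.[_]).
  apply: eq_map_poly => c /=; rewrite comp_mpoly_meval; apply: meval_eq => l.
  by rewrite tnth_mktuple mevalXU snoc_widen snoc_max.
have eQ : product_eqQ.@[init (unjoin x (conjpt y))] =
    (map_poly (meval (conjpt (fun=> y j0))) Pbar).[(y j1)^*].
  rewrite munV_eval -[map_poly _ (map_poly _ Pbar)]map_poly_comp /unjoin !snocK snoc_max.
  congr (_.[_]); apply: eq_map_poly => c /=; rewrite comp_mpoly_meval.
  by apply: meval_eq => l; rewrite tnth_mktuple mevalXU snoc_widen.
rewrite eP eQ -(Pbar_root (init y)) !init1 /root.
by split=> -[/eqP ? /eqP ?]; split=> //; apply/eqP.
Qed.

Lemma product_proj z w :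
  mpoly_map (tower_proj product_uncoord) (joinpt z (conjpt w)) =
  snoc (fun=> (unshear v w j0)^*) (unshear v z j0).
Proof.
have conj_unshear : unshear (conjpt v) (conjpt w) = conjpt (unshear v w).
  by rewrite -[in LHS](unshearK w v0) conjpt_shear shearK.
apply/funext => k; rewrite /mpoly_map tnth_mktuple.
rewrite -/(mpoly_map product_uncoord _ _) product_uncoordE joinptlK joinptrK conj_unshear.
by rewrite /unjoin !snoc_widen.
Qed.

Lemma product_cover : exists N (fib : pt K 2 -> 'I_N -> pt K 4) d,
  finite_cover product_set (tower_proj product_uncoord) fib d.
Proof.
exists (tower_size product_eqP product_eqQ),
  (tower_fib product_coord (P := product_eqP) (Q := product_eqQ)),
  (tower_deg (msize product_eqP).-1 (msize product_eqQ).-1).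
have Pbm : Pbar \is monic by apply: monic_map.
apply: tower_cover.
- exact: product_coordK.
- exact: product_uncoordK.
- move=> i; rewrite tnth_mktuple; case: split => k; apply: degle_comp => [l|].
  + by rewrite tnth_mktuple; apply: snoc_degle => *; apply: degleX.
  + exact: shear_tuple_degle.
  + by rewrite tnth_mktuple; apply: snoc_degle => *; apply: degleX.
  + exact: shear_tuple_degle.
- by rewrite munVK; apply: monic_map.
- by rewrite munVK; apply: monic_map.
- by rewrite munVK size_map_monic.
- by rewrite munVK size_map_monic ?size_map_monic.
- exact: leqSpred.
- exact: leqSpred.
Qed.

End ProductCover.

Section Polarize.
Variable K : numClosedFieldType.

(* The norm of [G] to the base plane vanishes on the Zariski-dense set of
   points (conj t, t), hence identically. *)
Lemma polarization (g : subset_of K 2) (f : {mpoly K[2]}) (G : {mpoly K[4]}) :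
  irreducible_variety g -> prime_elt f -> (forall z, g z <-> f.@[z] = 0) ->
  (forall z, g z -> G.@[joinpt z (conjpt z)] = 0) ->
  forall z w, g z -> g w -> G.@[joinpt z (conjpt w)] = 0.
Proof.
move=> irrg pf gE hG.
have [v [v0 _ [c [P [c0 eP [_ Pm sP _]]]]]] :=
  prime_monic_shear pf (oner_neq0 _) (leqSpred _ : degle (msize f).-1 f).
have gP z : g z <-> root (map_poly (meval (init (unshear v z))) P) (unshear v z ord_max).
  rewrite gE /root eP sheared_eval unshearK // mulf_eq0 (negPf c0).
  by split=> [/eqP|/eqP].
have [N [fib [d hY]]] := product_cover v0 Pm sP.
set Y := product_set v P in hY; set proj := tower_proj _ in hY.
have YE z w : Y (joinpt z (conjpt w)) <-> g z /\ g w by rewrite /Y (product_setE _ v0) !gP.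
have [chi [cm cE cY _]] := cover_chi hY G.
have vE H : vanish Y H <-> forall z w, g z -> g w -> H.@[joinpt z (conjpt w)] = 0.
  split=> [h z w gz gw|h x]; first by apply: h; apply/YE.
  by rewrite -(joinptlr x) -[joinptr x]conjptK => /YE[gz gw]; apply: h.
(* A point [z] of the curve with sheared first coordinate [t] gives the point (z, conj z) of the
   product above (conj t, t), and [G] vanishes there. *)
have diag t : exists l, G.@[fib (snoc (fun=> t^*) t) l] = 0.
  have := size_rootseq (monic_map (meval (fun=> t)) Pm); rewrite size_map_monic //.
  case eR : (rootseq _) => [|s rs] /=; first by case: (size P) sP => [|[|]].
  move=> _; pose z := shear v (snoc (fun=> t) s).
  have gz : g z.
    apply/gP; rewrite shearK // snocK snoc_max -mem_rootseq ?monic_map //.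
    by rewrite eR mem_head.
  have [l hl] := cover_fib hY ((YE z z).2 (conj gz gz)).
  exists l; rewrite -(hG z gz) -hl /proj (product_proj v0); congr (_.@[fib _ l]).
  by rewrite /z shearK // !snoc_widen.
(* The constant coefficient of [chi] is the norm of [G] up to sign. *)
have chi0 : chi`_0 = 0.
  apply: conj_diagonal_dense => t; have [l hl] := diag t.
  have := cE (snoc (fun=> t^*) t) 0; rewrite horner_coef0 coef_map /= => ->.
  by rewrite (bigD1 l) //= hl subrr mul0r.
have zero a : exists l, G.@[fib a l] = 0.
  have := cE a 0; rewrite horner_coef0 coef_map /= chi0 meval0 => /esym/eqP.
  rewrite prodf_seq_eq0 => /hasP[l _ /=]; rewrite sub0r oppr_eq0 => /eqP hl.
  by exists l.
suff /vE : vanish Y G by [].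
(* Write [chi = q * 'X^j] with the constant coefficient of [q] nonzero. On the product [q(G) G^j]
   vanishes, so by primality [G] or [q(G)] does; the latter fails where [G = 0] above a base point
   at which that coefficient is nonzero. *)
have [j [q nq eq]] := multiplicity_XsubC chi 0.
move: nq; rewrite (monic_neq0 cm) polyC0 subr0 /= in eq * => nq.
have q0 : q`_0 != 0 by move: nq; rewrite /root horner_coef0.
have {cY} : vanish Y (polysub proj q G * G ^+ j).
  move=> x /cY; rewrite eq polysubM; congr (_ = _).
  by rewrite !mevalM; congr (_ * _); rewrite /polysub map_polyXn hornerXn.
move/vE/(joinpt_prime irrg) => [/vE h|h]; last first.
  apply/vE; elim: j h {eq} => [|j IH].
    have [_ [x gx] _] := irrg => /(_ x x gx gx)/eqP.
    by rewrite expr0 meval1 oner_eq0.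
  by rewrite exprS => /(joinpt_prime irrg)[|/IH].
have [a qa] := mpoly_nonroot q0; have [l hl] := zero a.
have := h (fib a l) (fib_cover hY a l).
rewrite polysubE (fib_proj hY) hl horner_coef0 coef_map /= => e.
by move/eqP: qa.
Qed.

End Polarize.

(** * Two curves through a point *)

Section Segre.
Variable K : numClosedFieldType.

(* [G (., conj q)] vanishes on every curve through [q] on which [G] vanishes
   along the diagonal, so two such curves give two prime factors. *)
Lemma segre_curves (g1 g2 : subset_of K 2) (f1 f2 : {mpoly K[2]}) (G : {mpoly K[4]}) q :
  irreducible_variety g1 -> irreducible_variety g2 ->
  irreducible_mpoly f1 -> irreducible_mpoly f2 ->
  (forall z, g1 z <-> f1.@[z] = 0) -> (forall z, g2 z <-> f2.@[z] = 0) ->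
  g1 q -> g2 q ->
  (forall z, g1 z -> G.@[joinpt z (conjpt z)] = 0) ->
  (forall z, g2 z -> G.@[joinpt z (conjpt z)] = 0) ->
  (forall z, g1 z <-> g2 z) \/
  exists h : {mpoly K[2]}, forall z, G.@[joinpt z (conjpt q)] = f1.@[z] * f2.@[z] * h.@[z].
Proof.
move=> i1 i2 if1 if2 e1 e2 q1 q2 G1 G2.
have p1 := irreducible_mpoly_prime if1; have p2 := irreducible_mpoly_prime if2.
pose s : {mpoly K[2]} := G \mPo [tuple match split (j : 'I_(2 + 2)) with
  | inl k => 'X_k | inr k => (conjpt q k)%:MP end | j < 4].
have sE z : s.@[z] = G.@[joinpt z (conjpt q)].
  rewrite comp_mpoly_meval; apply: meval_eq => j; rewrite tnth_mktuple /joinpt.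
  by case: split => k; rewrite ?mevalXU ?mevalC.
have [h1 eh1] : divides f1 s.
  apply: (prime_vanish_divides p1) => z /e1 gz; rewrite sE.
  exact: (polarization i1 p1 e1 G1).
have : divides f2 s.
  apply: (prime_vanish_divides p2) => z /e2 gz; rewrite sE.
  exact: (polarization i2 p2 e2 G2).
(* Either [f2] divides the cofactor of [f1], or it divides [f1], and then irreducibility makes them
   proportional and the curves equal. *)
have [_ _ pp2] := p2; rewrite eh1 => /pp2[[h eh]|[c ec]].
  right; exists h => z; rewrite -sE eh1 eh !mevalM.
  by rewrite mulrC mulrA mulrAC -mulrA mulrC.
left => z; rewrite e1 e2 ec mevalM.
have [[a ea]|[a ea]] := if1.2 _ _ ec; last by case: if2.1; exists a.
have a0 : a != 0.
  by have [f10 _ _] := p1; apply: contra_neq f10 => a0; rewrite ec ea a0 mpolyC0 mul0r.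
rewrite ea mevalC; split=> [/eqP|->]; last by rewrite mulr0.
by rewrite mulf_eq0 (negPf a0) => /eqP.
Qed.

End Segre.

(** * Derivatives along lines, and real points *)

Section LineDerivative.
Variables (F : numFieldType) (n : nat) (p v : pt F n).

Definition line (Q : {mpoly F[n]}) : {poly F} :=
  mmap polyC (fun j => (p j)%:P + v j *: 'X) Q.
HB.instance Definition _ := GRing.RMorphism.copy line (mmap polyC (fun j => (p j)%:P + v j *: 'X)).

Lemma line_eval Q s : (line Q).[s] = Q.@[fun j => p j + v j * s].
Proof.
apply: (mpoly_rmorph_ext (f := horner_eval s \o line) (g := meval _)) => [c|j] /=.
  by rewrite /line mmapC /horner_eval hornerC mevalC.
by rewrite /line mmapX mmap1U /horner_eval mevalXU !hornerE.
Qed.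

Lemma line_deriv Q s :
  (line Q)^`().[s] = \sum_j v j * (Q^`M(j)).@[fun j => p j + v j * s].
Proof.
pose ok (Q : {mpoly F[n]}) :=
  (line Q)^`().[s] = \sum_j v j * (Q^`M(j)).@[fun j => p j + v j * s].
have okC c : ok c%:MP.
  rewrite /ok /line mmapC derivC horner0 big1 // => j _.
  by rewrite mderivC meval0 mulr0.
have okD Q1 Q2 : ok Q1 -> ok Q2 -> ok (Q1 + Q2).
  rewrite /ok rmorphD derivD hornerD => -> ->; rewrite -big_split; apply: eq_bigr => j _.
  by rewrite mderivD mevalD mulrDr.
have okM Q1 Q2 : ok Q1 -> ok Q2 -> ok (Q1 * Q2).
  rewrite /ok rmorphM derivM hornerD !hornerM !line_eval => -> ->.
  rewrite mulr_suml mulr_sumr -big_split; apply: eq_bigr => j _ /=.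
  by rewrite mderivM mevalD !mevalM; ring.
have okX i : ok 'X_i.
  rewrite /ok /line mmapX mmap1U derivD derivC add0r derivZ derivX hornerZ hornerC mulr1.
  rewrite (bigD1 i) //= mderivX mnm1E eqxx scale1r.
  rewrite (_ : (U_(i) - U_(i))%MM = 0%MM); last by apply/mnmP => l; rewrite mnmBE subnn mnm0E.
  rewrite mpolyX0 meval1 mulr1 big1 ?addr0 // => j ji.
  by rewrite mderivX mnm1E eq_sym (negPf ji) scale0r meval0 mulr0.
rewrite -/(ok Q) [Q]mpolyE; elim/big_ind: _ => [|Q1 Q2|m _].
- by rewrite -mpolyC0; apply: okC.
- exact: okD.
rewrite -mul_mpolyC mpolyXE_id; apply: (okM _ _ (okC _)).
elim/big_ind: _ => [|Q1 Q2|j _].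
- by rewrite -mpolyC1; apply: okC.
- exact: okM.
elim: (m j) => [|k IH]; first by rewrite expr0 -mpolyC1; apply: okC.
by rewrite exprS; apply: (okM _ _ (okX j)).
Qed.

End LineDerivative.

Section RealPoints.
Variable R : realType.
Local Notation C := R[i].
Local Notation toC := (real_complex R).

Lemma complexify_eval n (Q : {mpoly R[n]}) (p : 'I_n -> R) :
  (map_mpoly toC Q).@[fun j => toC (p j)] = toC (Q.@[p]).
Proof.
apply: (mpoly_rmorph_ext (f := meval (fun j => toC (p j)) \o map_mpoly toC)
  (g := toC \o meval p)) => [c|j] /=.
  by rewrite map_mpolyC !mevalC.
by rewrite map_mpolyX !mevalXU.
Qed.

Lemma mderiv_map n (Q : {mpoly R[n]}) j : (map_mpoly toC Q)^`M(j) = map_mpoly toC Q^`M(j).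
Proof.
apply/mpolyP => m; rewrite mcoeff_mderiv !mcoeff_map_mpoly mcoeff_mderiv.
exact/esym/(raddfMn toC).
Qed.

Lemma conj_complexE (a b : R) : (Complex a b)^* = Complex a (- b) :> C.
Proof. by []. Qed.

Lemma i_complexE : 'i = Complex 0 1 :> C.
Proof. by []. Qed.

End RealPoints.

Section TwoCurves.
Variable R : realType.
Local Notation C := R[i].
Local Notation toC := (real_complex R).

(* x_k = (z_k + w_k) / 2 and y_k = (z_k - w_k) / 2i, with w_k independent of z_k. *)
Definition realcoord (z w : pt C 2) : pt C 4 :=
  fun j => let k : 'I_2 := inord (j %/ 2) in
    if odd j then (z k - w k) / (2%:R * 'i) else (z k + w k) / 2%:R.

Definition polarize (P : {mpoly R[4]}) : {mpoly C[4]} :=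
  map_mpoly toC P \mPo [tuple
    let k : 'I_2 := inord (j %/ 2) in
    let z := 'X_(lshift 2 k : 'I_(2 + 2)) in let w := 'X_(rshift 2 k : 'I_(2 + 2)) in
    if odd j then (2%:R * 'i)^-1 *: (z - w) else 2%:R^-1 *: (z + w) | j < 4].

Lemma polarizeE P z w : (polarize P).@[joinpt z w] = (map_mpoly toC P).@[realcoord z w].
Proof.
rewrite comp_mpoly_meval; apply: meval_eq => j; rewrite tnth_mktuple /realcoord /=.
have jl (k : 'I_2) : joinpt z w (lshift 2 k : 'I_(2 + 2)) = z k.
  by rewrite -[LHS]/(joinptl (joinpt z w) k) joinptlK.
have jr (k : 'I_2) : joinpt z w (rshift 2 k : 'I_(2 + 2)) = w k.
  by rewrite -[LHS]/(joinptr (joinpt z w) k) joinptrK.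
case: ifP => _; first by rewrite mevalZ mevalB !mevalXU jl jr mulrC.
by rewrite mevalZ mevalD !mevalXU jl jr mulrC.
Qed.

Lemma realcoord_conj z : realcoord z (conjpt z) = fun j => toC (iotaC z j).
Proof.
have two0 : 2%:R != 0 :> C by rewrite pnatr_eq0.
have i0 : 'i != 0 :> C by rewrite neq0Ci.
apply/funext => j; rewrite /realcoord /iotaC /conjpt; case: ifP => _.
  case: (z _) => a b; rewrite conj_complexE i_complexE /=.
  apply: (mulIf (mulf_neq0 two0 i0)); rewrite divfK ?mulf_neq0 //.
  rewrite mulr_natl mulr2n; apply/eqP; rewrite eq_complex /=.
  by apply/andP; split; apply/eqP; ring.
case: (z _) => a b; rewrite conj_complexE /=.
apply: (mulIf two0); rewrite divfK // mulr_natr mulr2n.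
by apply/eqP; rewrite eq_complex /= subrr addr0 !eqxx.
Qed.

Lemma iotaC_inj : injective (@iotaC R).
Proof.
move=> z z' e; apply/funext => k.
have zE (x : pt C 2) : x k = Complex (iotaC x (inord (2 * k))) (iotaC x (inord (2 * k).+1)).
  have k2 : (2 * k < 4)%N by case: k => [[|[]]].
  have k3 : ((2 * k).+1 < 4)%N by case: k {k2} => [[|[]]].
  have e2 : ((2 * k) %/ 2 = k)%N by rewrite mulKn.
  have e3 : ((2 * k).+1 %/ 2 = k)%N by rewrite -addn1 mulnC divnMDl // addn0.
  rewrite /iotaC !inordK // e2 e3 oddS oddM /= inord_val.
  by case: (x k).
by rewrite !zE e.
Qed.

(** When [z] moves and [w] stays at the conjugate of [q], the polarization has a double zero at [q],
    so its derivative vanishes in every direction. By the chain rule these are the derivatives of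
    [P] with respect to the [z_k]. *)
Lemma singular_of_double_zero P (p : 'I_4 -> R) (q : pt C 2) (f1 f2 h : {mpoly C[2]}) :
  iotaC q = p -> f1.@[q] = 0 -> f2.@[q] = 0 ->
  (forall z, (polarize P).@[joinpt z (conjpt q)] = f1.@[z] * f2.@[z] * h.@[z]) ->
  forall j, (P^`M(j)).@[p] = 0.
Proof.
move=> qp f1q f2q hP.
have two0 : 2%:R != 0 :> C by rewrite pnatr_eq0.
have i0 : 'i != 0 :> C by rewrite neq0Ci.
pose r j := (P^`M(j)).@[p].
have dir (d : pt C 2) : \sum_j realcoord d (fun=> 0) j * toC (r j) = 0.
  pose PC := map_mpoly toC P; pose pC : pt C 4 := fun j => toC (p j).
  pose L := line pC (realcoord d (fun=> 0)) PC.
  have eL : L = line q d f1 * line q d f2 * line q d h.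
    apply: poly_eval_eq => s; rewrite !hornerM !line_eval -hP polarizeE.
    apply: meval_eq => j.
    have -> : pC j = realcoord q (conjpt q) j by rewrite realcoord_conj qp.
    by rewrite /realcoord; case: ifP => _; field.
  have := line_deriv pC (realcoord d (fun=> 0)) PC 0; rewrite -/L eL.
  have l1 : (line q d f1).[0] = 0.
    by rewrite line_eval -[RHS]f1q; apply: meval_eq => j; rewrite mulr0 addr0.
  have l2 : (line q d f2).[0] = 0.
    by rewrite line_eval -[RHS]f2q; apply: meval_eq => j; rewrite mulr0 addr0.
  rewrite !derivM !hornerE l1 l2 !(mul0r, mulr0, addr0) => e.
  rewrite [RHS]e; apply: eq_bigr => j _; congr (_ * _).
  rewrite mderiv_map /r -complexify_eval; apply: meval_eq => l.
  by rewrite mulr0 addr0.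
(* The derivative in [z_k] is half of [a - i b], where [a] and [b] are the real partial derivatives
   in [x_k] and [y_k]; being real, both vanish. *)
have cr (a b : R) : (1 / 2%:R) * toC a + (1 / (2%:R * 'i)) * toC b = 0 :> C -> a = 0 /\ b = 0.
  move=> e; have : toC a * 'i + toC b = 0.
    rewrite -[RHS](mulr0 (2%:R * 'i)) -e; field.
    by rewrite i0.
  rewrite i_complexE => /eqP; rewrite eq_complex /=.
  by rewrite !(mulr0, mulr1, mul0r, subr0, addr0, add0r, oppr0) => /andP[/eqP -> /eqP ->].
pose o0 := @Ordinal 4 0 isT; pose o1 := @Ordinal 4 1 isT.
pose o2 := @Ordinal 4 2 isT; pose o3 := @Ordinal 4 3 isT.
have sum4 (F : 'I_4 -> C) : \sum_j F j = F o0 + F o1 + F o2 + F o3.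
  rewrite !big_ord_recl big_ord0 addr0 !addrA.
  by congr (F _ + F _ + F _ + F _); apply: val_inj.
have eqd (a b : nat) : (a < 2)%N -> (b < 2)%N -> ((inord a : 'I_2) == inord b) = (a == b).
  by move=> ha hb; rewrite -val_eqE /= !inordK.
have [r0 r1] : r o0 = 0 /\ r o1 = 0.
  apply: cr; rewrite -[RHS](dir (fun l => (l == inord 0)%:R)) sum4 /realcoord /=.
  rewrite (_ : (0 %/ 2 = 0)%N) // (_ : (1 %/ 2 = 0)%N) //.
  rewrite (_ : (2 %/ 2 = 1)%N) // (_ : (3 %/ 2 = 1)%N) // !eqd //=.
  by rewrite !(subr0, addr0, mul0r).
have [r2 r3] : r o2 = 0 /\ r o3 = 0.
  apply: cr; rewrite -[RHS](dir (fun l => (l == inord 1)%:R)) sum4 /realcoord /=.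
  rewrite (_ : (0 %/ 2 = 0)%N) // (_ : (1 %/ 2 = 0)%N) //.
  rewrite (_ : (2 %/ 2 = 1)%N) // (_ : (3 %/ 2 = 1)%N) // !eqd //=.
  by rewrite !(subr0, addr0, mul0r, add0r).
move=> j; rewrite -/(r j); case: j => [[|[|[|[|]]]] // hj].
- by rewrite -[RHS]r0; congr r; apply: val_inj.
- by rewrite -[RHS]r1; congr r; apply: val_inj.
- by rewrite -[RHS]r2; congr r; apply: val_inj.
- by rewrite -[RHS]r3; congr r; apply: val_inj.
Qed.

Lemma two_curves_singular (P : {mpoly R[4]}) (p : 'I_4 -> R) (g1 g2 : subset_of C 2) :
  irreducible_plane_curve g1 -> irreducible_plane_curve g2 ->
  (exists q, regular_point g1 q /\ iotaC q = p) ->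
  (forall z, g1 z -> real_zero_set P (iotaC z)) ->
  (exists q, regular_point g2 q /\ iotaC q = p) ->
  (forall z, g2 z -> real_zero_set P (iotaC z)) ->
  (forall z, g1 z <-> g2 z) \/ forall j, (P^`M(j)).@[p] = 0.
Proof.
move=> [i1 _] [i2 _] [q [[g1q [f1 [if1 e1 _]]] qp]] P1 [q' [[g2q [f2 [if2 e2 _]]] qp']] P2.
have eq : q' = q by apply: iotaC_inj; rewrite qp qp'.
rewrite {q' qp'}eq in g2q.
have diag g : (forall z, g z -> real_zero_set P (iotaC z)) ->
    forall z, g z -> (polarize P).@[joinpt z (conjpt z)] = 0.
  move=> hP z gz; rewrite polarizeE realcoord_conj complexify_eval.
  by rewrite (hP z gz).
have [|[h hh]] := segre_curves i1 i2 if1 if2 e1 e2 g1q g2q (diag _ P1) (diag _ P2).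
  by left.
right; apply: (singular_of_double_zero qp _ _ hh); [exact/e1|exact/e2].
Qed.

End TwoCurves.

(** * The singular points of a real hypersurface *)

Lemma map_mpoly_degle (F K : fieldType) (f : {rmorphism F -> K}) n d (p : {mpoly F[n]}) :
  degle d p -> degle d (map_mpoly f p).
Proof.
move=> dp; rewrite (map_mpolyE f dp); apply: degle_sum => m _.
by apply/degleZ/degleXm; rewrite -ltnS; apply: bmdeg.
Qed.

Lemma poly_filt_deriv (A : comNzRingType) (D : nat -> A -> Prop) d (q : {poly A}) :
  filtration D -> poly_filt D d q -> poly_filt D d q^`().
Proof.
move=> hD [sq hq]; split=> [|i]; last first.
  rewrite coef_deriv -mulr_natl -[d]add0n; apply: filtM => //.
  elim: (i.+1) => [|j IH]; first exact: filt0.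
  by rewrite -addn1 natrD; apply: filtD => //; apply: filt1.
have [->|q0] := eqVneq q 0; first by rewrite deriv0 size_poly0.
exact: leq_trans (ltnW (lt_size_deriv q0)) sq.
Qed.

Section TowerShear.
Variables (K : numClosedFieldType) (v : pt K 4) (u : pt K 3).
Hypotheses (v0 : v ord_max != 0) (u0 : u ord_max != 0).

(** Both normalizations in one change of coordinates: [u] acts on the first three coordinates, the
    base of the other shear, then [v] on all four. *)
Definition shear2 : 4.-tuple {mpoly K[4]} :=
  [tuple tnth (shear_tuple v) i \mPo
     [tuple snoc (fun k => tnth (shear_tuple u) k \mPo [tuple 'X_(widen1 j) | j < 3])
        'X_ord_max l | l < 4] | i < 4].

Definition unshear2 : 4.-tuple {mpoly K[4]} :=
  [tuple snoc (fun k => tnth (unshear_tuple u) k \mPo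
      [tuple tnth (unshear_tuple v) (widen1 l) | l < 3])
     (tnth (unshear_tuple v) ord_max) j | j < 4].

Lemma shear2E x : mpoly_map shear2 x = shear v (snoc (shear u (init x)) (x ord_max)).
Proof.
apply/funext => i; rewrite /mpoly_map tnth_mktuple comp_mpoly_meval tnth_shear_eval.
congr (shear v _ i); apply/funext => l; rewrite tnth_mktuple meval_snoc mevalXU.
congr (snoc _ _ l); apply/funext => k; rewrite comp_mpoly_meval tnth_shear_eval.
by congr (shear u _ k); apply/funext => j; rewrite tnth_mktuple mevalXU.
Qed.

Lemma unshear2E x :
  mpoly_map unshear2 x = snoc (unshear u (init (unshear v x))) (unshear v x ord_max).
Proof.
apply/funext => j; rewrite /mpoly_map tnth_mktuple meval_snoc tnth_unshear_eval.
congr (snoc _ _ j); apply/funext => k; rewrite comp_mpoly_meval tnth_unshear_eval.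
by congr (unshear u _ k); apply/funext => l; rewrite tnth_mktuple tnth_unshear_eval.
Qed.

Lemma shear2K x : mpoly_map shear2 (mpoly_map unshear2 x) = x.
Proof. by rewrite shear2E unshear2E snocK snoc_max unshearK // snoc_init unshearK. Qed.

Lemma unshear2K x : mpoly_map unshear2 (mpoly_map shear2 x) = x.
Proof. by rewrite shear2E unshear2E shearK // snocK snoc_max shearK // snoc_init. Qed.

Lemma shear2_degle i : degle 1 (tnth shear2 i).
Proof.
rewrite tnth_mktuple; apply: degle_comp (shear_tuple_degle _ _) => l.
rewrite tnth_mktuple; apply: snoc_degle => [k|]; last exact: degleX.
apply: degle_comp (shear_tuple_degle _ _) => j; rewrite tnth_mktuple.
exact: degleX.
Qed.

Lemma unshear2_degle i : degle 1 (tnth unshear2 i).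
Proof.
rewrite tnth_mktuple; apply: snoc_degle => [k|]; last exact: unshear_tuple_degle.
apply: degle_comp (unshear_tuple_degle _ _) => j; rewrite tnth_mktuple.
exact: unshear_tuple_degle.
Qed.

End TowerShear.

Section Singular.
Variable R : realType.
Local Notation C := R[i].
Local Notation toC := (real_complex R).

(** [normp_filt] for a polynomial and its derivative, plus one for the extra coordinate factor. *)
Definition discriminant_degree D := (D * (D + D * D)).+1.

(** At most [dQ * dP] components, the length of a fibre list, times the bound for one component. The
    sums in [dP] and [dQ] turn separate bounds on variable and coefficients into total degrees. *)
Definition degree_bound D :=
  let dP := (D + D)%N in
  let dQ := (discriminant_degree D + discriminant_degree D)%N in
  ((dQ * dP) * component_bound (tower_deg dP dQ))%N.

Lemma toC_shear n (v x : pt R n.+1) :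
  shear (fun j => toC (v j)) (fun j => toC (x j)) = fun j => toC (shear v x j).
Proof.
apply/funext => i; rewrite /shear rmorphD rmorphM.
by case: ifP => _; rewrite ?rmorph0.
Qed.

Lemma toC_unshear n (v x : pt R n.+1) : v ord_max != 0 ->
  unshear (fun j => toC (v j)) (fun j => toC (x j)) = fun j => toC (unshear v x j).
Proof.
move=> v0; rewrite -{1}(unshearK x v0) -toC_shear shearK //.
by apply: contra_neq v0 => /complexI.
Qed.

Lemma toC_poly_eval n (q : {poly {mpoly R[n]}}) (a : pt R n) t :
  (map_poly (meval (fun j => toC (a j))) (map_poly (map_mpoly toC) q)).[toC t] =
  toC ((map_poly (meval a) q).[t]).
Proof.
rewrite -horner_map -!map_poly_comp; congr (_.[_]); apply: eq_map_poly => c /=.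
exact: complexify_eval.
Qed.

(* [N] is the discriminant of [P] in the direction [v], multiplied by a coordinate
   so that it is never constant. *)
Lemma discriminant_exists D (P : {mpoly R[4]}) : prime_elt P -> degle D P ->
  exists (v : pt R 4) (p : {poly {mpoly R[3]}}) (N : {mpoly R[3]}),
   [/\ v ord_max != 0, p \is monic, (1 < size p)%N & poly_filt (@degle R 3) D p] /\
   [/\ N != 0, (1 < msize N)%N, degle (discriminant_degree D) N &
     forall x : pt R 4, P.@[x] = 0 -> (forall j, (P^`M(j)).@[x] = 0) ->
       (map_poly (meval (init (unshear v x))) p).[unshear v x ord_max] = 0 /\
       N.@[init (unshear v x)] = 0].
Proof.
move=> pP dP; have [v [v0 _ [c [p [c0 ep [pp pm sp dp]]]]]] :=
  prime_monic_shear pP (oner_neq0 _) dP.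
pose N0 := normp p p^`().
have p0 : p != 0 by apply: monic_neq0.
(* In characteristic 0 a monic nonconstant polynomial has a nonzero derivative. *)
have dp0 : p^`() != 0.
  apply/eqP => /(congr1 (fun q : {poly {mpoly R[3]}} => q`_(size p).-2)).
  have -> : p^`()`_(size p).-2 = ((size p).-1)%:R.
    have := monicP pm; rewrite lead_coefE coef_deriv.
    by case: (size p) sp => [|[|k]] //= _ ->.
  rewrite coef0 => /(congr1 (meval (fun=> 0))); rewrite rmorph_nat meval0.
  by apply/eqP; rewrite pnatr_eq0; case: (size p) sp => [|[|k]].
(* A zero norm would make the prime [p] divide its derivative, which has smaller degree. *)
have N00 : N0 != 0.
  apply/eqP => /(normp_eq0_dvd pm sp)[w [q [w0 sw e]]].
  have [g eg] := prime_small_divides pp w0 sw (ex_intro _ q e).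
  have g0 : g != 0 by apply: contra_neq dp0 => h; rewrite eg h mul0r.
  have := lt_size_deriv p0; rewrite eg (size_mul g0 p0) (polySpred g0) addSn /=.
  by rewrite ltnNge leq_addl.
have X0 : 'X_ord_max != 0 :> {mpoly R[3]} by rewrite -msize_poly_eq0 msizeX mdeg1.
exists v, p, (N0 * 'X_ord_max); split=> //; split.
- by rewrite mulf_neq0.
- by rewrite msizeM // msizeX mdeg1 addnS /= addn1 ltnS lt0n msize_poly_eq0.
- have -> : discriminant_degree D = (D * (D + D * D) + 1)%N by rewrite addn1.
  apply: degleM (degleX _ _).
  apply: (normp_filt (degle_filtration R 3) sp dp).
  exact: poly_filt_deriv (degle_filtration R 3) dp.
move=> x Px dPx; set y := unshear v x.
have shy : shear v y = x by rewrite /y unshearK.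
have py : (map_poly (meval (init y)) p).[y ord_max] = 0.
  by rewrite ep sheared_eval shy Px mulr0.
split=> //; rewrite mevalM; suff -> : N0.@[init y] = 0 by rewrite mul0r.
(* The last sheared coordinate runs along [v], so the derivative of [p] is, up to the constant [c],
   the derivative of [P] in the direction [v]. *)
have dpy : (map_poly (meval (init y)) p^`()).[y ord_max] = 0.
  pose o : pt R 4 := fun j => if j == ord_max then 0 else y j.
  have eL : map_poly (meval (init y)) p = c *: line o v P.
    apply: poly_eval_eq => s; rewrite hornerZ line_eval.
    transitivity ((map_poly (meval (init (snoc (init y) s))) p).[snoc (init y) s ord_max]).
      by rewrite snocK snoc_max.
    rewrite ep sheared_eval; congr (_ * _); apply: meval_eq => j.
    rewrite /shear snoc_max /o; have [->|[k ->]] := ord_maxVwiden j; first by rewrite eqxx.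
    by rewrite snoc_widen.
  rewrite -deriv_map eL derivZ hornerZ line_deriv big1 ?mulr0 // => j _.
  rewrite (meval_eq (v2 := x)) ?dPx ?mulr0 // => l.
  by rewrite -{1}shy.
(* The product formula for the norm lives over a closed field, so the real value is computed among
   the complex numbers. *)
apply: (@complexI R); rewrite -complexify_eval.
pose ev : {rmorphism {mpoly R[3]} -> C} :=
  meval (fun j => toC (init y j)) \o map_mpoly toC.
have evE (q : {poly {mpoly R[3]}}) t : (map_poly ev q).[toC t] =
    toC ((map_poly (meval (init y)) q).[t]).
  by rewrite -toC_poly_eval -map_poly_comp.
rewrite -[LHS]/(ev N0) -normp_map // normp_rootseq ?monic_map ?size_map_monic //.
apply/eqP; rewrite prodf_seq_eq0; apply/hasP; exists (toC (y ord_max)).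
  by rewrite mem_rootseq ?monic_map // /root [_.[_]]evE py.
by rewrite /= [_.[_]]evE dpy.
Qed.

(** Primality of [P] is known over the reals, so the discriminant and both directions are real. What
    the tower needs, monic equations of bounded degree, survives the extension to the complex
    numbers. *)
Lemma singular_cover D (P : {mpoly R[4]}) : prime_elt P -> degle D P ->
  exists Y : subset_of C 4,
    [/\ zariski_closed Y, dim_le Y 2,
      exists e, variety_degree Y e /\ (e <= degree_bound D)%N &
      forall x, P.@[x] = 0 -> (forall j, (P^`M(j)).@[x] = 0) -> Y (complexify x)].
Proof.
move=> pP dP.
have [v [p [N [[v0 pm sp dp] [N0 sN dN hN]]]]] := discriminant_exists pP dP.
have [u [c [u0 _ c0 qm sq]]] := monic_shear N0 (oner_neq0 _).
set q := c%:MP *: muni (N \mPo shear_tuple u) in qm.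
have sq1 : (1 < size q)%N by rewrite /q size_scale ?mpolyC_eq0 // sq.
have dq : poly_filt (@degle R 2) (discriminant_degree D) q.
  have [s1 h1] : poly_filt (@degle R 2) (discriminant_degree D) (muni (N \mPo shear_tuple u)).
    by apply/muni_filt/degle_comp => // i; apply: shear_tuple_degle.
  split=> [|i]; first by apply: leq_trans (size_scale_leq _ _) s1.
  by rewrite /q coefZ mul_mpolyC; apply/degleZ.
pose vC : pt C 4 := fun j => toC (v j); pose uC : pt C 3 := fun j => toC (u j).
have vC0 : vC ord_max != 0 by apply: contra_neq v0 => /complexI.
have uC0 : uC ord_max != 0 by apply: contra_neq u0 => /complexI.
pose pC := map_poly (map_mpoly toC) p; pose qC := map_poly (map_mpoly toC) q.
have pCm : pC \is monic by apply: monic_map.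
have qCm : qC \is monic by apply: monic_map.
(* The coefficients of [pC] involve the three coordinates that the second shear changes, so they are
   rewritten in the new ones. *)
pose Ph : {mpoly C[4]} := munV (map_poly (comp_mpoly (shear_tuple uC)) pC).
pose Qh : {mpoly C[3]} := munV qC.
have dPh : degle (D + D) Ph.
  have [s1 h1] := dp; apply: munV_degle => [i|]; last first.
    by rewrite size_map_monic // size_map_monic.
  rewrite !coef_map; apply: degle_comp; first exact: shear_tuple_degle.
  exact: map_mpoly_degle.
have dQh : degle (discriminant_degree D + discriminant_degree D) Qh.
  have [s1 h1] := dq; apply: munV_degle => [i|]; last by rewrite size_map_monic.
  by rewrite coef_map; apply: map_mpoly_degle.
have mPh : muni Ph \is monic by rewrite munVK; apply: monic_map.
have mQh : muni Qh \is monic by rewrite munVK.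
have sPh : size (muni Ph) = size p by rewrite munVK !size_map_monic.
have sQh : size (muni Qh) = size q by rewrite munVK size_map_monic.
have sPh1 : (1 < size (muni Ph))%N by rewrite sPh.
have sQh1 : (1 < size (muni Qh))%N by rewrite sQh.
have hY := tower_cover (shear2K vC0 uC0) (unshear2K vC0 uC0) (shear2_degle vC uC)
  mPh mQh sPh1 sQh1 dPh dQh.
set Y := tower_set (unshear2 vC uC) Ph Qh in hY.
have cY : zariski_closed Y.
  apply: closedI.
    apply: closed_ext (closed_zero (Ph \mPo unshear2 vC uC)) => x.
    by rewrite comp_eval.
  apply: closed_ext (closed_zero (Qh \mPo [tuple tnth (unshear2 vC uC) (widen1 l) | l < 3])) => x.
  rewrite comp_eval (meval_eq (v2 := init (mpoly_map (unshear2 vC uC) x))) // => l.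
  by rewrite /mpoly_map tnth_mktuple.
exists Y; split=> //.
- exact: cover_dim_le hY.
- have dpi i : degle 1 (tnth (tower_proj (unshear2 vC uC)) i).
    by rewrite tnth_mktuple; apply: unshear2_degle.
  have [e [he le]] := cover_variety_degree hY dpi cY.
  exists e; split=> //; apply: leq_trans le _; rewrite /degree_bound leq_mul2r.
  apply/orP; right; rewrite /tower_size; apply: leq_mul.
    by have := size_muni dQh; case: (size _).
  rewrite size_map_monic //.
  by have := size_muni dPh; case: (size _).
move=> x Px dPx; have [px Nx] := hN x Px dPx.
have -> : complexify x = fun j => toC (x j) by [].
rewrite /Y /tower_set unshear2E toC_unshear //.
set y := unshear v x in px Nx *.
have -> : init (fun j => toC (y j)) = fun j => toC (init y j) by [].
rewrite toC_unshear // snocK; split.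
  rewrite munV_eval snocK snoc_max -map_poly_comp.
  transitivity ((map_poly (meval (fun j => toC (init y j))) pC).[toC (y ord_max)]).
    congr (_.[_]); apply: eq_map_poly => r /=; rewrite shear_eval.
    by rewrite toC_shear unshearK.
  by rewrite toC_poly_eval px.
rewrite munV_eval; set z := unshear u _.
transitivity ((map_poly (meval (fun j => toC (init z j))) qC).[toC (z ord_max)]) => //.
by rewrite toC_poly_eval /q sheared_eval /z unshearK // Nx mulr0.
Qed.

End Singular.

Theorem theorem3p3 :
  exists Cst : nat -> nat,
  forall (R : realType) (D : nat) (P : {mpoly R[4]}),
    irreducible_mpoly P -> (msize P <= D.+1)%N ->
    exists Y : subset_of R[i] 4,
      [/\ zariski_closed Y, dim_le Y 2,
          (exists d, variety_degree Y d /\ (d <= Cst D)%N) &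
          forall p : 'I_4 -> R,
            real_zero_set P p -> ~ Y (complexify p) ->
            forall g1 g2 : subset_of R[i] 2,
              irreducible_plane_curve g1 -> irreducible_plane_curve g2 ->
              (exists q, regular_point g1 q /\ iotaC q = p) ->
              (forall z, g1 z -> real_zero_set P (iotaC z)) ->
              (exists q, regular_point g2 q /\ iotaC q = p) ->
              (forall z, g2 z -> real_zero_set P (iotaC z)) ->
              forall z, g1 z <-> g2 z].
Proof.
exists degree_bound => R D P irrP dP.
have [Y [cY dY vY hY]] := singular_cover (irreducible_mpoly_prime irrP) dP.
exists Y; split=> // p Pp nYp g1 g2 i1 i2 r1 h1 r2 h2.
have [//|sing] := two_curves_singular i1 i2 r1 h1 r2 h2.
by case: nYp; apply: hY.
Qed.
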